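(* Let $X=(X_n)_{n\ge 0}$ be an ergodic Markov chain with values in a finite set $\mathbb{S}=\{a_1,\dots,a_d\}\subset\mathbb{R}$, with transition matrix $\Lambda=(\lambda_{ij})$, $\lambda_{ij}=\mathrm{P}(X_n=a_j\mid X_{n-1}=a_i)$, initial distribution $\nu$ and invariant distribution $\mu$. Let $h:\mathbb{S}\to\mathbb{R}$, let $(\xi_n)_{n\ge1}$ be i.i.d. standard Gaussian random variables independent of $X$, and for $\sigma>0$ let $Y^\sigma_n=h(X_n)+\sigma\xi_n$, $n\ge1$. Let $\mathcal{M}^\sigma_\pi$ be the unique invariant probability measure of the filtering process $\pi^\sigma_n$ on the simplex $\mathcal{S}^{d-1}$, and let $\mathcal{P}^\sigma$ be the steady-state minimal error probability. Let $P$ be the unique solution, in the class of nonnegative definite matrices with $\sum_{i,j}P_{ij}=0$, of $$P=\Lambda^*P\Lambda+\big(\mathrm{diag}(\mu)-\mu\mu^*\big)hh^*\big(\mathrm{diag}(\mu)-\mu\mu^*\big),$$ and let $Z=(Z_1,\dots,Z_d)$ be a zero mean Gaussian vector with covariance matrix $P$. Then for any continuous function $F:\mathbb{R}^d\to\mathbb{R}$ growing not faster than polynomially, $$\int_{\mathcal{S}^{d-1}}F\big(\sigma(\eta-\mu)\big)\,\mathcal{M}^\sigma_\pi(d\eta)\longrightarrow\mathrm{E}F(Z)\quad\text{as }\sigma\to\infty .$$ In particular $$\lim_{\sigma\to\infty}\sigma\big(\mathcal{P}^\infty-\mathcal{P}^\sigma\big)=\mathrm{E}\max_{j\in\mathcal{J}}Z_j,$$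 where $\mathcal{P}^\infty:=1-\max_i\mu_i$ is the a priori error probability and $\mathcal{J}=\{i:\mu_i=\max_j\mu_j\}$. If $\mu$ has a unique maximal atom (i.e. $\mathcal{J}$ is a singleton), then for any integer $p\ge1$ $$\lim_{\sigma\to\infty}\sigma^p\big(\mathcal{P}^\infty-\mathcal{P}^\sigma\big)=0 .$$
   Context: Probability measures on $\mathbb{S}$ are identified with column vectors in $\mathcal{S}^{d-1}=\{x\in\mathbb{R}^d:x_i\ge0,\ \sum_i x_i=1\}$, and functions on $\mathbb{S}$ with column vectors in $\mathbb{R}^d$; in particular $h$ also denotes the column vector with entries $h(a_i)$. The superscript $*$ denotes transposition, $|x|=\sum_i|x_i|$, and $\mathrm{diag}(x)$ is the diagonal matrix with diagonal entries $x_i$. The chain $X$ is ergodic if the limits $\mu_i=\lim_{n\to\infty}\mathrm{P}(X_n=a_i)$ exist, are unique (independent of $\nu$) and positive; equivalently, $\Lambda^q$ has positive entries for some integer $q\ge1$. Then $\mu$ is the unique solution of $\Lambda^*\mu=\mu$ in $\mathcal{S}^{d-1}$. Let $g(x)=(2\pi)^{-1/2}e^{-x^2/2}$, $\mathcal{F}^{Y^\sigma}_n=\sigma\{Y^\sigma_m:1\le m\le n\}$ and $\pi^\sigma_n(i)=\mathrm{P}(X_n=a_i\mid\mathcal{F}^{Y^\sigma}_n)$. The vector $\pi^\sigma_n$ satisfies $$\pi^\sigma_n=\frac{G^\sigma(Y^\sigma_n)\Lambda^*\pi^\sigma_{n-1}}{|G^\sigma(Y^\sigma_n)\Lambda^*\pi^\sigma_{n-1}|},\qquad\pi^\sigma_0=\nu,$$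 where $G^\sigma(y)$ is the diagonal matrix with entries $g((y-h(a_i))/\sigma)$. It is a Markov process on $\mathcal{S}^{d-1}$: from state $\eta$ it moves to $G^\sigma(y)\Lambda^*\eta/|G^\sigma(y)\Lambda^*\eta|$, with $y$ drawn from the density $\sigma^{-1}|G^\sigma(y)\Lambda^*\eta|$ on $\mathbb{R}$. For ergodic $X$ it is known that this process has a unique invariant probability measure, denoted $\mathcal{M}^\sigma_\pi$. The minimal error probability at time $n$ is $$\mathcal{P}^\sigma_n=\min_{\theta}\mathrm{P}(X_n\ne\theta)=1-\mathrm{E}\max_i\pi^\sigma_n(i),$$ the minimum being over bounded $\mathcal{F}^{Y^\sigma}_n$-measurable random variables $\theta$, and $\mathcal{P}^\sigma:=\lim_{n\to\infty}\mathcal{P}^\sigma_n$; for ergodic $X$ this limit is known to exist and not to depend on $\nu$. *)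

(* Defs.v *)
From HB Require Import structures.
From mathcomp Require Import all_boot all_order all_algebra finmap.
From mathcomp Require Import all_classical all_reals all_analysis.

Set Implicit Arguments.
Unset Strict Implicit.
Unset Printing Implicit Defensive.

Import Order.TTheory GRing.Theory Num.Theory.
Import numFieldNormedType.Exports.

Local Open Scope classical_set_scope.
Local Open Scope ring_scope.

Definition simplex (R : realType) (d : nat) : set 'cV[R]_d :=
  [set x | (forall i, 0 <= x i 0) /\ \sum_i x i 0 = 1].

Definition l1norm (R : realType) (d : nat) (x : 'cV[R]_d) : R :=
  \sum_i `|x i 0|.

(* R^d with its Borel sigma-algebra, generated by the open sets. *)
Definition borel_cV (R : realType) (d : nat) :=
  g_sigma_algebraType (@open 'cV[R]_d).

(* The maximum of f over the finite index set J. The value is meaningful for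
   nonempty J only; no sign condition on f is needed, unlike for a big operator
   with default value 0. *)
Definition max_over (R : realType) (d : nat) (J : set 'I_d) (f : 'I_d -> R) : R :=
  sup (f @` J).

Definition poly_growth (R : realType) (d : nat) (F : 'cV[R]_d -> R) : Prop :=
  exists (C : R) (k : nat), forall x, `|F x| <= C * (1 + l1norm x) ^+ k.

Definition stochastic_mx (R : realType) (d : nat) (Lam : 'M[R]_d) : Prop :=
  (forall i j, 0 <= Lam i j) /\ (forall i, \sum_j Lam i j = 1).

(* [Lam^T ^+ n *m nu] is the vector of the probabilities P(X_n = a_i) for the
   chain started from nu; the limit mu must not depend on nu. *)
Definition ergodic (R : realType) (d : nat) (Lam : 'M[R]_d) : Prop :=
  exists mu : 'cV[R]_d, (forall i, 0 < mu i 0) /\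
    forall nu, simplex nu ->
      forall i, (Lam^T ^+ n *m nu) i 0 @[n --> \oo] --> mu i 0.

Definition invariant_distr (R : realType) (d : nat) (Lam : 'M[R]_d)
    (mu : 'cV[R]_d) : Prop :=
  simplex mu /\ Lam^T *m mu = mu.

(* The state with index i is the real number [a i]. The Markov property
   P(X_{n+1} = a_j | X_0 = a_{s 0}, ..., X_n = a_{s n}) = Lam_{s n, j}
   is written with the denominator cleared. *)
Definition markov_chain (R : realType) (dT : measure_display)
    (T : measurableType dT) (P : probability T R) (d : nat) (a : 'I_d -> R)
    (Lam : 'M[R]_d) (nu : 'cV[R]_d) (X : nat -> {RV P >-> R}) : Prop :=
  [/\ forall n w, range a (X n w),
      forall i, P [set w | X 0%N w = a i] = (nu i 0)%:E &
      forall (n : nat) (s : nat -> 'I_d) (j : 'I_d),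
        (P [set w | (forall k, (k <= n)%N -> X k w = a (s k)) /\
                    X n.+1 w = a j] =
         (Lam (s n) j)%:E *
           P [set w | forall k, (k <= n)%N -> X k w = a (s k)])%E].

Definition sigma_of (R : realType) (T : Type) (I : set nat)
    (Z : nat -> T -> R) : set (set T) :=
  <<s \bigcup_(m in I) preimage_set_system [set: T] (Z m) measurable >>.

Definition indep_processes (R : realType) (dT : measure_display)
    (T : measurableType dT) (P : probability T R)
    (I : set nat) (X : nat -> T -> R) (J : set nat) (Y : nat -> T -> R) : Prop :=
  forall A B, sigma_of I X A -> sigma_of J Y B -> (P (A `&` B) = P A * P B)%E.

Definition mutually_indep (R : realType) (dT : measure_display)
    (T : measurableType dT) (P : probability T R)
    (I : set nat) (Z : nat -> T -> R) : Prop :=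
  forall (J : {fset nat}) (B : nat -> set R),
    [set` J] `<=` I -> (forall m, measurable (B m)) ->
    (P (\bigcap_(m in [set` J]) (Z m @^-1` B m)) =
       \prod_(m <- J) P (Z m @^-1` B m))%E.

(* (xi_n)_{n >= 1} is i.i.d. N(0,1); xi_0 is not constrained. *)
Definition std_gaussian_noise (R : realType) (dT : measure_display)
    (T : measurableType dT) (P : probability T R) (xi : nat -> {RV P >-> R}) :
    Prop :=
  mutually_indep P [set m | (1 <= m)%N] xi /\
  forall m, (1 <= m)%N -> forall B : set R, measurable B ->
    distribution P (xi m) B = normal_prob 0 1 B.

(* h is only evaluated on the state space. *)
Definition obs (R : realType) (T : Type) (h : R -> R) (sigma : R)
    (X xi : nat -> T -> R) (n : nat) (w : T) : R :=
  h (X n w) + sigma * xi n w.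

(* The minimum of P(X_n <> theta) over the bounded theta that are measurable with
   respect to Y_1, ..., Y_n. *)
Definition min_error (R : realType) (dT : measure_display)
    (T : measurableType dT) (P : probability T R)
    (X Y : nat -> T -> R) (n : nat) : R :=
  inf [set fine (P [set w | X n w <> theta w]) | theta in
    [set theta : T -> R | [bounded theta w | w in [set: T]] /\
       forall B : set R, measurable B ->
         sigma_of [set m | (1 <= m <= n)%N] Y (theta @^-1` B)]].

Definition prior_error (R : realType) (d : nat) (mu : 'cV[R]_d) : R :=
  1 - max_over [set: 'I_d] (fun i => mu i 0).

Definition maximal_atoms (R : realType) (d : nat) (mu : 'cV[R]_d) : set 'I_d :=
  [set i | mu i 0 = max_over [set: 'I_d] (fun j => mu j 0)].

(* hv is the vector with entries h(a_i). *)
Definition obs_mx (R : realType) (d : nat) (hv : 'cV[R]_d) (sigma y : R) :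
    'M[R]_d :=
  diag_mx (\row_i normal_pdf 0 1 ((y - hv i 0) / sigma)).

Definition filter_unnorm (R : realType) (d : nat) (Lam : 'M[R]_d)
    (hv : 'cV[R]_d) (sigma y : R) (eta : 'cV[R]_d) : 'cV[R]_d :=
  obs_mx hv sigma y *m Lam^T *m eta.

Definition filter_step (R : realType) (d : nat) (Lam : 'M[R]_d)
    (hv : 'cV[R]_d) (sigma y : R) (eta : 'cV[R]_d) : 'cV[R]_d :=
  (l1norm (filter_unnorm Lam hv sigma y eta))^-1 *:
    filter_unnorm Lam hv sigma y eta.

Definition filter_kernel (R : realType) (d : nat) (Lam : 'M[R]_d)
    (hv : 'cV[R]_d) (sigma : R) (eta : 'cV[R]_d) (A : set 'cV[R]_d) : \bar R :=
  (\int[lebesgue_measure]_(y in [set y | A (filter_step Lam hv sigma y eta)])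
     (sigma^-1 * l1norm (filter_unnorm Lam hv sigma y eta))%:E)%E.

(* A probability measure on the simplex is a Borel probability measure on R^d
   that gives mass 1 to it. *)
Definition filter_invariant (R : realType) (d : nat) (Lam : 'M[R]_d)
    (hv : 'cV[R]_d) (sigma : R) (M : probability (borel_cV R d) R) : Prop :=
  M (@simplex R d) = 1%E /\
  forall A : set (borel_cV R d), measurable A ->
    M A = (\int[M]_(eta in @simplex R d) filter_kernel Lam hv sigma eta A)%E.

Definition nonneg_definite (R : realType) (d : nat) (C : 'M[R]_d) : Prop :=
  C^T = C /\ forall x : 'cV[R]_d, 0 <= (x^T *m C *m x) 0 0.

Definition limit_covariance (R : realType) (d : nat) (Lam : 'M[R]_d)
    (mu hv : 'cV[R]_d) (C : 'M[R]_d) : Prop :=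
  let D := diag_mx mu^T - mu *m mu^T in
  [/\ nonneg_definite C, \sum_i \sum_j C i j = 0 &
      C = Lam^T *m C *m Lam + D *m hv *m hv^T *m D].

(* The normal law with mean m and variance v >= 0. The case v = 0 is separate
   because [normal_prob m 0] is not a point mass. *)
Definition normal_law (R : realType) (m v : R) : set R -> \bar R :=
  if v == 0 then \d_m else normal_prob m (Num.sqrt v).

(* Z is Gaussian: every linear combination of the Z_i has a (possibly
   degenerate) normal law. *)
Definition centered_gaussian (R : realType) (dT : measure_display)
    (T : measurableType dT) (Q : probability T R) (d : nat) (C : 'M[R]_d)
    (Z : 'I_d -> {RV Q >-> R}) : Prop :=
  [/\ forall u : 'I_d -> R, exists m v : R, 0 <= v /\
        forall B : set R, measurable B ->
          Q [set w | B (\sum_i u i * Z i w)] = normal_law m v B,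
      forall i, ('E_Q[Z i] = 0)%E &
      forall i j, covariance Q (Z i) (Z j) = (C i j)%:E].

(* Main.v *)
(** Put [e = 1 / sigma] and rescale the observation to [u = e * y]. Relative to the standard normal
    law, [u] has the density [lik], and Bayes' rule gives, for the deviation
    [x_n = sigma (pi_n - mu)], the recursion [x_(n+1) = Lam^T x_n + u b + O(e)] with
    [b = (diag mu - mu mu^T) h]: the deviation is almost an autoregression with Gaussian noise.
    By ergodicity some power of [Lam^T] contracts the vectors with zero sum, which bounds all
    moments of [x_n] uniformly in large [sigma] and [n]. Iterating the one-step estimate for
    [cos (v . x + th)] yields the limit [cos th * exp (- v^T C v / 2)], and trigonometric
    polynomials are dense, in weighted supremum norms, among the continuous functions of
    polynomial growth. The estimates hold for every sequence of laws driven by the filter kernel,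
    hence both for the invariant law and for the filter started from [nu].

    The recursion computes the conditional law of [X_n], so the minimal error is
    [1 - E max_i pi_n(i)]. Up to [O(|x_n| (|x_n| / sigma)^q)] for every [q], the rescaled gain
    [sigma (max_i pi_n(i) - max_i mu_i)] is the maximum of [x_n] over the maximal atoms; if there is
    only one, the expectation of that coordinate vanishes as [n -> oo] because [E pi_n -> mu]. *)

Require Import Defs.
From HB Require Import structures.
From mathcomp Require Import all_boot all_order all_algebra finmap.
From mathcomp Require Import all_classical all_reals all_analysis.
From mathcomp Require Import measurable_realfun simple_functions zify ring lra.

Import Order.TTheory GRing.Theory Num.Theory.
Import numFieldNormedType.Exports.
Import HBNNSimple.

Local Open Scope classical_set_scope.
Local Open Scope ring_scope.

Set Implicit Arguments.
Unset Strict Implicit.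
Unset Printing Implicit Defensive.

(** * Ergodic contraction and the limit covariance *)

(** The error of one step is [O(e)] and accumulates under iteration, so the argument works only if
    the number [k] of iterated steps is fixed before [sigma] is sent to infinity. Ergodicity makes
    this possible: deviations from [mu] have zero sum, hence what [k] steps retain of the initial
    deviation is geometrically small relative to a first moment that is bounded uniformly in
    [sigma]. As [Lam^T] need not contract strictly in the l1 norm, moments are propagated in an
    equivalent norm in which a single step contracts.

    Weighted approximation on the whole space, together with uniform moments, replaces tightness and
    uniform integrability and reaches functions of polynomial growth directly. The approximants are
    Bernstein polynomials in the sines of the rescaled coordinates: they average values of the
    function over a box, so they stay bounded outside the box, where nothing is approximated.

    Both the characteristic function of the normal law and its second moment come from one source,
    Stein's identity, which is the first-order form of the Cameron-Martin formula. *)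

Lemma cvg_finsum (R : realType) (I T : Type) (F : set_system T) {FF : Filter F}
    (r : seq I) (f : I -> T -> R) (l : I -> R) :
  (forall i, f i x @[x --> F] --> l i) ->
  \sum_(i <- r) f i x @[x --> F] --> \sum_(i <- r) l i.
Proof.
move=> fl; elim: r => [|i r IH].
  by under eq_fun do rewrite big_nil; rewrite big_nil; exact: cvg_cst.
under eq_fun do rewrite big_cons.
by rewrite big_cons; apply: (@cvgD _ R^o).
Qed.

Section LinearAlgebra.
Context {R : realType} {d : nat}.
Implicit Types (x y v : 'cV[R]_d) (Lam : 'M[R]_d).

Definition dotp v x : R := \sum_i v i 0 * x i 0.

Definition total x : R := \sum_i x i 0.

Lemma dotpDr v x y : dotp v (x + y) = dotp v x + dotp v y.
Proof. by rewrite -big_split; apply: eq_bigr => i _; rewrite mxE mulrDr. Qed.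

Lemma dotpZr v c x : dotp v (c *: x) = c * dotp v x.
Proof. by rewrite mulr_sumr; apply: eq_bigr => i _; rewrite mxE mulrCA. Qed.

Lemma dotpBr v x y : dotp v (x - y) = dotp v x - dotp v y.
Proof. by rewrite -scaleN1r dotpDr dotpZr mulN1r. Qed.

Lemma dotpDl v w x : dotp (v + w) x = dotp v x + dotp w x.
Proof. by rewrite -big_split; apply: eq_bigr => i _; rewrite mxE mulrDl. Qed.

Lemma dotpZl v c x : dotp (c *: v) x = c * dotp v x.
Proof. by rewrite mulr_sumr; apply: eq_bigr => i _; rewrite mxE mulrA. Qed.

Lemma dotpBl v w x : dotp (v - w) x = dotp v x - dotp w x.
Proof. by rewrite -scaleN1r dotpDl dotpZl mulN1r. Qed.

Lemma dotpE v x : dotp v x = (v^T *m x) 0 0.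
Proof. by rewrite mxE; apply: eq_bigr => i _; rewrite mxE. Qed.

Lemma dotp_mul v (B : 'M[R]_d) x : dotp v (B *m x) = dotp (B^T *m v) x.
Proof. by rewrite !dotpE trmx_mul trmxK mulmxA. Qed.

Lemma totalD x y : total (x + y) = total x + total y.
Proof. by rewrite -big_split; apply: eq_bigr => i _; rewrite mxE. Qed.

Lemma totalZ c x : total (c *: x) = c * total x.
Proof. by rewrite mulr_sumr; apply: eq_bigr => i _; rewrite mxE. Qed.

Lemma totalB x y : total (x - y) = total x - total y.
Proof. by rewrite -scaleN1r totalD totalZ mulN1r. Qed.

Lemma l1norm_ge0 x : 0 <= l1norm x.
Proof. exact: sumr_ge0. Qed.

Lemma l1normD x y : l1norm (x + y) <= l1norm x + l1norm y.
Proof. by rewrite -big_split ler_sum// => i _; rewrite mxE ler_normD. Qed.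

Lemma l1normZ c x : l1norm (c *: x) = `|c| * l1norm x.
Proof. by rewrite mulr_sumr; apply: eq_bigr => i _; rewrite mxE normrM. Qed.

Lemma l1norm0 : l1norm (0 : 'cV[R]_d) = 0.
Proof. by apply: big1 => i _; rewrite mxE normr0. Qed.

Lemma l1normB x y : l1norm (x - y) <= l1norm x + l1norm y.
Proof. by rewrite (le_trans (l1normD _ _))// -scaleN1r l1normZ normrN1 mul1r. Qed.

Lemma coord_l1norm x i : `|x i 0| <= l1norm x.
Proof. by rewrite /l1norm (bigD1 i)//= lerDl sumr_ge0. Qed.

Lemma l1norm_sum (I : Type) (r : seq I) (F : I -> 'cV[R]_d) :
  l1norm (\sum_(k <- r) F k) <= \sum_(k <- r) l1norm (F k).
Proof.
elim/big_ind2 : _ => //; first by rewrite l1norm0.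
by move=> x a y b xa yb; rewrite (le_trans (l1normD _ _))// lerD.
Qed.

Lemma dotp_bound v x : `|dotp v x| <= l1norm v * l1norm x.
Proof.
rewrite (le_trans (ler_norm_sum _ _ _))// mulr_suml ler_sum// => i _.
by rewrite normrM ler_wpM2l// coord_l1norm.
Qed.

Lemma simplex_l1norm x : simplex x -> l1norm x = 1.
Proof. by move=> [x0 <-]; apply: eq_bigr => i _; rewrite ger0_norm. Qed.

Lemma simplex_sub_total x y : simplex x -> simplex y -> total (x - y) = 0.
Proof. by move=> [_ x1] [_ y1]; rewrite totalB /total x1 y1 subrr. Qed.

Lemma stoch_total Lam x : stochastic_mx Lam -> total (Lam^T *m x) = total x.
Proof.
move=> [_ L1]; rewrite /total; under eq_bigr do rewrite mxE.
rewrite exchange_big/=; apply: eq_bigr => i _.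
under eq_bigr do rewrite mxE.
by rewrite -mulr_suml L1 mul1r.
Qed.

Lemma stoch_l1norm Lam x :
  stochastic_mx Lam -> l1norm (Lam^T *m x) <= l1norm x.
Proof.
move=> [L0 L1]; rewrite /l1norm.
apply: (@le_trans _ _ (\sum_i \sum_j Lam j i * `|x j 0|)).
  apply: ler_sum => i _; rewrite mxE (le_trans (ler_norm_sum _ _ _))//.
  by apply: ler_sum => j _; rewrite normrM mxE ger0_norm.
rewrite exchange_big/= ler_sum// => j _.
by rewrite -mulr_suml L1 mul1r.
Qed.

Lemma stoch_simplex Lam x :
  stochastic_mx Lam -> simplex x -> simplex (Lam^T *m x).
Proof.
move=> LS [x0 x1]; split; last by have := stoch_total x LS; rewrite /total x1.
by case: LS => L0 _ i; rewrite mxE sumr_ge0// => j _; rewrite mxE mulr_ge0.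
Qed.

Lemma exprS_mulmx (B : 'M[R]_d) k x : B ^+ k.+1 *m x = B *m (B ^+ k *m x).
Proof. by rewrite exprS mulmxA. Qed.

Lemma exprSr_mulmx (B : 'M[R]_d) k x : B ^+ k.+1 *m x = B ^+ k *m (B *m x).
Proof. by rewrite exprSr mulmxA. Qed.

Lemma stoch_iter_total Lam n x :
  stochastic_mx Lam -> total (Lam^T ^+ n *m x) = total x.
Proof.
move=> LS; elim: n => [|n IH]; first by rewrite expr0 mul1mx.
by rewrite exprS_mulmx stoch_total.
Qed.

Lemma stoch_iter_l1norm Lam n x :
  stochastic_mx Lam -> l1norm (Lam^T ^+ n *m x) <= l1norm x.
Proof.
move=> LS; elim: n => [|n IH]; first by rewrite expr0 mul1mx.
by rewrite exprS_mulmx (le_trans (stoch_l1norm _ _)).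
Qed.

Lemma invariant_iter Lam mu n :
  invariant_distr Lam mu -> Lam^T ^+ n *m mu = mu.
Proof.
move=> [_ Lmu]; elim: n => [|n IH]; first by rewrite expr0 mul1mx.
by rewrite exprS_mulmx IH.
Qed.

Lemma delta_simplex (j : 'I_d) : simplex (delta_mx j 0 : 'cV[R]_d).
Proof.
split=> [i|]; first by rewrite mxE; case: (_ && _).
rewrite (bigD1 j)//= big1 ?addr0 ?mxE ?eqxx// => i ij.
by rewrite mxE (negbTE ij).
Qed.

Lemma col_delta_sum x : x = \sum_j x j 0 *: delta_mx j 0.
Proof.
apply/colP => i; rewrite summxE (bigD1 i)//= big1 ?addr0.
  by rewrite !mxE !eqxx mulr1.
by move=> j ji; rewrite !mxE eq_sym (negbTE ji) mulr0.
Qed.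

(** For [x] with zero sum, [Lam^T ^+ n *m x] is the combination of the differences
    [Lam^T ^+ n *m delta_mx j 0 - mu] with coefficients [x j 0], since the multiples of [mu] cancel.
    Ergodicity makes all these differences at most 1/2 for one common large [n]. *)
Lemma ergodic_contraction Lam mu : stochastic_mx Lam -> ergodic Lam ->
    invariant_distr Lam mu ->
  exists2 q : nat, (0 < q)%N & forall x, total x = 0 ->
    l1norm (Lam^T ^+ q *m x) <= 2^-1 * l1norm x.
Proof.
move=> LS [mu' [_ cvmu]] muI.
have mu'E : mu' = mu.
  apply/colP => i; have muS : simplex mu by case: muI.
  have /(cvg_lim (@Rhausdorff R)) <- := cvmu mu muS i.
  under eq_fun do rewrite (invariant_iter _ muI).
  by rewrite (lim_cst (@Rhausdorff R)).
have cv j : l1norm (Lam^T ^+ n *m delta_mx j 0 - mu) @[n --> \oo] --> (0 : R).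
  rewrite (_ : 0 = \sum_(i < d) (0 : R)); last by rewrite big1.
  rewrite /l1norm; apply: cvg_finsum => i.
  rewrite -(@normr0 _ R^o); apply: (@cvg_norm _ R^o).
  rewrite -(subrr (mu i 0)).
  under eq_fun do rewrite mxE [(- mu) i 0]mxE.
  apply: (@cvgB _ R^o); last exact: cvg_cst.
  by rewrite -mu'E; apply: cvmu; exact: delta_simplex.
have : \forall n \near \oo,
    forall j, l1norm (Lam^T ^+ n *m delta_mx j 0 - mu) <= 2^-1.
  apply: filter_forall => j.
  have := cvgr_le _ (cv j) 2^-1; apply.
  by rewrite invr_gt0.
(* The exponent has to be positive, hence [N.+1]. *)
move=> [N _ HN]; exists N.+1 => // x x0.
have -> : Lam^T ^+ N.+1 *m x =
    \sum_j x j 0 *: (Lam^T ^+ N.+1 *m delta_mx j 0 - mu).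
  rewrite {1}[x]col_delta_sum mulmx_sumr.
  under [RHS]eq_bigr do rewrite scalerBr.
  rewrite sumrB -scaler_suml.
  have -> : \sum_i x i 0 = 0 by [].
  rewrite scale0r subr0; apply: eq_bigr => j _.
  by rewrite -scalemxAr.
rewrite (le_trans (l1norm_sum _ _))// mulr_sumr ler_sum// => j _.
rewrite l1normZ mulrC ler_wpM2r//.
by apply: HN => /=; exact: leqnSn.
Qed.

Section AdaptedNorm.
Variables (Lam : 'M[R]_d) (q : nat).
Hypotheses (LS : stochastic_mx Lam) (q0 : (0 < q)%N).
Hypothesis Lq : forall x, total x = 0 ->
  l1norm (Lam^T ^+ q *m x) <= 2^-1 * l1norm x.

(** A norm equivalent to the l1 norm, built so that contraction after [q] steps becomes contraction
    at every step. *)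
Definition adapted_norm x := \sum_(k < q) l1norm (Lam^T ^+ k *m x).

Lemma adapted_norm_ge0 x : 0 <= adapted_norm x.
Proof. by apply: sumr_ge0 => k _; exact: l1norm_ge0. Qed.

Lemma le_adapted_norm x : l1norm x <= adapted_norm x.
Proof.
rewrite /adapted_norm (bigD1 (Ordinal q0))//= expr0 mul1mx lerDl.
by apply: sumr_ge0 => k _; exact: l1norm_ge0.
Qed.

Lemma adapted_norm_le x : adapted_norm x <= q%:R * l1norm x.
Proof.
rewrite /adapted_norm (@le_trans _ _ (\sum_(k < q) l1norm x))//.
  by apply: ler_sum => k _; exact: stoch_iter_l1norm.
by rewrite sumr_const card_ord mulr_natl.
Qed.

Lemma adapted_normD x y : adapted_norm (x + y) <= adapted_norm x + adapted_norm y.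
Proof.
rewrite -big_split ler_sum// => k _.
by rewrite mulmxDr l1normD.
Qed.

(** Shifting the orbit by one step exchanges the term [l1norm x] for the term of index [q], which is
    at most half of it. As the whole sum is at most [q%:R * l1norm x], the loss is a fixed
    proportion of the sum. *)
Lemma adapted_norm_contract x : total x = 0 ->
  adapted_norm (Lam^T *m x) <= (1 - (2 * q%:R)^-1) * adapted_norm x.
Proof.
move=> x0.
have -> : adapted_norm (Lam^T *m x) =
    adapted_norm x - l1norm x + l1norm (Lam^T ^+ q *m x).
  rewrite /adapted_norm; case: q q0 => // q' _.
  rewrite big_ord_recr/= [in RHS]big_ord_recl/= expr0 mul1mx -exprSr_mulmx.
  congr +%R; rewrite addrAC subrr add0r; apply: eq_bigr => i _.
  by rewrite -exprSr_mulmx.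
have := Lq x0; have := adapted_norm_le x.
have q0' : 0 < q%:R :> R by rewrite ltr0n.
move=> h1 h2; rewrite mulrBl mul1r.
suff : (2 * q%:R)^-1 * adapted_norm x <= 2^-1 * l1norm x by lra.
rewrite invfM -mulrA ler_wpM2l ?invr_ge0//.
by rewrite ler_pdivrMl.
Qed.

Lemma adapted_norm_iter n x : total x = 0 ->
  adapted_norm (Lam^T ^+ n *m x) <= (1 - (2 * q%:R)^-1) ^+ n * adapted_norm x.
Proof.
move=> x0; elim: n => [|n IH]; first by rewrite !expr0 mul1mx mul1r.
rewrite exprS_mulmx (le_trans (adapted_norm_contract _))//.
  by rewrite stoch_iter_total.
rewrite exprS -mulrA ler_wpM2l//.
rewrite subr_ge0 invf_le1 ?mulr_gt0 ?ltr0n//.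
by rewrite -natrM ler1n muln_gt0 q0.
Qed.

End AdaptedNorm.

End LinearAlgebra.

(** * Existence and uniqueness of the limit covariance *)

Lemma geometric_dominated_cvg (R : realType) (f : R^nat) (c r : R) :
  0 <= r -> r < 1 -> (forall k, `|f k| <= c * r ^+ k) -> cvg (series f @ \oo).
Proof.
move=> r0 r1 fle; apply: normed_cvg.
apply: (@series_le_cvg _ _ (geometric c r)) => [k|k|k|].
- exact: normr_ge0.
- exact: le_trans (normr_ge0 _) (fle k).
- exact: fle.
- by apply: is_cvg_geometric_series; rewrite ger0_norm.
Qed.

Section LimitCovariance.
Context {R : realType} {d : nat}.
Implicit Types (x y v mu : 'cV[R]_d) (Lam C : 'M[R]_d).

(** The derivative at [e = 0] of Bayes' rule with prior [mu], per unit of the rescaled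
    observation. *)
Definition drift mu hv : 'cV[R]_d := (diag_mx mu^T - mu *m mu^T) *m hv.

Lemma driftE mu hv i : drift mu hv i 0 = mu i 0 * (hv i 0 - dotp mu hv).
Proof.
rewrite /drift mulmxBl [LHS]mxE [X in _ + X]mxE -mulmxA mul_diag_mx !mxE.
rewrite mulrBr; congr (_ - _).
by rewrite (bigD1 ord0)//= big1 ?addr0 -?dotpE// => j; rewrite ord1.
Qed.

Lemma drift_total mu hv : simplex mu -> total (drift mu hv) = 0.
Proof.
move=> [_ mu1]; rewrite /total; under eq_bigr do rewrite driftE mulrBr.
by rewrite sumrB -mulr_suml mu1 mul1r /dotp subrr.
Qed.

Lemma drift_outer mu hv : drift mu hv *m (drift mu hv)^T =
  (diag_mx mu^T - mu *m mu^T) *m hv *m hv^T *m (diag_mx mu^T - mu *m mu^T).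
Proof.
rewrite /drift trmx_mul !mulmxA; congr (_ *m _).
by rewrite linearB/= tr_diag_mx trmx_mul trmxK.
Qed.

Lemma dotp_outer v x : dotp v (x *m x^T *m v) = dotp v x ^+ 2.
Proof.
rewrite dotpE -!mulmxA !mulmxA -(mulmxA _ x^T) expr2 [LHS]mxE.
rewrite (bigD1 ord0)//= big1 ?addr0; last by move=> j; rewrite ord1.
rewrite -!dotpE; congr (_ * _); rewrite /dotp.
by apply: eq_bigr => i _; rewrite mulrC.
Qed.

Lemma dotp_ones x : dotp (\col_i 1) x = total x.
Proof. by apply: eq_bigr => i _; rewrite mxE mul1r. Qed.

Lemma sum_mx_ones C : \sum_i \sum_j C i j = dotp (\col_i 1) (C *m \col_i 1).
Proof.
rewrite dotp_ones; apply: eq_bigr => i _; rewrite mxE.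
by apply: eq_bigr => j _; rewrite mxE mulr1.
Qed.

Lemma dotpC v x : dotp v x = dotp x v.
Proof. by apply: eq_bigr => i _; rewrite mulrC. Qed.

Lemma dotp_delta i x : dotp (delta_mx i 0) x = x i 0.
Proof.
rewrite /dotp (bigD1 i)//= big1 ?addr0 ?mxE ?eqxx ?mul1r// => j ji.
by rewrite mxE (negbTE ji) mul0r.
Qed.

Lemma quad_sym_add C v w : C^T = C ->
  dotp (v + w) (C *m (v + w)) =
  dotp v (C *m v) + 2 * dotp v (C *m w) + dotp w (C *m w).
Proof.
move=> CT; rewrite mulmxDr dotpDl !dotpDr.
by rewrite (dotp_mul w C v) CT (dotpC _ v); lra.
Qed.

(** A nonnegative quadratic form that vanishes at [u] has [u] in its kernel: otherwise it would be
    negative at [t *: e + u] for a suitable basis vector [e] and a small [t] of the right sign. *)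
Lemma nonneg_definite_kernel C : nonneg_definite C ->
  \sum_i \sum_j C i j = 0 -> C *m \col_i 1 = 0.
Proof.
move=> [CT C0]; rewrite sum_mx_ones; set u := \col_i 1 => uCu.
apply/colP => i; rewrite [RHS]mxE; set s := (C *m u) i 0.
apply/eqP/negP => /negP s0.
set e : 'cV[R]_d := delta_mx i 0.
set a := dotp e (C *m e).
have ge t : 0 <= t ^+ 2 * a + 2 * t * s.
  have := C0 (t *: e + u); rewrite -mulmxA -dotpE quad_sym_add// uCu addr0.
  rewrite -scalemxAr !(dotpZl,dotpZr) -/a dotp_delta -/s.
  by congr (0 <= _); ring.
have a0 : 0 <= a by have := C0 e; rewrite -mulmxA -dotpE.
(* The minimizer would be [- s / a]; the denominator [a + 1] also covers [a = 0] and still gives a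
   negative value. *)
have := ge (- s / (a + 1)).
have -> : (- s / (a + 1)) ^+ 2 * a + 2 * (- s / (a + 1)) * s =
   - (s ^+ 2 / (a + 1)) * ((a + 2) / (a + 1)).
  have a1 : a + 1 != 0 by rewrite gt_eqF//; lra.
  by field.
apply/negP; rewrite -ltNge mulNr oppr_lt0 mulr_gt0// divr_gt0//; try lra.
by rewrite exprn_even_gt0.
Qed.

(** The normalization of [C] puts its range among the zero-sum vectors, which are the ones that
    powers of [Lam^T] contract. *)
Lemma limit_covariance_total Lam mu hv C v :
  limit_covariance Lam mu hv C -> total (C *m v) = 0.
Proof.
move=> [C0 CS _]; have [CT _] := C0.
by rewrite -dotp_ones dotp_mul CT nonneg_definite_kernel// dotpC /dotp big1// => i _; rewrite mxE mulr0.
Qed.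

Lemma limit_covariance_step Lam mu hv C v : limit_covariance Lam mu hv C ->
  dotp v (C *m v) = dotp (Lam *m v) (C *m (Lam *m v)) + dotp v (drift mu hv) ^+ 2.
Proof.
move=> [_ _ /= CE]; rewrite {1}CE -drift_outer mulmxDl dotpDr dotp_outer.
by rewrite -!mulmxA (dotp_mul v Lam^T) trmxK.
Qed.

Lemma limit_covariance_iter Lam mu hv C n v : limit_covariance Lam mu hv C ->
  dotp v (C *m v) = dotp (Lam ^+ n *m v) (C *m (Lam ^+ n *m v)) +
    \sum_(k < n) dotp v (Lam^T ^+ k *m drift mu hv) ^+ 2.
Proof.
move=> CE; elim: n v => [|n IH] v; first by rewrite expr0 mul1mx big_ord0 addr0.
rewrite (limit_covariance_step v CE) IH -exprSr_mulmx -addrA; congr +%R.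
rewrite big_ord_recl/= expr0 mul1mx addrC; congr +%R.
by apply: eq_bigr => k _; rewrite exprS_mulmx (dotp_mul v Lam^T) trmxK.
Qed.

Lemma trmx_exp (B : 'M[R]_d) n : (B ^+ n)^T = B^T ^+ n.
Proof.
elim: n => [|n IH]; first by rewrite !expr0 trmx1.
by rewrite exprS exprSr trmx_mul IH.
Qed.

Lemma stoch_bound Lam c x : stochastic_mx Lam -> (forall i, `|x i 0| <= c) ->
  forall i, `|(Lam *m x) i 0| <= c.
Proof.
move=> [L0 L1] xc i; rewrite mxE (le_trans (ler_norm_sum _ _ _))//.
rewrite -[c]mul1r -(L1 i) mulr_suml ler_sum// => j _.
by rewrite normrM ger0_norm// ler_wpM2l.
Qed.

Variables (Lam : 'M[R]_d) (mu hv : 'cV[R]_d).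
Hypotheses (LS : stochastic_mx Lam) (LE : ergodic Lam) (muI : invariant_distr Lam mu).

Lemma geometric_decay : exists c r : R, [/\ 0 <= c, 0 <= r, r < 1 &
  forall n x, total x = 0 -> l1norm (Lam^T ^+ n *m x) <= c * r ^+ n * l1norm x].
Proof.
have [q q0 Lq] := ergodic_contraction LS LE muI.
have q1 : 1 <= q%:R :> R by rewrite ler1n.
exists q%:R, (1 - (2 * q%:R)^-1); split => //.
- by rewrite subr_ge0 invf_le1; lra.
- by rewrite ltrBlDr ltrDl invr_gt0; lra.
- move=> n x x0; apply: le_trans (le_adapted_norm Lam q0 _) _.
  apply: le_trans (adapted_norm_iter LS q0 Lq n x0) _.
  rewrite [q%:R * _]mulrC -mulrA ler_wpM2l//; last exact: adapted_norm_le.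
  by rewrite exprn_ge0// subr_ge0 invf_le1; lra.
Qed.

Lemma cvg_geometric0 (c r : R) : 0 <= r -> r < 1 -> c * r ^+ n @[n --> \oo] --> (0 : R).
Proof.
move=> r0 r1; rewrite -(mulr0 c); apply: (@cvgMr _ _ _ _ _ c).
by apply: cvg_expr; rewrite ger0_norm.
Qed.

(** The remainder of the iterated equation vanishes although [Lam ^+ n *m v] need not tend to 0:
    this vector stays bounded, [C] maps it to a zero-sum vector, and the power moved to the other
    side of the form contracts the latter. *)
Lemma limit_covariance_cvg C v : limit_covariance Lam mu hv C ->
  \sum_(k < n) dotp v (Lam^T ^+ k *m drift mu hv) ^+ 2 @[n --> \oo] -->
    dotp v (C *m v).
Proof.
move=> CE; have [c [r [c0 r0 r1 H]]] := geometric_decay.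
have wb n i : `|(Lam ^+ n *m v) i 0| <= l1norm v.
  elim: n i => [i|n IH]; first by rewrite expr0 mul1mx coord_l1norm.
  by rewrite exprS_mulmx; apply: stoch_bound.
set cC := \sum_i \sum_j `|C i j|.
have CB x : l1norm (C *m x) <= cC * l1norm x.
  rewrite /l1norm mulr_suml ler_sum// => i _; rewrite mxE.
  rewrite (le_trans (ler_norm_sum _ _ _))// mulr_suml ler_sum// => j _.
  by rewrite normrM ler_wpM2l// coord_l1norm.
have cC0 : 0 <= cC by apply: sumr_ge0 => i _; exact: sumr_ge0.
apply/cvgrPdist_le => e e0.
set K := l1norm v * (c * (cC * (d%:R * l1norm v))).
have : K * r ^+ n @[n --> \oo] --> (0 : R) by exact: cvg_geometric0.
move/cvgrPdist_le => /(_ _ e0); apply: filterS => n.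
rewrite sub0r normrN => Kn; apply: le_trans Kn.
rewrite (limit_covariance_iter n v CE) addrK dotpC.
have -> : dotp (C *m (Lam ^+ n *m v)) (Lam ^+ n *m v) =
    dotp v (Lam^T ^+ n *m (C *m (Lam ^+ n *m v))).
  by rewrite dotpC -{1}[Lam ^+ n]trmxK -dotp_mul trmx_exp.
rewrite (le_trans (dotp_bound _ _))// /K.
rewrite ger0_norm; last first.
  by rewrite !mulr_ge0 ?l1norm_ge0 ?exprn_ge0.
rewrite -mulrA ler_wpM2l ?l1norm_ge0//.
rewrite (le_trans (H _ _ (limit_covariance_total _ CE)))// mulrAC.
rewrite ler_wpM2r ?exprn_ge0// ler_wpM2l//.
rewrite (le_trans (CB _))// ler_wpM2l ?l1norm_ge0//.
rewrite /l1norm (@le_trans _ _ (\sum_(i < d) l1norm v))//.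
  by apply: ler_sum => i _; exact: wb.
by rewrite sumr_const card_ord mulr_natl.
Qed.

(** The limit formula determines the quadratic form, and polarization on basis vectors recovers the
    entries. *)
Lemma limit_covariance_unique C C' :
  limit_covariance Lam mu hv C -> limit_covariance Lam mu hv C' -> C = C'.
Proof.
move=> CE CE'.
have quad v : dotp v (C *m v) = dotp v (C' *m v).
  have := limit_covariance_cvg (v := v) CE; have := limit_covariance_cvg (v := v) CE'.
  by move=> /(cvg_lim (@Rhausdorff R)) <- /(cvg_lim (@Rhausdorff R)) <-.
have CT : C^T = C by case: CE => -[].
have CT' : C'^T = C' by case: CE' => -[].
apply/matrixP => i j.
have entry (B : 'M[R]_d) : B i j = dotp (delta_mx i 0) (B *m delta_mx j 0).
  by rewrite dotp_delta -colE mxE.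
have := quad (delta_mx i 0 + delta_mx j 0).
by rewrite !quad_sym_add// !quad -!entry; lra.
Qed.

Let x k := Lam^T ^+ k *m drift mu hv.

(** The solution is the series of the matrices [x k *m (x k)^T], the stationary covariance of the
    autoregression driven by [drift mu hv]. It converges entrywise by the geometric decay of
    [x k]. *)
Lemma limit_covariance_exists : exists C, limit_covariance Lam mu hv C.
Proof.
have muS : simplex mu by case: muI.
have [c [r [c0 r0 r1 H]]] := geometric_decay.
have xb k i : `|x k i 0| <= c * l1norm (drift mu hv) * r ^+ k.
  rewrite (le_trans (coord_l1norm _ _))// mulrAC H//.
  exact: drift_total.
set B := c * l1norm (drift mu hv) in xb.
have B0 : 0 <= B by rewrite mulr_ge0 ?l1norm_ge0.
have cvS i j : cvg (series (fun k => x k i 0 * x k j 0) @ \oo).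
  apply: (@geometric_dominated_cvg _ _ (B * B) r) => // k.
  rewrite normrM (le_trans (ler_pM _ _ (xb k i) (xb k j)))//.
  rewrite mulrACA; apply: ler_wpM2l; first exact: mulr_ge0.
  apply: ler_piMr; first exact: exprn_ge0.
  by apply: exprn_ile1 => //; exact: ltW.
pose S n : 'M[R]_d := \sum_(k < n) x k *m (x k)^T.
have SE n i j : S n i j = series (fun k => x k i 0 * x k j 0) n.
  rewrite /S summxE /series/= big_mkord; apply: eq_bigr => k _.
  rewrite mxE (bigD1 ord0)//= big1 ?addr0 ?mxE// => l.
  by rewrite ord1.
pose C : 'M[R]_d := \matrix_(i, j) lim (series (fun k => x k i 0 * x k j 0) @ \oo).
have SC i j : S n i j @[n --> \oo] --> C i j.
  by under eq_fun do rewrite SE; rewrite mxE; exact: cvS.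
have quad v w : dotp v (S n *m w) @[n --> \oo] --> dotp v (C *m w).
  rewrite /dotp; apply: cvg_finsum => i.
  apply: (@cvgMr _ _ _ _ _ (v i 0)); rewrite mxE.
  under eq_fun do rewrite mxE.
  by apply: cvg_finsum => j; apply: cvgM; [exact: SC|exact: cvg_cst].
have quadS n v : dotp v (S n *m v) = \sum_(k < n) dotp v (x k) ^+ 2.
  rewrite /S mulmx_suml dotpE mulmx_sumr summxE; apply: eq_bigr => k _.
  by rewrite -dotpE dotp_outer.
have x0 k : total (x k) = 0 by rewrite /x stoch_iter_total// drift_total.
exists C; split.
- split.
    apply/matrixP => i j; rewrite !mxE; congr (lim (series _ @ \oo)).
    by apply/funext => k; rewrite mulrC.
  move=> v; rewrite -mulmxA -dotpE.
  rewrite -(cvg_lim (@Rhausdorff R) (quad v v)).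
  apply: limr_ge; first by apply: cvgP; exact: quad.
  by near=> n; rewrite quadS sumr_ge0// => k _; rewrite sqr_ge0.
- rewrite sum_mx_ones -(cvg_lim (@Rhausdorff R) (quad _ _)).
  apply/cvg_lim; first exact: Rhausdorff.
  under eq_fun do (rewrite quadS big1; last by
    move=> k _; rewrite dotp_ones x0 expr0n).
  exact: cvg_cst.
- rewrite /= -drift_outer; apply/matrixP => i j.
  have /(cvg_lim (@Rhausdorff R)) <- : S n.+1 i j @[n --> \oo] --> C i j.
    by rewrite (cvg_shiftS (fun n => S n i j)).
  apply/cvg_lim; first exact: Rhausdorff.
  (* Splitting off the term of index 0 gives a recursion for the partial sums, whose limit is the
     fixed-point equation. *)
  have SS n : S n.+1 = Lam^T *m S n *m Lam + drift mu hv *m (drift mu hv)^T.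
    rewrite /S big_ord_recl/= /x expr0 mul1mx addrC; congr +%R.
    rewrite mulmx_sumr mulmx_suml; apply: eq_bigr => k _.
    by rewrite /bump/= add1n exprS_mulmx trmx_mul trmxK !mulmxA.
  under eq_fun do rewrite SS mxE.
  rewrite [(_ + drift mu hv *m _) i j]mxE.
  apply: (@cvgD _ R^o); last exact: cvg_cst.
  have E (D : 'M[R]_d) : (Lam^T *m D *m Lam) i j =
      dotp (row i Lam^T)^T (D *m col j Lam).
    rewrite dotpE trmxK mulmxA -row_mul mxE [RHS]mxE.
    by apply: eq_bigr => l _; rewrite !mxE.
  by under eq_fun do rewrite E; rewrite E; exact: quad.
Unshelve. all: by end_near. Qed.

End LimitCovariance.

(** * Gaussian expectations *)

Section ImageDensity.
Context d1 d2 (S : measurableType d1) (T : measurableType d2) (R : realType).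
Variables (rho : {measure set S -> \bar R}) (nu : {measure set T -> \bar R}).
Variables (phi : S -> T) (p : S -> R).
Hypotheses (mphi : measurable_fun setT phi) (mp : measurable_fun setT p).
Hypothesis p0 : forall z, 0 <= p z.
Hypothesis nuE : forall A, measurable A ->
  nu A = (\int[rho]_(z in phi @^-1` A) (p z)%:E)%E.

(** The hypothesis [nuE] says that [nu] is the image under [phi] of the measure with density [p]
    relative to [rho]. Affine substitution, normal densities, transitions of the filter and joint
    laws are all treated below as instances. *)
Lemma ge0_integral_image_density (f : T -> \bar R) :
  measurable_fun [set: T] f -> (forall y, (0 <= f y)%E) ->
  (\int[nu]_y f y = \int[rho]_z (f (phi z) * (p z)%:E))%E.
Proof.
move=> mf f0.
have mT : measurable [set: T] by [].
pose f_ := nnsfun_approx mT mf.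
have fcvg y : (f_ n y)%:E @[n --> \oo] --> f y.
  by apply: cvg_nnsfun_approx.
have fphim n : measurable_fun setT (f_ n \o phi).
  by apply: measurableT_comp.
transitivity (limn (fun n => (\int[nu]_x (f_ n x)%:E)%E)).
  rewrite -monotone_convergence//.
  - by apply: eq_integral => y _; apply/esym/cvg_lim => //; exact: fcvg.
  - by move=> n; exact/measurable_EFinP/measurable_funP.
  - by move=> n y _; rewrite lee_fin.
  - by move=> y _ m n mn; rewrite lee_fin; exact/lefP/nd_nnsfun_approx.
transitivity (limn (fun n => (\int[rho]_z ((f_ n (phi z))%:E * (p z)%:E))%E)); last first.
  rewrite -monotone_convergence//.
  - apply: eq_integral => z _; apply/cvg_lim => //.
    by apply: cvgeZr => //.
  - move=> n; apply: emeasurable_funM; last exact/measurable_EFinP.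
    by apply/measurable_EFinP; exact: fphim.
  - by move=> n z _; rewrite -EFinM lee_fin mulr_ge0.
  - move=> z _ m n mn; rewrite -!EFinM lee_fin ler_wpM2r//.
    exact/lefP/nd_nnsfun_approx.
congr (limn _); apply/funext => n.
have mpre k : measurable (phi @^-1` (f_ n @^-1` [set k])).
  by rewrite -[X in measurable X]setTI; exact: mphi.
transitivity (\sum_(k \in range (f_ n)) k%:E * nu (f_ n @^-1` [set k]))%E.
  under eq_integral do rewrite fimfunE -fsumEFin//.
  rewrite ge0_integral_fsum//; last 2 first.
  - by move=> k; exact/measurable_EFinP/measurable_funM.
  - by move=> k y _; rewrite nnfun_muleindic_ge0.
  apply: eq_fsbigr => k _; rewrite integralZl_indic_nnsfun// integral_indic//=.
  by rewrite setIT.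
transitivity (\sum_(k \in range (f_ n)) k%:E *
    \int[rho]_(z in phi @^-1` (f_ n @^-1` [set k])) (p z)%:E)%E.
  by apply: eq_fsbigr => k _; rewrite nuE.
transitivity (\int[rho]_z (\sum_(k \in range (f_ n))
    (k%:E * (\1_(phi @^-1` (f_ n @^-1` [set k])) z * p z)%:E)))%E; last first.
  apply: eq_integral => z _.
  rewrite fimfunE -EFinM mulr_fsuml// -fsumEFin//.
  by apply: eq_fsbigr => k _; rewrite -EFinM mulrA.
rewrite ge0_integral_fsum//; last 2 first.
- move=> k; apply/measurable_EFinP; apply: measurable_funM => //.
  by apply: measurable_funM.
- move=> k z _; rewrite -EFinM lee_fin mulrA mulr_ge0//.
  have := nnfun_muleindic_ge0 (f_ n) k (phi z).
  by rewrite lee_fin.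
apply: eq_fsbigr => k /set_mem [y _ <-].
rewrite ge0_integralZl_EFin//; last 2 first.
- by move=> z _; rewrite lee_fin mulr_ge0.
- by apply/measurable_EFinP; apply: measurable_funM.
congr (_ * _)%E; rewrite integral_mkcond; apply: eq_integral => z _.
rewrite patchE indicE; case: ifPn => _; first by rewrite mul1r.
by rewrite mul0r.
Qed.

End ImageDensity.

Section Affine.
Context (R : realType).
Notation leb := (@lebesgue_measure R).

(** The scaled image of Lebesgue measure under the affine map agrees with Lebesgue measure on
    half-open intervals, and these determine it. *)
Lemma lebesgue_affine (m s : R) (A : set R) : 0 < s -> measurable A ->
  leb A = (\int[leb]_(x in (fun x : R => m + s * x)%R @^-1` A) (s)%:E)%E.
Proof.
move=> s0 mA.
have maff : measurable_fun [set: R] (fun x : R => m + s * x).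
  by apply: measurable_funD => //; apply: measurable_funM.
pose aff (x : measurableTypeR R) : measurableTypeR R := m + s * x.
have maff' : measurable_fun setT aff by [].
pose sn : {nonneg R} := NngNum (ltW s0).
have := @lebesgue_measure_unique R (mscale sn (pushforward leb aff)).
move=> /(_ maff' _ A mA) ->; last first.
  move=> _ [[a b]] _ <-/=; rewrite /mscale/= /pushforward.
  have -> : aff @^-1` `]a, b] = `]((a - m) / s), ((b - m) / s)]%classic.
    apply/seteqP; split => x /=; rewrite !in_itv/= /aff.
      by rewrite ltr_pdivrMr// ler_pdivlMr// [x * s]mulrC ltrBlDl lerBrDl.
    by rewrite ltr_pdivrMr// ler_pdivlMr// [x * s]mulrC ltrBlDl lerBrDl.
  rewrite !lebesgue_measure_itv/= !lte_fin ltr_pM2r ?invr_gt0// ltrD2r.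
  case: ifP => _; last by rewrite mule0.
  rewrite -!EFinB -EFinM; congr EFin.
  by field; rewrite gt_eqF.
rewrite /mscale/= integral_cst//.
by rewrite -[X in measurable X]setTI; exact: maff.
Qed.

Lemma ge0_integral_affine (m s : R) (f : R -> \bar R) : 0 < s ->
  measurable_fun [set: R] f -> (forall x, (0 <= f x)%E) ->
  (\int[leb]_x f x = \int[leb]_x (f (m + s * x)%R * s%:E))%E.
Proof.
move=> s0 mf f0.
apply: (@ge0_integral_image_density _ _ _ _ _ leb leb (fun x => m + s * x)) => //.
- by apply: measurable_funD => //; apply: measurable_funM.
- by move=> _; exact: ltW.
- by move=> A mA; exact: lebesgue_affine.
Qed.

Lemma ge0_integral_normal (m s : R) (f : R -> \bar R) :
  measurable_fun [set: R] f -> (forall x, (0 <= f x)%E) ->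
  (\int[normal_prob m s]_x f x = \int[leb]_x (f x * (normal_pdf m s x)%:E))%E.
Proof.
move=> mf f0; apply: (@ge0_integral_image_density _ _ _ _ _ leb _ id) => //.
- exact: measurable_normal_pdf.
- exact: normal_pdf_ge0.
Qed.

Lemma normal_pdf_affine (m s x : R) : 0 < s ->
  normal_pdf m s (m + s * x) * s = normal_pdf 0 1 x.
Proof.
move=> s0; rewrite !normal_pdfE ?oner_eq0 ?gt_eqF// /normal_peak /normal_fun.
rewrite expr1n !mul1r -mulrnAr sqrtrM ?sqr_ge0// sqrtr_sqr gtr0_norm//.
have s0' : s != 0 by rewrite gt_eqF.
have p0' : Num.sqrt (pi *+ 2) != 0 :> R.
  by rewrite gt_eqF// sqrtr_gt0 pmulrn_lgt0// pi_gt0.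
rewrite invfM subr0 mulrAC; congr (_ * expR _); last by field.
by rewrite mulrAC mulVf// mul1r.
Qed.

Lemma ge0_integral_normal_std (m s : R) (f : R -> \bar R) : 0 < s ->
  measurable_fun [set: R] f -> (forall x, (0 <= f x)%E) ->
  (\int[normal_prob m s]_x f x = \int[normal_prob 0 1]_x f (m + s * x)%R)%E.
Proof.
move=> s0 mf f0.
have maff : measurable_fun [set: R] (fun x : R => m + s * x).
  by apply: measurable_funD => //; apply: measurable_funM.
rewrite (@ge0_integral_normal m s f mf f0).
rewrite (@ge0_integral_normal 0 1 (fun x => f (m + s * x)) (measurableT_comp mf maff) (fun=> f0 _)).
rewrite (@ge0_integral_affine m s)//.
- by apply: eq_integral => x _; rewrite -muleA -EFinM normal_pdf_affine.
- apply: emeasurable_funM => //; apply/measurable_EFinP.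
  exact: measurable_normal_pdf.
- by move=> x; rewrite mule_ge0// lee_fin normal_pdf_ge0.
Qed.

Lemma normal_pdf_shift (t x : R) :
  normal_pdf 0 1 (x - t) = normal_pdf 0 1 x * expR (t * x - t ^+ 2 / 2).
Proof.
rewrite !normal_pdfE ?oner_eq0// /normal_fun -mulrA -expRD; congr (_ * expR _).
by field.
Qed.

(** A substitution moves the translation into the normal density, where completing the square
    produces the exponential factor. *)
Lemma ge0_integral_normal_shift (t : R) (f : R -> \bar R) :
  measurable_fun [set: R] f -> (forall x, (0 <= f x)%E) ->
  (\int[normal_prob 0 1]_x f (x + t)%R =
   \int[normal_prob 0 1]_x (f x * (expR (t * x - t ^+ 2 / 2))%:E))%E.
Proof.
move=> mf f0.
have msh : measurable_fun [set: R] (fun x : R => x + t) by exact: measurable_funD.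
have mexp : measurable_fun [set: R] (fun x : R => expR (t * x - t ^+ 2 / 2)).
  by apply: measurableT_comp => //; apply: measurable_funB => //.
have mn := measurable_normal_pdf (0 : R) 1.
rewrite !ge0_integral_normal//.
- rewrite [RHS](@ge0_integral_affine t 1)//.
  + apply: eq_integral => x _.
    rewrite mul1r mule1 -muleA -EFinM [t + x]addrC; congr (_ * _%:E)%E.
    by rewrite mulrC -normal_pdf_shift addrK.
  + apply: emeasurable_funM; last exact/measurable_EFinP.
    by apply: emeasurable_funM => //; exact/measurable_EFinP.
  + by move=> x; rewrite !mule_ge0// lee_fin// ?expR_ge0 ?normal_pdf_ge0.
- by apply: emeasurable_funM => //; exact/measurable_EFinP.
- by move=> x; rewrite mule_ge0// lee_fin expR_ge0.
- exact: measurableT_comp.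
Qed.

End Affine.

(** * Taylor bounds of first and second order *)

Section MeanValue.
Context {R : realType}.
Implicit Types (f g : R -> R) (x h : R).

Lemma mean_value_lt f g a b : (forall x, is_derive x 1 f (g x)) -> a < b ->
  exists c, [/\ a <= c, c <= b & f b - f a = g c * (b - a)].
Proof.
move=> fg ab.
have fc : {within `[a, b], continuous f}.
  apply: continuous_subspaceT => x.
  by apply: differentiable_continuous; apply/derivable1_diffP; case: (fg x).
have [c] := MVT ab (fun x _ => fg x) fc.
by rewrite in_itv/= => /andP[ac cb] E; exists c; split => //; exact: ltW.
Qed.

Lemma mean_value f g a b : (forall x, is_derive x 1 f (g x)) ->
  exists c, `|c - a| <= `|b - a| /\ f b - f a = g c * (b - a).
Proof.
move=> fg; have key := mean_value_lt fg.
have [ab|ba|->] := ltgtP a b.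
- have [c [ac cb E]] := key _ _ ab; exists c; split => //.
  by rewrite !ger0_norm ?subr_ge0 ?lerB// ltW.
- have [c [ac cb E]] := key _ _ ba; exists c; split.
    rewrite !ler0_norm ?subr_le0//; last exact: ltW.
    by rewrite lerN2 lerB.
  by rewrite -opprB E -mulrN opprB.
- by exists b; rewrite !subrr mulr0.
Qed.

Lemma mean_value_lipschitz f g K a b : (forall x, is_derive x 1 f (g x)) ->
  (forall c, `|c - a| <= `|b - a| -> `|g c| <= K) -> `|f b - f a| <= K * `|b - a|.
Proof.
move=> fg gK; have [c [ca ->]] := mean_value a b fg.
by rewrite normrM ler_wpM2r// gK.
Qed.

(** A Lipschitz bound on the derivative stands in for a second derivative; the constant is twice the
    optimal one, which is harmless. *)
Lemma mean_value_quadratic f g K a b : 0 <= K -> (forall x, is_derive x 1 f (g x)) ->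
  (forall c, `|c - a| <= `|b - a| -> `|g c - g a| <= K * `|c - a|) ->
  `|f b - f a - g a * (b - a)| <= K * `|b - a| ^+ 2.
Proof.
move=> K0 fg gK; have [c [ca ->]] := mean_value a b fg.
rewrite -mulrBl normrM expr2 mulrA ler_wpM2r//.
by rewrite (le_trans (gK _ ca))// ler_wpM2l.
Qed.

Lemma cos_lipschitz x y : `|cos x - cos y| <= `|x - y|.
Proof.
rewrite -[leRHS]mul1r; apply: (@mean_value_lipschitz _ (fun x => - sin x)).
by move=> c _; rewrite normrN ler_norml sin_geN1 sin_le1.
Qed.

Lemma sin_lipschitz x y : `|sin x - sin y| <= `|x - y|.
Proof.
rewrite -[leRHS]mul1r; apply: (@mean_value_lipschitz _ cos).
by move=> c _; rewrite ler_norml cos_geN1 cos_le1.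
Qed.

Lemma cos_taylor x h : `|cos (x + h) - cos x + sin x * h| <= h ^+ 2.
Proof.
have := @mean_value_quadratic cos (fun x => - sin x) 1 x (x + h) ler01
  (fun x => is_derive_cos x).
have -> : x + h - x = h by ring.
rewrite mul1r mulNr !opprK real_normK ?num_real//; apply.
by move=> c _; rewrite addrC distrC mul1r sin_lipschitz.
Qed.

Lemma expR_norm_le h : `|expR h - 1| <= `|h| * expR `|h|.
Proof.
rewrite -expR0 -{2}(subr0 h) mulrC.
apply: (@mean_value_lipschitz _ expR) => c; rewrite !subr0 => ch.
by rewrite ger0_norm ?expR_ge0// ler_expR (le_trans (ler_norm _)).
Qed.

Lemma expR_taylor h : `|expR h - 1 - h| <= h ^+ 2 * expR `|h|.
Proof.
have := @mean_value_quadratic expR expR (expR `|h|) 0 h (expR_ge0 _)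
  (fun x => is_derive_expR x).
rewrite subr0 expR0 mul1r real_normK ?num_real// mulrC; apply => c.
rewrite !subr0 => ch; rewrite (le_trans (expR_norm_le _))// mulrC.
by rewrite ler_wpM2r// ler_expR.
Qed.

Lemma le_norm_expR (x : R) : `|x| <= expR `|x|.
Proof. by rewrite (le_trans _ (expR_ge1Dx _))// lerDr. Qed.

End MeanValue.

(** * A class of functions integrable against the standard normal law *)

Section Subexponential.
Context {R : realType}.
Implicit Types f g : R -> R.

(** Functions of this class are Gaussian-integrable, and the class is closed under sums, products
    and affine substitutions, so integrability of composite expressions reduces to closure
    properties. *)
Definition subexp f := measurable_fun [set: R] f /\
  exists C c, [/\ 0 <= C, 0 <= c & forall u, `|f u| <= C * expR (c * `|u|)].

Local Notation gam := (normal_prob (0 : R) 1).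

Lemma normal_expR (t : R) : (\int[gam]_x (expR (t * x))%:E = (expR (t ^+ 2 / 2))%:E)%E.
Proof.
have h := @ge0_integral_normal_shift R t (cst 1%E) (measurable_cst _) (fun=> lee01).
have mexp : measurable_fun [set: R] (fun x : R => expR (t * x)).
  by apply: measurableT_comp => //; apply: measurable_funM.
move: h; rewrite integral_cst// mul1e [X in X = _ -> _](@probability_setT _ _ _ gam).
under eq_integral do rewrite mul1e expRB mulrC EFinM.
rewrite ge0_integralZl_EFin//; last exact/measurable_EFinP.
move=> /(congr1 (mule (expR (t ^+ 2 / 2))%:E)).
by rewrite mule1 muleA -EFinM divff ?gt_eqF ?expR_gt0// mul1e.
Qed.

Lemma measurable_expR_abs c : measurable_fun [set: R] (fun u : R => expR (c * `|u|)).
Proof.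
by apply: measurableT_comp => //; apply: measurable_funM => //.
Qed.

(** The function is dominated by [expR (c * u) + expR (- c * u)], and [normal_expR] gives the
    integrals of both terms. *)
Lemma integrable_expR_abs c : 0 <= c ->
  gam.-integrable [set: R] (fun u => (expR (c * `|u|))%:E).
Proof.
move=> c0; have mabs := measurable_expR_abs c.
have mexp t : measurable_fun [set: R] (fun x : R => expR (t * x)).
  by apply: measurableT_comp => //; apply: measurable_funM.
have iexp t : gam.-integrable [set: R] (fun u => (expR (t * u))%:E).
  apply/integrableP; split; first by apply/measurable_EFinP; exact: mexp.
  under eq_integral do rewrite gee0_abs ?lee_fin ?expR_ge0//.
  by rewrite normal_expR ltry.
apply: (@le_integrable _ _ _ gam _ measurableT _
    ((fun u => (expR (c * u))%:E) \+ (fun u => (expR (- c * u))%:E))%E).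
- exact/measurable_EFinP.
- move=> u _ /=; rewrite !lee_fin [leLHS]ger0_norm ?expR_ge0//.
  rewrite [leRHS]ger0_norm ?addr_ge0 ?expR_ge0//.
  have [u0|u0] := leP 0 u; first by rewrite ger0_norm// lerDl expR_ge0.
  by rewrite ltr0_norm// mulrN -mulNr lerDr expR_ge0.
- exact: integrableD.
Qed.

Lemma subexp_integrable f : subexp f -> gam.-integrable [set: R] (EFin \o f).
Proof.
move=> [mf [C [c [C0 c0 fC]]]].
apply: (@le_integrable _ _ _ gam _ measurableT _
  (fun u => C%:E * (expR (c * `|u|))%:E)%E).
- exact/measurable_EFinP.
- move=> u _ /=; rewrite lee_fin [leRHS]ger0_norm ?mulr_ge0 ?expR_ge0//.
- by apply: integrableZl => //; exact: integrable_expR_abs.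
Qed.

Lemma subexp_cst (a : R) : subexp (fun=> a).
Proof.
split=> //; exists `|a|, 0; split => // u.
by rewrite mul0r expR0 mulr1.
Qed.

Lemma subexp_id : subexp id.
Proof. by split=> //; exists 1, 1; split => // u; rewrite !mul1r le_norm_expR. Qed.

Lemma subexpD f g : subexp f -> subexp g -> subexp (fun u => f u + g u).
Proof.
move=> [mf [C [c [C0 c0 fC]]]] [mg [D [e [D0 e0 gD]]]].
split; first exact: measurable_funD.
exists (C + D), (c + e); split; rewrite ?addr_ge0// => u.
rewrite (le_trans (ler_normD _ _))// mulrDl lerD//.
- rewrite (le_trans (fC _))// ler_wpM2l// ler_expR ler_wpM2r//.
  by rewrite lerDl.
- rewrite (le_trans (gD _))// ler_wpM2l// ler_expR ler_wpM2r//.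
  by rewrite lerDr.
Qed.

Lemma subexpM f g : subexp f -> subexp g -> subexp (fun u => f u * g u).
Proof.
move=> [mf [C [c [C0 c0 fC]]]] [mg [D [e [D0 e0 gD]]]].
split; first exact: measurable_funM.
exists (C * D), (c + e); split; rewrite ?addr_ge0 ?mulr_ge0// => u.
by rewrite normrM mulrDl expRD mulrACA ler_pM.
Qed.

Lemma subexpZ a f : subexp f -> subexp (fun u => a * f u).
Proof. exact/subexpM/subexp_cst. Qed.

Lemma subexpN f : subexp f -> subexp (fun u => - f u).
Proof.
move=> /(subexpZ (-1)); congr subexp; apply/funext => u.
by rewrite mulN1r.
Qed.

Lemma subexpB f g : subexp f -> subexp g -> subexp (fun u => f u - g u).
Proof. by move=> sf /subexpN; exact: subexpD. Qed.

Lemma subexpX n f : subexp f -> subexp (fun u => f u ^+ n).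
Proof.
move=> sf; elim: n => [|n IH].
  by under eq_fun do rewrite expr0; exact: subexp_cst.
by under eq_fun do rewrite exprS; exact: subexpM.
Qed.

Lemma subexp_norm f : subexp f -> subexp (fun u => `|f u|).
Proof.
move=> [mf [C [c [C0 c0 fC]]]]; split; first exact: measurableT_comp.
by exists C, c; split=> // u; rewrite normr_id.
Qed.

Lemma subexp_le f g : measurable_fun [set: R] f -> subexp g ->
  (forall u, `|f u| <= `|g u|) -> subexp f.
Proof.
move=> mf [mg [C [c [C0 c0 gC]]]] fg; split=> //.
by exists C, c; split=> // u; exact: le_trans (fg u) (gC u).
Qed.

Lemma subexp_bounded f K : measurable_fun [set: R] f ->
  (forall u, `|f u| <= K) -> subexp f.
Proof.
move=> mf fK; apply: subexp_le mf (subexp_cst K) _ => u.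
exact: le_trans (fK u) (ler_norm _).
Qed.

Lemma subexp_expR c : subexp (fun u => expR (c * u)).
Proof.
split; first by apply: measurableT_comp => //; apply: measurable_funM.
exists 1, `|c|; split=> // u.
by rewrite mul1r ger0_norm ?expR_ge0// ler_expR -normrM ler_norm.
Qed.

Lemma subexp_expR_abs c : subexp (fun u => expR (c * `|u|)).
Proof.
split; first exact: measurable_expR_abs.
exists 1, `|c|; split=> // u; rewrite mul1r ger0_norm ?expR_ge0// ler_expR.
by rewrite ler_wpM2r// ler_norm.
Qed.

Lemma subexp_sum I (r : seq I) (F : I -> R -> R) :
  (forall i, subexp (F i)) -> subexp (fun u => \sum_(i <- r) F i u).
Proof.
move=> sF; elim: r => [|i r IH].
  by under eq_fun do rewrite big_nil; exact: subexp_cst.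
by under eq_fun do rewrite big_cons; exact: subexpD.
Qed.

Definition gE f : R := \int[gam]_u f u.

Lemma gE_cst a : gE (fun=> a) = a.
Proof.
by rewrite /gE Rintegral_cst// [X in fine X](@probability_setT _ _ _ gam) mulr1.
Qed.

Lemma gED f g : subexp f -> subexp g -> gE (fun u => f u + g u) = gE f + gE g.
Proof. by move=> sf sg; apply: RintegralD => //; exact: subexp_integrable. Qed.

Lemma gEZ a f : subexp f -> gE (fun u => a * f u) = a * gE f.
Proof. by move=> sf; apply: RintegralZl => //; exact: subexp_integrable. Qed.

Lemma gEB f g : subexp f -> subexp g -> gE (fun u => f u - g u) = gE f - gE g.
Proof. by move=> sf sg; apply: RintegralB => //; exact: subexp_integrable. Qed.

Lemma le_gE f g : subexp f -> subexp g -> (forall u, f u <= g u) -> gE f <= gE g.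
Proof.
move=> sf sg fg; apply: le_Rintegral => //; exact: subexp_integrable.
Qed.

Lemma gE_norm f : subexp f -> `|gE f| <= gE (fun u => `|f u|).
Proof. by move=> sf; apply: le_normr_Rintegral => //; exact: subexp_integrable. Qed.

Lemma gE_ge0 f : (forall u, 0 <= f u) -> 0 <= gE f.
Proof. by move=> f0; apply: Rintegral_ge0 => u _. Qed.

Lemma gE_fin f : subexp f -> ((gE f)%:E = \int[gam]_u (f u)%:E)%E.
Proof.
move=> sf; rewrite /gE /Rintegral fineK//.
by apply: integrable_fin_num => //; exact: subexp_integrable.
Qed.

Lemma subexp_shift t f : subexp f -> subexp (fun u => f (u + t)).
Proof.
move=> [mf [C [c [C0 c0 fC]]]]; split.
  by apply: measurableT_comp => //; exact: measurable_funD.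
exists (C * expR (c * `|t|)), c; split=> // [|u]; first by rewrite mulr_ge0 ?expR_ge0.
rewrite (le_trans (fC _))// -mulrA ler_wpM2l// -expRD ler_expR -mulrDr ler_wpM2l//.
by rewrite addrC ler_normD.
Qed.

Lemma subexp_expR_shift t : subexp (fun u => expR (t * u - t ^+ 2 / 2)).
Proof.
have := subexpZ (expR (- (t ^+ 2 / 2))) (subexp_expR t).
by congr subexp; apply/funext => u; rewrite -expRD addrC.
Qed.

Lemma gE_shift_ge0 t f : subexp f -> (forall u, 0 <= f u) ->
  gE (fun u => f (u + t)) = gE (fun u => f u * expR (t * u - t ^+ 2 / 2)).
Proof.
move=> sf f0; have mf := sf.1; apply: EFin_inj; rewrite !gE_fin.
- rewrite (@ge0_integral_normal_shift R t (EFin \o f))//.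
  exact/measurable_EFinP.
- by apply: subexpM => //; exact: subexp_expR_shift.
- exact: subexp_shift.
Qed.

(* Cameron--Martin: translating a standard normal variable by [t] amounts to
   the change of density [expR (t * u - t ^+ 2 / 2)]. *)
Lemma gE_shift t f : subexp f ->
  gE (fun u => f (u + t)) = gE (fun u => f u * expR (t * u - t ^+ 2 / 2)).
Proof.
move=> sf; have [mf [C [c [C0 c0 fC]]]] := sf.
(* So far the change of measure is known for nonnegative functions. Adding the dominating function
   [g] makes [f] nonnegative, and its contribution cancels at the end. *)
pose g (u : R) : R := C * expR (c * `|u|).
have sg : subexp g by apply: subexpZ; exact: subexp_expR_abs.
have g0 u : 0 <= g u by rewrite mulr_ge0 ?expR_ge0.
have fg0 u : 0 <= f u + g u.
  by rewrite addrC -lerBlDr sub0r (le_trans _ (fC u))// -normrN ler_norm.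
have sfg := subexpD sf sg.
have := gE_shift_ge0 t sfg fg0.
rewrite gED; [|exact: subexp_shift|exact: (@subexp_shift t g)].
rewrite (gE_shift_ge0 t sg g0).
have ss := subexp_expR_shift t.
rewrite [X in _ = gE X -> _](_ : _ = fun u => f u * expR (t * u - t ^+ 2 / 2) +
    g u * expR (t * u - t ^+ 2 / 2)); last by apply/funext => u; rewrite mulrDl.
rewrite [X in _ = X -> _]gED; [|exact: subexpM|exact: subexpM].
exact: addIr.
Qed.

End Subexponential.

(** * Stein's identity and the characteristic function of the normal law *)

Section CharacteristicFunction.
Context {R : realType}.
Implicit Types (f : R -> R) (c t th : R).

Lemma is_derive_quadratic f x l K :
  (forall h, `|f (x + h) - f x - h * l| <= K * h ^+ 2) -> is_derive x 1 f l.
Proof.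
move=> H.
have cv : h^-1 *: ((f \o shift x) (h *: 1) - f x) @[h --> 0^'] --> l.
  apply/cvgrPdist_le => e e0; near=> h.
  have h0 : h != 0 by near: h; exact: nbhs_dnbhs_neq.
  rewrite /= [h *: 1]mulr1 [h + x]addrC /GRing.scale/=.
  have -> : l - h^-1 * (f (x + h) - f x) = - (h^-1 * (f (x + h) - f x - h * l)).
    by field.
  rewrite normrN normrM normfV ler_pdivrMl ?normr_gt0//.
  rewrite (le_trans (H h))// -real_normK ?num_real// expr2 mulrCA.
  rewrite ler_wpM2l//.
  have hs : `|h| <= e / (`|K| + 1).
    near: h; apply: dnbhs0_le.
    by rewrite divr_gt0// ltr_wpDl.
  rewrite (@le_trans _ _ ((`|K| + 1) * `|h|))//.
    by rewrite ler_wpM2r// (le_trans (ler_norm _))// lerDl.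
  by rewrite mulrC -ler_pdivlMr.
apply: DeriveDef; first by apply: cvgP; exact: cv.
exact/cvg_lim.
Unshelve. all: by end_near. Qed.

Lemma subexp_cos c th : subexp (fun u => cos (c * u + th)).
Proof.
apply: (@subexp_bounded _ _ 1); last by move=> u; rewrite ler_norml cos_geN1 cos_le1.
apply: (@measurableT_comp _ _ _ _ _ _ (@cos R)).
  by apply: continuous_measurable_fun; exact: continuous_cos.
by apply: measurable_funD => //; apply: measurable_funM.
Qed.

Lemma subexp_sin c th : subexp (fun u => sin (c * u + th)).
Proof.
apply: (@subexp_bounded _ _ 1); last by move=> u; rewrite ler_norml sin_geN1 sin_le1.
apply: (@measurableT_comp _ _ _ _ _ _ (@sin R)).
  by apply: continuous_measurable_fun; exact: continuous_sin.
by apply: measurable_funD => //; apply: measurable_funM.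
Qed.

(** Both sides of the Cameron-Martin identity for the cosine are expanded to first order in the
    shift [t], with errors of order [t ^+ 2]; comparing the first-order terms gives the identity. *)
Lemma gE_cos_stein c th :
  gE (fun u => u * cos (c * u + th)) = - (c * gE (fun u => sin (c * u + th))).
Proof.
(* [k] dominates the second-order error of the density factor for [t] in [[-1, 1]], where the
   exponent is at most [|t| * (|u| + 1)] in absolute value. *)
pose k (u : R) : R := (`|u| + 1) ^+ 2 * (expR 1 * expR (1 * `|u|)) + 1.
have sk : subexp k.
  apply: subexpD; last exact: subexp_cst.
  apply: subexpM; last by apply: subexpZ; exact: subexp_expR_abs.
  apply: subexpX; apply: subexpD; last exact: subexp_cst.
  by apply: (@subexp_norm _ id); exact: subexp_id.
have sc := subexp_cos c th; have ss := subexp_sin c th.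
have suc : subexp (fun u => u * cos (c * u + th)) by exact/subexpM/sc/subexp_id.
set A := gE _; set B := gE _.
have key t : `|t| <= 1 -> `|t * (A + c * B)| <= (gE k + c ^+ 2) * t ^+ 2.
  move=> t1.
  have /= E := gE_shift t sc.
  have L : `|gE (fun u => cos (c * (u + t) + th)) -
       (gE (fun u => cos (c * u + th)) - c * t * B)| <= c ^+ 2 * t ^+ 2.
    rewrite -gEZ// -gEB//; last exact: subexpZ.
    have sb : subexp (fun u => cos (c * u + th) - c * t * sin (c * u + th)).
      by apply: subexpB => //; exact: subexpZ.
    have sa := subexp_shift t sc.
    rewrite -gEB// (le_trans (gE_norm _))//; first exact: subexpB.
    rewrite -[leRHS]gE_cst; apply: le_gE => [||u].
    - by apply: subexp_norm; exact: subexpB.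
    - exact: subexp_cst.
    - have := cos_taylor (c * u + th) (c * t).
      have -> : c * u + th + c * t = c * (u + t) + th by ring.
      by rewrite exprMn => h; apply: le_trans h; rewrite le_eqVlt; apply/orP; left; apply/eqP; congr `|_|; ring.
  have S : `|gE (fun u => cos (c * u + th) * expR (t * u - t ^+ 2 / 2)) -
       (gE (fun u => cos (c * u + th)) + t * A)| <= t ^+ 2 * gE k.
    have -> : t * A = gE (fun u => t * (u * cos (c * u + th))) by rewrite gEZ.
    rewrite -gED//; last exact: subexpZ.
    have sb : subexp (fun u => cos (c * u + th) + t * (u * cos (c * u + th))).
      by apply: subexpD => //; exact: subexpZ.
    have sa : subexp (fun u => cos (c * u + th) * expR (t * u - t ^+ 2 / 2)).
      by apply: subexpM => //; exact: subexp_expR_shift.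
    rewrite -gEB// (le_trans (gE_norm _))//; first exact: subexpB.
    rewrite -gEZ//; apply: le_gE => [||u].
    - by apply: subexp_norm; exact: subexpB.
    - exact: subexpZ.
    set x := t * u - t ^+ 2 / 2.
    have -> : cos (c * u + th) * expR x - (cos (c * u + th) + t * (u * cos (c * u + th)))
       = cos (c * u + th) * ((expR x - 1 - x) - t ^+ 2 / 2) by rewrite /x; ring.
    rewrite normrM -[leRHS]mul1r ler_pM//.
      by rewrite ler_norml cos_geN1 cos_le1.
    have t2 : t ^+ 2 = `|t| * `|t| by rewrite -expr2 real_normK ?num_real.
    have xb : `|x| <= `|t| * (`|u| + 1).
      rewrite (le_trans (ler_normB _ _))// normrM mulrDr lerD2l mulr1.
      rewrite ger0_norm ?divr_ge0 ?sqr_ge0// t2.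
      by have := normr_ge0 t; nra.
    rewrite (le_trans (ler_normB _ _))// /k mulrDr mulr1 lerD//; last first.
      by rewrite ger0_norm ?divr_ge0 ?sqr_ge0//; have := sqr_ge0 t; lra.
    rewrite (le_trans (expR_taylor _))// -expRD mulrA ler_pM ?sqr_ge0 ?expR_ge0//.
      rewrite -exprMn -[leLHS]real_normK ?num_real// -[leRHS]real_normK ?num_real//.
      rewrite lerXn2r ?nnegrE// normrM (@ger0_norm _ (`|u| + 1)) ?addr_ge0//.
    rewrite ler_expR mul1r (le_trans xb)// addrC.
    by rewrite ler_piMl// addr_ge0.
  rewrite -E in S.
  have -> : t * (A + c * B) =
     (gE (fun u => cos (c * (u + t) + th)) - (gE (fun u => cos (c * u + th)) - c * t * B))
   - (gE (fun u => cos (c * (u + t) + th)) - (gE (fun u => cos (c * u + th)) + t * A)).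
    by ring.
  rewrite (le_trans (ler_normB _ _))// [gE k + _]addrC mulrDl lerD//.
  by rewrite [gE k * _]mulrC.
set K := gE k + c ^+ 2 in key.
have K0 : 0 <= K.
  rewrite addr_ge0 ?sqr_ge0// gE_ge0// => u.
  by rewrite addr_ge0// !mulr_ge0 ?sqr_ge0 ?expR_ge0.
suff : A + c * B = 0 by move/eqP; rewrite addr_eq0 => /eqP.
apply/eqP; rewrite -normr_le0; apply/ler_addgt0Pl => e e0; rewrite addr0.
(* Dividing [key] by [t] leaves the bound [K * t], which this choice makes at most [e]. *)
pose t := Num.min 1 (e / (K + 1)).
have K1 : 0 < K + 1 by rewrite ltr_wpDl.
have t0 : 0 < t by rewrite lt_min ltr01 divr_gt0.
have := key t; rewrite gtr0_norm// ge_min lexx => /(_ isT).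
rewrite normrM gtr0_norm// expr2 mulrCA ler_pM2l// => /le_trans; apply.
rewrite (@le_trans _ _ (K * (e / (K + 1))))//.
  by rewrite ler_wpM2l// ge_min lexx orbT.
rewrite mulrCA; apply: ler_piMr; first exact: ltW.
by rewrite ler_pdivrMr// mul1r lerDl.
Qed.

(** The phase [th - pi / 2] turns the cosine identity into the one for the sine. *)
Lemma gE_sin_stein c th :
  gE (fun u => u * sin (c * u + th)) = c * gE (fun u => cos (c * u + th)).
Proof.
have := gE_cos_stein c (th - pi / 2).
under eq_fun do rewrite addrA cosB sin_pihalf cos_pihalf mulr0 add0r mulr1.
move=> ->.
under eq_fun do rewrite addrA sinB sin_pihalf cos_pihalf mulr0 sub0r mulr1.
under eq_fun do rewrite -mulN1r.
by rewrite gEZ ?mulN1r ?mulrN ?opprK//; exact: subexp_cos.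
Qed.

(** Differentiation under the expectation produces [u * sin (c * u + th)], and Stein's identity
    closes this into a linear differential equation in [c]. *)
Lemma is_derive_gE_cos c th :
  is_derive c 1 (fun c => gE (fun u => cos (c * u + th)))
    (- (c * gE (fun u => cos (c * u + th)))).
Proof.
apply: (@is_derive_quadratic _ _ _ (gE (fun u => u ^+ 2))) => h.
rewrite -gE_sin_stein mulrN opprK.
have s1 := subexp_cos (c + h) th; have s2 := subexp_cos c th.
have s3 : subexp (fun u => u * sin (c * u + th)).
  by apply: (@subexpM _ id); [exact: subexp_id|exact: subexp_sin].
have s4 := subexpB s1 s2; have s5 := subexpZ h s3.
have s6 : subexp (fun u : R => u ^+ 2) by exact/subexpX/subexp_id.
rewrite -gEB// -gEZ// -gED//.
rewrite (le_trans (gE_norm _))//; first exact: subexpD.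
rewrite mulrC -gEZ//; apply: le_gE => [||u].
- by apply: subexp_norm; exact: subexpD.
- exact: subexpZ.
- have := cos_taylor (c * u + th) (h * u).
  have -> : c * u + th + h * u = (c + h) * u + th by ring.
  by rewrite exprMn => h'; apply: le_trans h'; rewrite le_eqVlt; apply/orP; left; apply/eqP; congr `|_|; ring.
Qed.

(** By the differential equation the product with [expR (c ^+ 2 / 2)] has zero derivative, so it
    keeps its value at [c = 0]. *)
Lemma gE_cos c th : gE (fun u => cos (c * u + th)) = cos th * expR (- (c ^+ 2 / 2)).
Proof.
pose psi c := gE (fun u => cos (c * u + th)) * expR (c ^+ 2 / 2).
have dpsi (x : R) : is_derive x 1 psi (0 : R).
  have d1 := is_derive_gE_cos x th.
  have d2 : is_derive x 1 (fun c : R => expR (c ^+ 2 / 2)) (x * expR (x ^+ 2 / 2)).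
    apply: is_derive_eq.
    by rewrite !(scaler1,scaler0,addr0,add0r,expr1) /GRing.scale/=; field.
  apply: is_derive_eq.
  by rewrite /GRing.scale/=; ring.
have := @is_derive_0_is_cst _ psi c 0 dpsi.
rewrite /psi expr0n mul0r expR0 mulr1.
under [X in _ = gE X -> _]eq_fun do rewrite mul0r add0r.
rewrite gE_cst => <-.
by rewrite -mulrA -expRD subrr expR0 mulr1.
Qed.

End CharacteristicFunction.

(** * Density of trigonometric polynomials *)

Section TrigPoly.
Context {R : realType} {d : nat}.
Implicit Types (f g : 'cV[R]_d -> R) (v w : 'cV[R]_d).

(** The free phase [th] provides sines and constants and keeps the class closed under products by
    the product-to-sum formula. *)
Inductive trigpoly : ('cV[R]_d -> R) -> Prop :=
| Trig_cos v th : trigpoly (fun x => cos (dotp v x + th))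
| Trig_add f g : trigpoly f -> trigpoly g -> trigpoly (fun x => f x + g x)
| Trig_scale (c : R) f : trigpoly f -> trigpoly (fun x => c * f x).

Lemma trigpoly_cst (c : R) : trigpoly (fun=> c).
Proof.
have := Trig_scale c (Trig_cos 0 0); congr trigpoly; apply/funext => x.
by rewrite /dotp big1 ?addr0 ?cos0 ?mulr1// => i _; rewrite mxE mul0r.
Qed.

Lemma trigpoly_mul f g : trigpoly f -> trigpoly g -> trigpoly (fun x => f x * g x).
Proof.
move=> tf tg; elim: tf => [v th|f1 f2 _ IH1 _ IH2|c f1 _ IH1].
- elim: tg => [w ph|g1 g2 _ IH1 _ IH2|c g1 _ IH1].
  + have := Trig_scale 2^-1 (Trig_add (Trig_cos (v + w) (th + ph))
        (Trig_cos (v - w) (th - ph))).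
    congr trigpoly; apply/funext => x.
    rewrite dotpDl dotpBl; set a := dotp v x; set b := dotp w x.
    have -> : a + b + (th + ph) = (a + th) + (b + ph) by ring.
    have -> : a - b + (th - ph) = (a + th) - (b + ph) by ring.
    by rewrite cosD cosB; field.
  + have := Trig_add IH1 IH2; congr trigpoly; apply/funext => x; ring.
  + have := Trig_scale c IH1; congr trigpoly; apply/funext => x; ring.
- have := Trig_add IH1 IH2; congr trigpoly; apply/funext => x; ring.
- have := Trig_scale c IH1; congr trigpoly; apply/funext => x; ring.
Qed.

Lemma trigpoly_sin (i : 'I_d) (c : R) : trigpoly (fun x => sin (x i 0 * c)).
Proof.
have := Trig_cos (c *: delta_mx i 0) (- (pi / 2)); congr trigpoly.
apply/funext => x; rewrite dotpZl dotp_delta mulrC.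
by rewrite cosB cos_pihalf sin_pihalf mulr0 add0r mulr1.
Qed.

End TrigPoly.

(** * Bernstein polynomials as expectations of a random walk *)

Section Bernstein.
Context {R : realType} {d : nat}.
Implicit Types (s : 'I_d -> R) (l : seq 'I_d) (k : 'I_d -> nat).
Implicit Types f g : ('I_d -> nat) -> R.

Definition incr (i : 'I_d) k : 'I_d -> nat := fun j => (k j + (j == i))%N.

(* Expectation of [f] at the end of the random walk on [nat^d] which starts at
   [k] and, for each entry [i] of [l], moves by one in direction [i] with
   probability [s i]. *)
Fixpoint bernstein s l f k : R :=
  if l is i :: l' then
    s i * bernstein s l' f (incr i k) + (1 - s i) * bernstein s l' f k
  else f k.

Lemma bernstein_cst s l c k : bernstein s l (fun=> c) k = c.
Proof. by elim: l k => //= i l IH k; rewrite !IH; ring. Qed.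

Lemma bernsteinD s l f g k :
  bernstein s l (fun k => f k + g k) k = bernstein s l f k + bernstein s l g k.
Proof. by elim: l k => //= i l IH k; rewrite !IH; ring. Qed.

Lemma bernsteinZ s l c f k :
  bernstein s l (fun k => c * f k) k = c * bernstein s l f k.
Proof. by elim: l k => //= i l IH k; rewrite !IH; ring. Qed.

Lemma bernstein_sum s l I (r : seq I) (F : I -> ('I_d -> nat) -> R) k :
  bernstein s l (fun k => \sum_(i <- r) F i k) k =
  \sum_(i <- r) bernstein s l (F i) k.
Proof.
elim: r => [|i r IH].
  by rewrite big_nil -[RHS](bernstein_cst s l 0 k); congr bernstein;
    apply/funext => ?; rewrite big_nil.
rewrite big_cons -IH -bernsteinD; congr bernstein.
by apply/funext => ?; rewrite big_cons.
Qed.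

Lemma bernstein_le s l f g k : (forall i, 0 <= s i <= 1) ->
  (forall k, f k <= g k) -> bernstein s l f k <= bernstein s l g k.
Proof.
move=> s01 fg; elim: l k => //= i l IH k.
have /andP[s0 s1] := s01 i.
by rewrite lerD// ler_wpM2l// subr_ge0.
Qed.

Lemma bernstein_norm_le s l f (K : R) k : (forall i, 0 <= s i <= 1) ->
  (forall k, `|f k| <= K) -> `|bernstein s l f k| <= K.
Proof.
move=> s01 fK; rewrite ler_norml; apply/andP; split.
  rewrite -[leLHS](bernstein_cst s l _ k); apply: bernstein_le => // k'.
  by have := fK k'; rewrite ler_norml => /andP[].
rewrite -[leRHS](bernstein_cst s l _ k); apply: bernstein_le => // k'.
by have := fK k'; rewrite ler_norml => /andP[].
Qed.

(** Squared bias plus variance: coordinate [i] of the walk moves by a sum of [count_mem i l]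
    independent Bernoulli variables of parameter [s i]. *)
Lemma bernstein_second_moment s l i (m : R) k :
  bernstein s l (fun k => ((k i)%:R - m) ^+ 2) k =
  ((k i)%:R + (count_mem i l)%:R * s i - m) ^+ 2 +
  (count_mem i l)%:R * (s i * (1 - s i)).
Proof.
elim: l k => [|j l IH] k /=; first by rewrite !mul0r !addr0.
rewrite !IH /incr; have [->|ij] := eqVneq j i.
  by rewrite !natrD (_ : (true : nat)%:R = 1 :> R)//; ring.
by rewrite addn0 add0n; ring.
Qed.

Lemma trigpoly_bernstein (s : 'cV[R]_d -> 'I_d -> R) l f k :
  (forall i, trigpoly (fun x => s x i)) ->
  trigpoly (fun x => bernstein (s x) l f k).
Proof.
move=> ts; elim: l k => [|i l IH] k /=; first exact: trigpoly_cst.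
apply: Trig_add; apply: trigpoly_mul => //.
apply: Trig_add; first exact: trigpoly_cst.
have := Trig_scale (-1) (ts i); congr trigpoly; apply/funext => x.
by rewrite mulN1r.
Qed.

End Bernstein.

Section TrigDensity.
Context {R : realType}.

(** An inverse of the sine on [[-1, 1]], extended to all reals. Clamping keeps the argument away
    from the endpoints, where the arcsine is not Lipschitz. *)
Definition arcs (z : R) : R := asin (Num.max (- sin 1) (Num.min (sin 1) z)).

Lemma sin1_gt0 : 0 < sin (1 : R).
Proof. by apply: sin_gt0_pi; have := pi_ge2 R; lra. Qed.

(** Clamping does not move [z] away from [sin t], and on [[-1, 1]] the derivative of the sine is at
    least [cos 1]. *)
Lemma arcs_spec (z : R) : `|arcs z| <= 1 /\
  forall t, `|t| <= 1 -> `|arcs z - t| <= (cos 1)^-1 * `|z - sin t|.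
Proof.
have pi2 := pi_ge2 R; have s1 := sin1_gt0.
set w := Num.max (- sin 1) (Num.min (sin 1) z).
have wb : - sin 1 <= w <= sin 1.
  by rewrite /w le_max lexx/= ge_max ge_min lexx/= andbT; lra.
have s1' := @sin_le1 R 1.
have wb2 : w \in `[(-1), 1] by rewrite in_itv/=; lra.
have sa : sin (arcs z) = w by rewrite /arcs asinK.
have wb' : -1 <= w <= 1 by lra.
have a1 := asin_geNpi2 wb'; have a2 := asin_lepi2 wb'.
have sle (x y : R) : - (pi / 2) <= x <= pi / 2 -> - (pi / 2) <= y <= pi / 2 ->
    (sin x <= sin y) = (x <= y).
  by move=> xp yp; rewrite !leNgt ltr_sin// in_itv.
have ab : `|arcs z| <= 1.
  rewrite ler_norml; apply/andP; split.
    rewrite -sle; [rewrite sinN sa; lra|lra|].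
    by apply/andP; split; [exact: a1|exact: a2].
  rewrite -sle; [rewrite sa; lra| |lra].
  by apply/andP; split; [exact: a1|exact: a2].
split=> // t t1.
have [ts1 ts2] : - sin 1 <= sin t /\ sin t <= sin 1.
  move: t1; rewrite ler_norml => /andP[t1 t2]; split.
    by rewrite -sinN sle; lra.
  by rewrite sle; lra.
have wz : `|w - sin t| <= `|z - sin t|.
  set T := sin t in ts1 ts2 *; rewrite /w.
  have h2 := normr_ge0 (z - T); have h0 := ler_norm (z - T); have h1 : T - z <= `|z - T|.
    by rewrite -opprB -normrN ler_norm.
  rewrite ler_norml; case: (leP (sin 1) z) => h.
    by rewrite max_r; last lra; apply/andP; split; lra.
  case: (leP (- sin 1) z) => h'.
    by apply/andP; split; lra.
  by apply/andP; split; lra.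
rewrite ler_pdivlMl ?cos1_gt0//; apply: le_trans wz; rewrite -sa.
have cosge (c : R) : `|c| <= 1 -> cos 1 <= cos c.
  move=> c1; rewrite -(cos_norm c) leNgt ltr_cos ?in_itv/= ?normr_ge0//=; [|lra..].
  by rewrite -leNgt.
have key (x y : R) : `|x| <= 1 -> `|y| <= 1 -> x < y ->
    cos 1 * `|y - x| <= `|sin y - sin x|.
  rewrite !ler_norml => /andP[x1 x2] /andP[y1 y2] xy.
  have [c [xc cy ->]] := mean_value_lt (@is_derive_sin R) xy.
  have cc : cos 1 <= cos c by apply: cosge; rewrite ler_norml; lra.
  by rewrite normrM ler_wpM2r// (le_trans cc)// ler_norm.
have [tz|zt|->] := ltgtP t (arcs z).
- exact: key.
- by rewrite distrC [leRHS]distrC; exact: key.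
- by rewrite !subrr !normr0 mulr0.
Qed.

End TrigDensity.

Section UniformContinuity.
Context {R : realType} {d : nat}.

Lemma continuous_unif_box (F : 'cV[R]_d -> R) (r e : R) : continuous F -> 0 < e ->
  exists2 tau, 0 < tau & forall x y : 'cV[R]_d, (forall i, `|x i 0| <= r) ->
    (forall i, `|y i 0 - x i 0| < tau) -> `|F y - F x| <= e.
Proof.
move=> Fc e0.
(* Compactness of the box comes from [rV_compact], which concerns row vectors; hence the
   transposition. *)
pose G (x : 'rV[R]_d) := F x^T.
have trc : continuous (fun x : 'rV[R]_d => x^T).
  move=> x; have FF : Filter (nbhs x) by exact: nbhs_filter.
  apply/cvgrPdist_lt => t t0.
  apply: (@filterS _ (nbhs x) _ (ball x t)); last exact: nbhsx_ballx.
  move=> y [_ xy]; rewrite -[X in X < _]/(mx_norm _).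
  have [->|/mx_norm_neq0[[i j] ->]] := eqVneq (mx_norm (x^T - y^T)) 0; first by [].
  by have := xy j i; rewrite !mxE.
have Gc : continuous G.
  by move=> x; apply: (@continuous_comp _ _ _ (fun x => x^T) F); [exact: trc|exact: Fc].
pose A := [set x : 'rV[R]_d | forall i, `[(- r), r]%classic (x ord0 i)].
have Ac : compact A.
  exact: (@rV_compact R d (fun=> `[(- r), r]%classic) (fun=> @segment_compact R _ _)).
have := compact_near_coveringP A => /iffLR/(_ Ac) nc.
pose P (tau : R) (x : 'rV[R]_d) := forall y : 'rV[R]_d, (forall i, `|y 0 i - x 0 i| < tau) -> `|G y - G x| <= e.
have : \forall tau \near 0^'+, A `<=` P tau.
  apply: nc => x Ax.
  have : \forall y \near x, `|G x - G y| < e / 2.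
    by have /cvgrPdist_lt := Gc x; apply; rewrite divr_gt0.
  move=> /nbhs_ballP[t /= t0 xt].
  exists (ball x (t / 2), [set tau | tau < t / 2]) => /=.
    split; first by apply: nbhsx_ballx; rewrite divr_gt0.
    by apply: nbhs_right_lt; rewrite divr_gt0.
  move=> [x' tau] [/= [_ xx'] taut] y yx'.
  have xy : ball x t y.
    split=> // i j; rewrite ord1 /ball/=.
    have := yx' j; have := xx' 0 j; rewrite /ball/= => h1 h2.
    have -> : x 0 j - y 0 j = (x 0 j - x' 0 j) - (y 0 j - x' 0 j) by ring.
    by rewrite (le_lt_trans (ler_normB _ _))//; lra.
  have xx'' : ball x t x'.
    split=> // i j; rewrite ord1; have := xx' 0 j; rewrite /ball/=; lra.
  have := xt _ xy; have := xt _ xx'' => /= h1 h2.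
  have -> : G y - G x' = (G x - G x') - (G x - G y) by ring.
  by rewrite (le_trans (ler_normB _ _))//; lra.
move=> H.
have [tau [tau0 Htau]] : exists tau : R, 0 < tau /\ A `<=` P tau.
  near (0 : R)^'+ => tau; exists tau; split; first by near: tau; exact: nbhs_right_gt.
  by near: tau.
exists tau => // x y xr yx.
have := Htau x^T _ y^T; rewrite /G !trmxK; apply.
- by move=> i /=; rewrite mxE in_itv/= -ler_norml.
- by move=> i; rewrite !mxE.
Unshelve. all: by end_near. Qed.

End UniformContinuity.

(** * Weighted density of trigonometric polynomials *)

Section Density.
Context {R : realType} {d : nat}.
Implicit Types (F : 'cV[R]_d -> R) (x : 'cV[R]_d).

(** The point with [sin (x i 0 / r) = 2 * k i / N - 1], as far as the clamping in [arcs] permits.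
    All nodes lie in the box of radius [r]. *)
Definition node (r : R) (N : nat) (k : 'I_d -> nat) : 'cV[R]_d :=
  \col_i (r * arcs (2 * ((k i)%:R / N%:R) - 1)).

(** These are the step probabilities of the walk. After [N] steps in each direction the frequencies
    [k i / N] concentrate at [sine_coord r x i], and the node of these frequencies is [x] itself if
    [x] lies in the box. *)
Definition sine_coord (r : R) x (i : 'I_d) : R := (1 + sin (x i 0 * r^-1)) / 2.

Definition directions N : seq 'I_d := flatten (nseq N (enum 'I_d)).

Lemma count_directions N i : count_mem i (directions N) = N.
Proof.
rewrite /directions; elim: N => //= N IH.
by rewrite count_cat IH count_uniq_mem ?enum_uniq// mem_enum.
Qed.

Lemma sine_coord01 r x i : 0 <= sine_coord r x i <= 1.
Proof.
have := sin_geN1 (x i 0 * r^-1); have := sin_le1 (x i 0 * r^-1).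
by rewrite /sine_coord; lra.
Qed.

Definition trig_approx F (r : R) N x : R :=
  bernstein (sine_coord r x) (directions N) (fun k => F (node r N k)) (fun=> 0%N).

Lemma trigpoly_trig_approx F r N : trigpoly (trig_approx F r N).
Proof.
apply: trigpoly_bernstein => i.
have := Trig_scale 2^-1 (Trig_add (trigpoly_cst 1) (trigpoly_sin i r^-1)).
by congr trigpoly; apply/funext => x; rewrite mulrC.
Qed.

Lemma node_bound r N k i : 0 <= r -> `|node r N k i 0| <= r.
Proof.
move=> r0; rewrite mxE normrM ger0_norm// ler_piMr//.
exact: (arcs_spec _).1.
Qed.

Lemma node_dist r N k i x : 0 < r -> (0 < N)%N -> `|x i 0| <= r ->
  (node r N k i 0 - x i 0) ^+ 2 <=
  (2 * r / cos 1) ^+ 2 / N%:R ^+ 2 * ((k i)%:R - N%:R * sine_coord r x i) ^+ 2.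
Proof.
move=> r0 N0 xr.
have N0' : N%:R != 0 :> R by rewrite pnatr_eq0 -lt0n.
have r0' : r != 0 by rewrite gt_eqF.
have xr1 : `|x i 0 * r^-1| <= 1.
  by rewrite normrM normfV (gtr0_norm r0) ler_pdivrMr// mul1r.
have H := (arcs_spec (2 * ((k i)%:R / N%:R) - 1)).2 _ xr1.
have c0 := @cos1_gt0 R; have c0' : cos 1 != 0 :> R by rewrite gt_eqF.
have E : node r N k i 0 - x i 0 = r * (arcs (2 * ((k i)%:R / N%:R) - 1) - x i 0 * r^-1).
  by rewrite mxE; field.
have -> : (2 * r / cos 1) ^+ 2 / N%:R ^+ 2 * ((k i)%:R - N%:R * sine_coord r x i) ^+ 2 =
   (r * ((cos 1)^-1 * (2 * ((k i)%:R / N%:R) - 1 - sin (x i 0 * r^-1)))) ^+ 2.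
  by rewrite /sine_coord; field; rewrite c0' N0'.
rewrite E !exprMn ler_wpM2l ?sqr_ge0// -exprMn.
rewrite -[leLHS]real_normK ?num_real// -[leRHS]real_normK ?num_real//.
by rewrite lerXn2r ?nnegrE// normrM (@gtr0_norm _ (cos 1)^-1) ?invr_gt0.
Qed.

Lemma l1norm_box r x : (forall i, `|x i 0| <= r) -> l1norm x <= d%:R * r.
Proof.
move=> xr; apply: (@le_trans _ _ (\sum_(i < d) r)); first exact: ler_sum.
by rewrite sumr_const card_ord mulr_natl.
Qed.

(** Bernstein's proof of the Weierstrass theorem: the error is controlled by uniform continuity and
    by the mean square distance between node and [x], which is of order [1 / N]. *)
Lemma trig_approx_box F (r e B : R) : continuous F -> 0 < r -> 0 < e -> 0 <= B ->
  (forall x, (forall i, `|x i 0| <= r) -> `|F x| <= B) ->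
  exists N, forall x, (forall i, `|x i 0| <= r) -> `|F x - trig_approx F r N x| <= e.
Proof.
move=> Fc r0 e0 B0 FB.
have e20 : 0 < e / 2 by rewrite divr_gt0.
have [tau tau0 Ft] := continuous_unif_box r Fc e20.

pose K : R := (2 * r / cos 1) ^+ 2.
have K0 : 0 <= K by rewrite sqr_ge0.
(* If some coordinate of the node differs from that of [x] by at least [tau], then [2 * B] is at
   most [c] times the squared distance. *)
pose c : R := 2 * B / tau ^+ 2.
have c0 : 0 <= c by apply: divr_ge0; [exact: mulr_ge0|exact: sqr_ge0].
pose N := (Num.truncn (c * d%:R * K / (e / 2))).+1.
have N0 : 0 < N%:R :> R by rewrite ltr0n.
have NE : c * d%:R * K / N%:R <= e / 2.
  rewrite ler_pdivrMr// [leRHS]mulrC -ler_pdivrMr//.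
  exact/ltW/truncnS_gt.
exists N => x xr.
pose s := sine_coord r x; pose l := directions N.
have -> : F x - trig_approx F r N x = bernstein s l (fun k => - (F (node r N k) - F x)) (fun=> 0%N).
  rewrite /trig_approx -[F x in LHS](bernstein_cst s l (F x) (fun=> 0%N)).
  rewrite -[X in _ - X]mul1r -mulNr -bernsteinZ -bernsteinD; congr bernstein.
  by apply/funext => k; ring.
have s01 i : 0 <= s i <= 1 by exact: sine_coord01.
have nb k i : `|node r N k i 0| <= r by apply: node_bound; exact: ltW.
have pt k : `|F (node r N k) - F x| <=
    e / 2 + c * \sum_i (node r N k i 0 - x i 0) ^+ 2.
  have S0 : 0 <= \sum_i (node r N k i 0 - x i 0) ^+ 2.
    by apply: sumr_ge0 => i _; exact: sqr_ge0.
  have [near_x|/existsNP[i /negP]] :=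
      pselect (forall i, `|node r N k i 0 - x i 0| < tau).
    by rewrite (le_trans (Ft _ _ xr near_x))// lerDl mulr_ge0.
  rewrite -leNgt => far.
  apply: (@le_trans _ _ (2 * B)).
    rewrite (le_trans (ler_normB _ _))//.
    by have := FB _ (nb k); have := FB _ xr; lra.
  apply: ler_wpDl; first exact: ltW.
  rewrite /c -[_ / _ * _]mulrA; apply: ler_peMr; first exact: mulr_ge0.
  rewrite ler_pdivlMl ?exprn_gt0// mulr1.
  rewrite (bigD1 i)//= ler_wpDr//; first by apply: sumr_ge0 => j _; exact: sqr_ge0.
  by rewrite -[leRHS]real_normK ?num_real// lerXn2r ?nnegrE// ltW.
pose up (k : 'I_d -> nat) := e / 2 + c * \sum_i (K / N%:R ^+ 2 * ((k i)%:R - N%:R * s i) ^+ 2).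
have ptu k : `|F (node r N k) - F x| <= up k.
  rewrite (le_trans (pt k))// lerD2l ler_wpM2l// ler_sum// => i _.
  exact: node_dist.
have upE : bernstein s l up (fun=> 0%N) <= e.
  rewrite /up bernsteinD bernstein_cst bernsteinZ bernstein_sum.
  have H i : bernstein s l (fun k => K / N%:R ^+ 2 * ((k i)%:R - N%:R * s i) ^+ 2) (fun=> 0%N)
      <= K / N%:R.
    rewrite bernsteinZ bernstein_second_moment count_directions.
    rewrite add0r subrr expr0n add0r.
    have -> : K / N%:R = K / N%:R ^+ 2 * N%:R by field; rewrite gt_eqF.
    rewrite ler_wpM2l ?divr_ge0 ?sqr_ge0// ler_piMr//.
    by have := s01 i; nra.
  have : \sum_i bernstein s l (fun k => K / N%:R ^+ 2 * ((k i)%:R - N%:R * s i) ^+ 2) (fun=> 0%N)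
      <= \sum_(i < d) (K / N%:R) by apply: ler_sum.
  rewrite sumr_const card_ord -[_ *+ d]mulr_natl => /(ler_wpM2l c0).
  have -> : c * (d%:R * (K / N%:R)) = c * d%:R * K / N%:R by rewrite (mulrA c) (mulrA _ K).
  by move=> h; have h2 := le_trans h NE; lra.
rewrite ler_norml; apply/andP; split.
- rewrite (le_trans (_ : _ <= - bernstein s l up (fun=> 0%N)))//; first by rewrite lerN2.
  rewrite -mulN1r -bernsteinZ; apply: bernstein_le => // k.
  by rewrite mulN1r lerN2 (le_trans (ler_norm _)).
- apply: le_trans upE; apply: bernstein_le => // k.
  by rewrite (le_trans (ler_norm _))// normrN.
Qed.

(** Outside the box the approximant is still an average of values of [F] at nodes in the box. There
    both functions are [O((1 + l1norm x) ^+ k)] with a constant free of [r], and the extra power in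
    [k.+1] absorbs this constant once [r] is large. *)
Lemma trig_density F : continuous F -> poly_growth F ->
  exists m, forall e, 0 < e -> exists2 p, trigpoly p &
    forall x, `|F x - p x| <= e * (1 + l1norm x) ^+ m.
Proof.
move=> Fc [C [k Fk]].
have C0 : 0 <= C.
  have := Fk 0; rewrite l1norm0 addr0 expr1n mulr1.
  exact/le_trans/normr_ge0.
exists k.+1 => e e0.
(* Outside the box [r <= l1norm x], so [1 + d%:R * r] is at most [(1 + d%:R) * (1 + l1norm x)]; [D]
   collects this bound on the approximant and the bound on [F]. *)
pose D : R := C * (1 + (1 + d%:R) ^+ k).
have D0 : 0 <= D by rewrite mulr_ge0// addr_ge0// exprn_ge0// addr_ge0.
pose r := D / e + 1.
have r0 : 0 < r by rewrite ltr_wpDl// divr_ge0// ltW.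
have rE : D <= e * (1 + r).
  by rewrite /r mulrDr mulr1 mulrDr mulrCA divff ?gt_eqF// mulr1; lra.
have B0 : 0 <= C * (1 + d%:R * r) ^+ k.
  by rewrite mulr_ge0// exprn_ge0// addr_ge0// mulr_ge0// ltW.
have FB x : (forall i, `|x i 0| <= r) -> `|F x| <= C * (1 + d%:R * r) ^+ k.
  move=> xr; rewrite (le_trans (Fk _))// ler_wpM2l// lerXn2r ?nnegrE ?addr_ge0 ?l1norm_ge0//.
    by rewrite mulr_ge0// ltW.
  by rewrite lerD2l l1norm_box.
have [N HN] := trig_approx_box Fc r0 e0 B0 FB.
exists (trig_approx F r N); first exact: trigpoly_trig_approx.
move=> x.
have x1 : 1 <= 1 + l1norm x by rewrite lerDl l1norm_ge0.
have [xr|/existsNP[i /negP]] := pselect (forall i, `|x i 0| <= r).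
  apply: le_trans (HN _ xr) _; apply: ler_peMr; first exact: ltW.
  exact: exprn_ege1.
rewrite -ltNge => rx.
have rl : r <= l1norm x by rewrite ltW// (lt_le_trans rx)// coord_l1norm.
have pb : `|trig_approx F r N x| <= C * (1 + d%:R * r) ^+ k.
  apply: bernstein_norm_le => [j|k']; first exact: sine_coord01.
  by apply: FB => j; apply: node_bound; exact: ltW.
rewrite (le_trans (ler_normB _ _))//.
apply: (@le_trans _ _ (D * (1 + l1norm x) ^+ k)).
  rewrite /D mulrDr mulr1 mulrDl lerD// -mulrA (le_trans pb)// ler_wpM2l//.
  have d0 : 0 <= d%:R :> R by [].
  have l0 := l1norm_ge0 x.
  have dr0 : 0 <= d%:R * r by rewrite mulr_ge0// ltW.
  rewrite -exprMn lerXn2r ?nnegrE ?mulr_ge0 ?(addr_ge0 ler01)//.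
  by have := ler_wpM2l d0 rl; have := l1norm_ge0 x; lra.
rewrite exprS mulrA ler_wpM2r ?exprn_ge0 ?addr_ge0 ?l1norm_ge0//.
by rewrite (le_trans rE)// ler_wpM2l ?(ltW e0)// lerD2l.
Qed.

End Density.

(** * One step of the filter at small signal-to-noise ratio *)

Section BorelVectors.
Context {R : realType} {d : nat}.

Let delta n : R := n.+1%:R^-1.

Definition rat_box (c : 'cV[rat]_d) (n : nat) : set 'cV[R]_d :=
  [set x | forall i, `|x i 0 - ratr (c i 0)| < (delta n)].

Lemma open_rat_box (U : set 'cV[R]_d) x : open U -> U x ->
  exists c n, rat_box c n x /\ rat_box c n `<=` U.
Proof.
move=> oU Ux; have := open_nbhs_nbhs (conj oU Ux).
move=> /nbhs_ballP[e /= e0 xU].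
pose n := Num.truncn (2 / e).
have n0 : 0 < delta n by rewrite invr_gt0.
have ne : 2 * (delta n) < e.
  by rewrite ltr_pdivrMr// mulrC -ltr_pdivrMr//; exact: truncnS_gt.
have cP (i : 'I_d) : exists q : rat, `|x i 0 - ratr q| < (delta n).
  have : x i 0 - (delta n) < x i 0 + (delta n).
    by rewrite ltrBlDr -addrA ltrDl addr_gt0.
  move=> /rat_in_itvoo[q]; rewrite in_itv/= => /andP[q1 q2]; exists q.
  by rewrite ltr_norml; apply/andP; split; lra.
pose c : 'cV[rat]_d := \col_i sval (cid (cP i)).
have cE i : `|x i 0 - ratr (c i 0)| < (delta n) by rewrite mxE; case: cid.
exists c, n; split => // y yc; apply: xU; split => // i j.
rewrite ord1 /ball/= (_ : _ - _ = (x i 0 - ratr (c i 0)) - (y i 0 - ratr (c i 0))); last by ring.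
by rewrite (le_lt_trans (ler_normB _ _))//; have := yc i; have := cE i; lra.
Qed.

(** Every open set is the countable union of the rational boxes it contains, and a box is described
    coordinate by coordinate. *)
Lemma measurable_to_borel_cV d' (T : measurableType d') (phi : T -> borel_cV R d) :
  (forall i, measurable_fun [set: T] (fun t => (phi t : 'cV[R]_d) i 0)) ->
  measurable_fun [set: T] phi.
Proof.
move=> mphi; apply: (@measurability _ _ T (borel_cV R d) _ _ (@open 'cV[R]_d)) => //.
move=> _ [U oU <-]; rewrite setTI.
have -> : phi @^-1` U = \bigcup_(cn : 'cV[rat]_d * nat)
    (if `[< rat_box cn.1 cn.2 `<=` U >] then phi @^-1` rat_box cn.1 cn.2 else set0).
  apply/seteqP; split => [t /= Ut|t [[c n] _] /=].
    have [c [n [ct cU]]] := open_rat_box oU Ut.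
    by exists (c, n) => //=; case: asboolP.
  by case: asboolP => // cU; exact: cU.
apply: countable_bigcupT_measurable => [|[c n]/=]; first exact: countableP.
case: asboolP => // _.
have -> : phi @^-1` rat_box c n =
    \bigcap_(i in [set: 'I_d]) [set t | `|(phi t : 'cV[R]_d) i 0 - ratr (c i 0)| < (delta n)].
  by apply/seteqP; split => [t /= H i _|t H i] /=; [exact: H|exact: H].
apply: fin_bigcap_measurable => [|i _]; first exact: finite_finset.
have := mphi i; set f := (fun t => _) => mf.
have mg : measurable_fun [set: T] (fun t => `|f t - ratr (c i 0)|).
  by apply: measurableT_comp => //; exact: measurable_funB.
rewrite -[X in measurable X]setTI; apply: measurable_fun_ltr => //.
Qed.

Lemma continuous_borel_cV (F : 'cV[R]_d -> R) : continuous F ->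
  measurable_fun [set: borel_cV R d] F.
Proof.
move=> /continuousP Fc; apply: (measurability _ (RGenOpens.measurableE R)).
move=> _ [_ [a [b ->] <-]]; rewrite setTI; apply: sub_sigma_algebra.
by apply: Fc; exact: interval_open.
Qed.

Lemma coord_borel_cV (i : 'I_d) :
  measurable_fun [set: borel_cV R d] (fun x : 'cV[R]_d => x i 0).
Proof. by apply: continuous_borel_cV; exact: coord_continuous. Qed.

Lemma measurable_simplex : measurable (@simplex R d : set (borel_cV R d)).
Proof.
have -> : @simplex R d = (\bigcap_(i in [set: 'I_d]) [set x : 'cV[R]_d | 0 <= x i 0]) `&`
    [set x : 'cV[R]_d | \sum_i x i 0 = 1].
  by apply/seteqP; split => x /= [h1 h2]; split => // i; [move=> _; exact: h1|exact: h1].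
apply: measurableI.
  apply: fin_bigcap_measurable => [|i _]; first exact: finite_finset.
  have mc := coord_borel_cV i; have := mc (@measurableT _ _) `[0, +oo[%classic (measurable_itv `[0, +oo[).
  rewrite setTI; congr (measurable _); apply/seteqP.
  by split => x/=; rewrite in_itv/= andbT.
have ms : measurable_fun [set: borel_cV R d] (fun x : 'cV[R]_d => \sum_i x i 0).
  by apply: measurable_sum => i; exact: coord_borel_cV.
rewrite -[X in measurable X]setTI.
by apply: (ms _ [set 1]) => //; exact: measurable_set1.
Qed.

End BorelVectors.

(** * Bayes' rule for one observation and its linearization *)

Section OneStep.
Context {R : realType} {d : nat}.
Variable hv : 'cV[R]_d.
Implicit Types (p mu v z : 'cV[R]_d) (e u : R).

(* [bayes e p u] is the posterior of the prior [p] after the observation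
   [y = u / e] with noise level [1 / e]; [lik e p u] is the density of [u] with
   respect to the standard normal law. *)
Definition weight e (i : 'I_d) u : R :=
  expR (e * hv i 0 * u - (e * hv i 0) ^+ 2 / 2).

Definition lik e p u : R := \sum_i p i 0 * weight e i u.

Definition bayes e p u : 'cV[R]_d := \col_i (p i 0 * weight e i u / lik e p u).

Let H := l1norm hv.
Let H0 : 0 <= H. Proof. exact: l1norm_ge0. Qed.
Let hH i : `|hv i 0| <= H. Proof. exact: coord_l1norm. Qed.

(** A common bound for the exponents of all weights: for [0 < e <= 1] they are at most [e * drive u]
    in absolute value. *)
Definition drive u : R := H * `|u| + H ^+ 2.

Let drive0 u : 0 <= drive u.
Proof. by rewrite addr_ge0 ?mulr_ge0 ?sqr_ge0. Qed.

Lemma subexp_drive : subexp drive.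
Proof.
apply: subexpD; last exact: subexp_cst.
by apply: subexpZ; apply: (@subexp_norm _ id); exact: subexp_id.
Qed.

Lemma subexp_expR_drive (c : R) : subexp (fun u => expR (c * drive u)).
Proof.
have := subexpZ (expR (c * H ^+ 2)) (subexp_expR_abs (c * H)).
by congr subexp; apply/funext => u; rewrite -expRD /drive; congr expR; ring.
Qed.

Lemma weight_gt0 e i u : 0 < weight e i u. Proof. exact: expR_gt0. Qed.

Lemma subexp_weight e i : subexp (weight e i).
Proof. exact: subexp_expR_shift. Qed.

Lemma gE_weight e i : gE (weight e i) = 1.
Proof.
have := gE_shift (e * hv i 0) (subexp_cst 1); rewrite gE_cst => ->.
by congr gE; apply/funext => u; rewrite mul1r.
Qed.

Lemma subexp_lik e p : subexp (lik e p).
Proof. by apply: subexp_sum => i; apply: subexpZ; exact: subexp_weight. Qed.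

Lemma gE_lik e p : simplex p -> gE (lik e p) = 1.
Proof.
move=> [_ <-]; rewrite /lik.
elim: (index_enum _) => [|i r IH].
  by under [X in gE X]eq_fun do rewrite big_nil; rewrite gE_cst big_nil.
under [X in gE X]eq_fun do rewrite big_cons.
rewrite gED.
- by rewrite gEZ ?gE_weight ?mulr1 ?IH ?big_cons//; exact: subexp_weight.
- by apply: subexpZ; exact: subexp_weight.
- by apply: subexp_sum => j; apply: subexpZ; exact: subexp_weight.
Qed.

Lemma lik_gt0 e p u : simplex p -> 0 < lik e p u.
Proof.
move=> [p0 p1]; have : \sum_i p i 0 != 0 by rewrite p1 oner_eq0.
rewrite psumr_neq0// => /hasP[i _ /= pi].
rewrite /lik (bigD1 i)//= ltr_wpDr ?mulr_gt0 ?weight_gt0//.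
by apply: sumr_ge0 => j _; rewrite mulr_ge0// ltW// weight_gt0.
Qed.

Lemma bayes_simplex e p u : simplex p -> simplex (bayes e p u).
Proof.
move=> pS; have L0 := lik_gt0 e u pS; have [p0 _] := pS; split.
  by move=> i; rewrite mxE divr_ge0 ?mulr_ge0 ?(ltW L0) ?(ltW (weight_gt0 _ _ _)).
under eq_bigr do rewrite mxE.
by rewrite -mulr_suml divff// gt_eqF.
Qed.

Section SmallNoise.
Variable e : R.
Hypotheses (e0 : 0 < e) (e1 : e <= 1).

Let x i u := e * hv i 0 * u - (e * hv i 0) ^+ 2 / 2.

Let x_bound i u : `|x i u| <= e * drive u.
Proof.
rewrite (le_trans (ler_normB _ _))// /drive mulrDr lerD//.
  by rewrite !normrM (gtr0_norm e0) -mulrA ler_wpM2l ?(ltW e0)// ler_wpM2r.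
rewrite ger0_norm ?divr_ge0 ?sqr_ge0//.
have h2 : hv i 0 ^+ 2 <= H ^+ 2.
  by rewrite -[leLHS]real_normK ?num_real// lerXn2r ?nnegrE.
have e2 : e ^+ 2 <= e by rewrite expr2 ler_piMl// ltW.
have := ler_wpM2r (sqr_ge0 (hv i 0)) e2; have := ler_wpM2l (ltW e0) h2.
by rewrite exprMn; have := mulr_ge0 (sqr_ge0 e) (sqr_ge0 (hv i 0)); lra.
Qed.

Let x_bound1 i u : `|x i u| <= drive u.
Proof. by rewrite (le_trans (x_bound i u))// ler_piMl. Qed.

Lemma weight_sub1 i u : `|weight e i u - 1| <= e * (drive u * expR (drive u)).
Proof.
rewrite (le_trans (expR_norm_le _))// mulrA ler_pM ?expR_ge0//.
  exact: x_bound.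
by rewrite ler_expR x_bound1.
Qed.

Lemma lik_sub1 p u : simplex p -> `|lik e p u - 1| <= e * (drive u * expR (drive u)).
Proof.
move=> [p0 p1]; rewrite -{1}p1 -sumrB (le_trans (ler_norm_sum _ _ _))//.
rewrite -[leRHS]mul1r -p1 mulr_suml ler_sum// => i _.
rewrite -{2}[p i 0]mulr1 -mulrBr normrM ger0_norm// ler_wpM2l//.
exact: weight_sub1.
Qed.

Lemma lik_le p u : simplex p -> lik e p u <= 1 + drive u * expR (drive u).
Proof.
move=> pS; have := ler_norm (lik e p u - 1); have := lik_sub1 u pS.
have : e * (drive u * expR (drive u)) <= drive u * expR (drive u).
  by rewrite ler_piMl// mulr_ge0 ?expR_ge0.
lra.
Qed.

Definition weight_rem i u := weight e i u - 1 - e * hv i 0 * u.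

Definition weight_rem_bound u := drive u ^+ 2 * expR (drive u) + H ^+ 2.

Lemma weight_remP i u : `|weight_rem i u| <= e ^+ 2 * weight_rem_bound u.
Proof.
have -> : weight_rem i u = (expR (x i u) - 1 - x i u) - (e * hv i 0) ^+ 2 / 2.
  by rewrite /weight_rem /weight -/(x i u) /x; ring.
rewrite (le_trans (ler_normB _ _))// /weight_rem_bound mulrDr lerD//.
  rewrite (le_trans (expR_taylor _))// mulrA -exprMn ler_pM ?sqr_ge0 ?expR_ge0//.
    rewrite -[leLHS]real_normK ?num_real// lerXn2r ?nnegrE ?x_bound//.
    by rewrite mulr_ge0// ltW.
  by rewrite ler_expR x_bound1.
rewrite ger0_norm ?divr_ge0 ?sqr_ge0// exprMn -mulrA ler_wpM2l ?sqr_ge0//.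
have h2 : hv i 0 ^+ 2 <= H ^+ 2.
  by rewrite -[leLHS]real_normK ?num_real// lerXn2r ?nnegrE.
by have := sqr_ge0 (hv i 0); lra.
Qed.

Definition jump_bound u := 2 * drive u * expR (2 * drive u).

(** The difference of a weight and the likelihood is a [p]-average of differences of weights, each
    at most a small multiple of [weight e j u]. The average of these is the likelihood again and
    cancels the denominator, so the bound is uniform in [p] and [e]. *)
Lemma bayes_jump p u : simplex p ->
  e^-1 * l1norm (bayes e p u - p) <= jump_bound u.
Proof.
move=> pS; have L0 := lik_gt0 e u pS; have [p0 p1] := pS.
rewrite ler_pdivrMl// -[leRHS]mul1r -p1 mulr_suml ler_sum// => i _.
rewrite !mxE; set L := lik e p u in L0 *.
have -> : p i 0 * weight e i u / L - p i 0 = p i 0 * ((weight e i u - L) / L).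
  by field; rewrite gt_eqF.
rewrite normrM ger0_norm// ler_wpM2l// normrM normfV (gtr0_norm L0).
rewrite ler_pdivrMr// mulr_sumr.
have -> : weight e i u - L = \sum_j p j 0 * (weight e i u - weight e j u).
  under eq_bigr do rewrite mulrBr.
  by rewrite sumrB -mulr_suml p1 mul1r.
rewrite (le_trans (ler_norm_sum _ _ _))// ler_sum// => j _.
rewrite normrM ger0_norm// mulrCA ler_wpM2l//.
have -> : weight e i u - weight e j u = weight e j u * (expR (x i u - x j u) - 1).
  by rewrite mulrBr mulr1 /weight -expRD; congr (expR _ - _); rewrite /x; ring.
rewrite normrM gtr0_norm ?weight_gt0// mulrC ler_wpM2r ?(ltW (weight_gt0 _ _ _))//.
rewrite (le_trans (expR_norm_le _))// /jump_bound mulrA ler_pM ?expR_ge0//.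
  rewrite (le_trans (ler_normB _ _))//.
  by have := x_bound i u; have := x_bound j u; lra.
rewrite ler_expR (le_trans (ler_normB _ _))//.
by have := x_bound1 i u; have := x_bound1 j u; lra.
Qed.

Definition linear_error u := 2 * weight_rem_bound u + 2 * H * `|u| * (drive u * expR (drive u)).

(* Multiplying the error of the linearization by the likelihood cancels the
   denominator of [bayes]. *)
Lemma bayes_linearization p mu u : simplex p -> simplex mu ->
  lik e p u * l1norm (e^-1 *: (bayes e p u - p) - u *: drift mu hv) <=
  e * (linear_error u + 3 * H * `|u| * (e^-1 * l1norm (p - mu))).
Proof.
move=> pS muS; have L0 := lik_gt0 e u pS; have [p0 p1] := pS; have [mu0 mu1] := muS.
set L := lik e p u in L0 *.
pose rbar := \sum_j p j 0 * weight_rem j u.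
have LE : L = 1 + e * dotp p hv * u + rbar.
  rewrite /L /lik /rbar -{1}p1 /dotp mulr_sumr mulr_suml -!big_split/=.
  by apply: eq_bigr => j _; rewrite /weight_rem; ring.
have rb : `|rbar| <= e ^+ 2 * weight_rem_bound u.
  rewrite /rbar (le_trans (ler_norm_sum _ _ _))//.
  rewrite -[leRHS]mul1r -p1 mulr_suml ler_sum// => i _.
  by rewrite normrM ger0_norm// ler_wpM2l// weight_remP.
have dH q : simplex q -> `|dotp q hv| <= H.
  by move=> /simplex_l1norm q1; rewrite (le_trans (dotp_bound _ _))// q1 mul1r.
have dpm : `|dotp (p - mu) hv| <= H * l1norm (p - mu).
  by rewrite (le_trans (dotp_bound _ _))// mulrC.
rewrite -[leLHS](ger0_norm (mulr_ge0 (ltW L0) (l1norm_ge0 _))) normrM.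
rewrite (ger0_norm (l1norm_ge0 _)) -l1normZ.
have pt i : `|(L *: (e^-1 *: (bayes e p u - p) - u *: drift mu hv)) i 0| <=
   p i 0 * (e * (2 * weight_rem_bound u)) +
   (`|(p - mu) i 0| * (2 * H * `|u|) + mu i 0 * (H * `|u| * l1norm (p - mu))) +
   mu i 0 * (e * (2 * H * `|u| * (drive u * expR (drive u)))).
  have := driftE mu hv i; move: (drift mu hv) => b bE.
  have dE : p i 0 - mu i 0 = (p - mu) i 0 by rewrite !mxE.
  rewrite !mxE -/L bE dE.
  (* Three sources of error: the second-order remainder of the weights, the exchange of [p] for [mu]
     in the drift, and the exchange of the likelihood for 1. *)
  have -> : L * (e^-1 * (p i 0 * weight e i u / L - p i 0) -
      u * (mu i 0 * (hv i 0 - dotp mu hv))) =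
    p i 0 * (e^-1 * (weight_rem i u - rbar)) +
    (((p - mu) i 0 * (hv i 0 - dotp p hv) * u) - mu i 0 * (dotp (p - mu) hv * u)) +
    mu i 0 * ((hv i 0 - dotp mu hv) * u * (1 - L)).
    rewrite dotpBl !mxE.
    have -> : L * (e^-1 * (p i 0 * weight e i u / L - p i 0) -
      u * (mu i 0 * (hv i 0 - dotp mu hv))) =
      p i 0 * e^-1 * (weight e i u - L) - L * (u * (mu i 0 * (hv i 0 - dotp mu hv))).
      by field; rewrite !gt_eqF.
    have -> : weight e i u = 1 + e * hv i 0 * u + weight_rem i u.
      by rewrite /weight_rem; ring.
    have -> : rbar = L - 1 - e * dotp p hv * u by rewrite LE; ring.
    by field; rewrite gt_eqF.
  have hd q : simplex q -> `|hv i 0 - dotp q hv| <= 2 * H.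
    move=> qS; rewrite (le_trans (ler_normB _ _))//.
    by have := hH i; have := dH q qS; lra.
  rewrite (le_trans (ler_normD _ _))// lerD//.
    rewrite (le_trans (ler_normD _ _))// lerD//.
      rewrite normrM ger0_norm// ler_wpM2l// normrM normfV (gtr0_norm e0).
      rewrite ler_pdivrMl// (le_trans (ler_normB _ _))//.
      by have := weight_remP i u; have := rb; rewrite expr2; lra.
    rewrite (le_trans (ler_normB _ _))// lerD//.
      by rewrite !normrM -mulrA ler_wpM2l// ler_wpM2r// hd.
    rewrite normrM ger0_norm// ler_wpM2l// normrM mulrAC [leRHS]mulrAC.
    by rewrite [leRHS]mulrAC ler_wpM2r.
  rewrite normrM ger0_norm// ler_wpM2l// !normrM mulrCA ler_pM ?mulr_ge0//.
    by rewrite ler_wpM2r// hd.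
  by rewrite -normrN opprB; exact: lik_sub1.
rewrite /l1norm (le_trans (ler_sum _ (fun i _ => pt i)))//.
rewrite !big_split/= -!mulr_suml p1 mu1 !mul1r -/(l1norm (p - mu)).
rewrite /linear_error le_eqVlt; apply/orP; left; apply/eqP.
by field; rewrite gt_eqF.
Qed.

End SmallNoise.

End OneStep.

(** Inversion is discontinuous at 0, so it is written piecewise by [expR] and [ln], with the
    conventional value 0 at 0. *)
Lemma measurable_inv (R : realType) : measurable_fun [set: R] (fun x : R => x^-1).
Proof.
have -> : (fun x : R => x^-1) = fun x => if 0 < x then expR (- ln x) else
    if x < 0 then - expR (- ln (- x)) else 0.
  apply/funext => x; have [x0|x0|x0] := ltgtP 0 x; last by rewrite -x0 invr0.
  - by rewrite expRN lnK// posrE.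
  - by rewrite expRN lnK ?posrE ?oppr_gt0// invrN opprK.
have mln := @measurable_ln R.
have mN : measurable_fun [set: R] (fun x : R => - x) by exact: measurable_funN.
have mN' (f : R -> R) : measurable_fun [set: R] f -> measurable_fun [set: R] (fun x => expR (- f x)).
  by move=> mf; apply: measurableT_comp => //; exact: measurableT_comp.
apply: measurable_fun_ifT.
- exact: measurable_fun_ltr.
- exact: mN'.
- apply: measurable_fun_ifT => //; first exact: measurable_fun_ltr.
  apply: measurableT_comp => //.
  by apply: mN'; exact: measurableT_comp.
Qed.

Section ContinuousVectors.
Context {R : realType} {d : nat}.
Implicit Types (v : 'cV[R]_d) (B : 'M[R]_d).

Lemma coord_cvg (i : 'I_d) (x : 'cV[R]_d) : y i 0 @[y --> x] --> x i 0.
Proof. exact: coord_continuous. Qed.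

Lemma continuous_dotp v : continuous (dotp v).
Proof.
move=> x; apply: (@cvg_finsum R _ _ (nbhs x) _ _ (fun i (y : 'cV[R]_d) => v i 0 * y i 0)) => i.
by apply: cvgM; [exact: cvg_cst|exact: coord_cvg].
Qed.

Lemma continuous_l1norm_mul B : continuous (fun x : 'cV[R]_d => l1norm (B *m x)).
Proof.
move=> x.
apply: (@cvg_finsum R _ _ (nbhs x) _ _ (fun i (y : 'cV[R]_d) => `|(B *m y) i 0|)) => i.
have E (y : 'cV[R]_d) : (B *m y) i 0 = dotp (row i B)^T y.
  by rewrite dotpE trmxK -row_mul [RHS]mxE.
under eq_fun do rewrite E; rewrite E.
by apply: (@cvg_norm _ R^o); exact: continuous_dotp.
Qed.

Lemma continuous_l1norm : continuous (@l1norm R d).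
Proof.
have := @continuous_l1norm_mul 1%:M; rewrite (_ : (fun x => _) = @l1norm R d)//.
by apply/funext => x; rewrite mul1mx.
Qed.

Lemma continuous_adapted_norm (Lam : 'M[R]_d) q : continuous (adapted_norm Lam q).
Proof.
move=> x; apply: (@cvg_finsum R _ _ (nbhs x) _ _
  (fun (k : 'I_q) (y : 'cV[R]_d) => l1norm (Lam^T ^+ k *m y))) => k.
exact: continuous_l1norm_mul.
Qed.

Lemma measurable_mulmx_borel B :
  measurable_fun [set: borel_cV R d] (fun x : 'cV[R]_d => (B *m x : borel_cV R d)).
Proof.
apply: measurable_to_borel_cV => i.
have E (y : 'cV[R]_d) : (B *m y) i 0 = dotp (row i B)^T y.
  by rewrite dotpE trmxK -row_mul [RHS]mxE.
under eq_fun do rewrite E.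
by apply: continuous_borel_cV; exact: continuous_dotp.
Qed.

Lemma measurable_centered_borel (s : R) (mu : 'cV[R]_d) :
  measurable_fun [set: borel_cV R d] (fun x : 'cV[R]_d => (s *: (x - mu) : borel_cV R d)).
Proof.
apply: measurable_to_borel_cV => i.
have -> : (fun x : borel_cV R d => (s *: ((x : 'cV[R]_d) - mu)) i 0) =
    (fun x : 'cV[R]_d => s * (x i 0 - mu i 0)).
  by apply/funext => x; rewrite !mxE.
apply: measurable_funM => //; apply: measurable_funB => //.
exact: coord_borel_cV.
Qed.

End ContinuousVectors.

Section MeasurableBayes.
Context {R : realType} {d : nat} (hv : 'cV[R]_d) (e : R).

Lemma measurable_weight i : measurable_fun [set: R] (weight hv e i).
Proof. exact: (subexp_weight hv e i).1. Qed.

Lemma measurable_lik_comp d' (T : measurableType d') (p : T -> borel_cV R d) (u : T -> R) :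
  measurable_fun [set: T] p -> measurable_fun [set: T] u ->
  measurable_fun [set: T] (fun t => lik hv e (p t) (u t)).
Proof.
move=> mp mu; apply: measurable_sum => i; apply: measurable_funM.
  by apply: (measurableT_comp (coord_borel_cV i)).
exact: (measurableT_comp (measurable_weight i)).
Qed.

Lemma measurable_bayes_comp d' (T : measurableType d') (p : T -> borel_cV R d) (u : T -> R) :
  measurable_fun [set: T] p -> measurable_fun [set: T] u ->
  measurable_fun [set: T] (fun t => (bayes hv e (p t) (u t) : borel_cV R d)).
Proof.
move=> mp mu; apply: measurable_to_borel_cV => i.
under eq_fun do rewrite mxE.
apply: measurable_funM.
  apply: measurable_funM; first by apply: (measurableT_comp (coord_borel_cV i)).
  exact: (measurableT_comp (measurable_weight i)).
by apply: (measurableT_comp (@measurable_inv R)); exact: measurable_lik_comp.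
Qed.

Lemma measurable_bayes p :
  measurable_fun [set: R] (fun u => (bayes hv e p u : borel_cV R d)).
Proof. by apply: measurable_bayes_comp => //; exact: measurable_cst. Qed.

End MeasurableBayes.

(** * One-step estimates for cosines and for moments *)

Section OneStepExpectation.
Context {R : realType} {d : nat}.
Variable hv : 'cV[R]_d.
Implicit Types (p mu v : 'cV[R]_d) (e u : R).

Let H := l1norm hv.
Let H0 : 0 <= H. Proof. exact: l1norm_ge0. Qed.

Lemma subexp_abs : subexp (fun u : R => `|u|).
Proof. by apply: (@subexp_norm _ id); exact: subexp_id. Qed.

Lemma subexp_drive_expR : subexp (fun u => drive hv u * expR (drive hv u)).
Proof.
apply: subexpM; first exact: subexp_drive.
by have := subexp_expR_drive hv 1; under eq_fun do rewrite mul1r.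
Qed.

Lemma subexp_jump_bound : subexp (jump_bound hv).
Proof.
apply: subexpM; last exact: subexp_expR_drive.
by apply: subexpZ; exact: subexp_drive.
Qed.

Lemma subexp_linear_error : subexp (linear_error hv).
Proof.
have sd := subexp_drive hv.
have sE : subexp (fun u => expR (drive hv u)).
  by have := subexp_expR_drive hv 1; under eq_fun do rewrite mul1r.
apply: subexpD.
  apply: subexpZ; apply: subexpD; last exact: subexp_cst.
  by apply: subexpM => //; exact: subexpX.
apply: subexpM; last exact: subexp_drive_expR.
by apply: subexpZ; exact: subexp_abs.
Qed.

Lemma measurable_zeta e mu p : measurable_fun [set: R]
  (fun u => (e^-1 *: (bayes hv e p u - mu) : borel_cV R d)).
Proof.
exact: (measurableT_comp (measurable_centered_borel e^-1 mu) (measurable_bayes hv e p)).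
Qed.

(** For the linearized step and the standard normal law, [gE_cos] evaluates the expectation exactly.
    Two errors remain: the linearization inside the cosine, which is Lipschitz, and the replacement
    of the likelihood by 1. *)
Lemma trig_one_step v : exists2 C, 0 <= C & forall e mu p th,
  0 < e -> e <= 1 -> simplex p -> simplex mu ->
  `|gE (fun u => cos (dotp v (e^-1 *: (bayes hv e p u - mu)) + th) * lik hv e p u) -
    expR (- (dotp v (drift mu hv) ^+ 2 / 2)) *
      cos (dotp v (e^-1 *: (p - mu)) + th)| <=
  e * (C * (1 + l1norm (e^-1 *: (p - mu)))).
Proof.
pose f1 u := l1norm v * linear_error hv u + drive hv u * expR (drive hv u).
pose f2 (u : R) := l1norm v * (3 * H) * `|u|.
have sf1 : subexp f1.
  apply: subexpD; last exact: subexp_drive_expR.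
  by apply: subexpZ; exact: subexp_linear_error.
have sf2 : subexp f2 by apply: subexpZ; exact: subexp_abs.
have v0 := l1norm_ge0 v.
have dr0 u : 0 <= drive hv u.
  by rewrite addr_ge0 ?mulr_ge0 ?sqr_ge0.
have f10 u : 0 <= f1 u.
  rewrite addr_ge0 ?mulr_ge0 ?expR_ge0// addr_ge0 ?mulr_ge0 ?expR_ge0//.
  by rewrite addr_ge0 ?sqr_ge0// mulr_ge0 ?expR_ge0 ?sqr_ge0.
have f20 u : 0 <= f2 u by rewrite !mulr_ge0.
have c1 : 0 <= gE f1 by apply: gE_ge0.
have c2 : 0 <= gE f2 by apply: gE_ge0.
exists (gE f1 + gE f2); first exact: addr_ge0.
move=> e mu p th e0 e1 pS muS.
set b := drift mu hv; set z := e^-1 *: (p - mu).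
have lz : l1norm z = e^-1 * l1norm (p - mu) by rewrite l1normZ gtr0_norm ?invr_gt0.
have -> : expR (- (dotp v b ^+ 2 / 2)) * cos (dotp v z + th) =
    gE (fun u => cos (dotp v b * u + (dotp v z + th))) by rewrite gE_cos mulrC.
have sL := subexp_lik hv e p.
have sc : subexp (fun u => cos (dotp v (e^-1 *: (bayes hv e p u - mu)) + th)).
  apply: (@subexp_bounded _ _ 1); last by move=> u; rewrite ler_norml cos_geN1 cos_le1.
  apply: (@measurableT_comp _ _ _ _ _ _ (@cos R)).
    by apply: continuous_measurable_fun; exact: continuous_cos.
  apply: measurable_funD => //.
  apply: (measurableT_comp (continuous_borel_cV (@continuous_dotp _ _ v))).
  exact: measurable_zeta.
have sc' := subexp_cos (dotp v b) (dotp v z + th).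
have scL := subexpM sc sL.
rewrite -gEB// (le_trans (gE_norm _))//; first exact: subexpB.
apply: (@le_trans _ _ (gE (fun u => e * (f1 u + f2 u * l1norm z)))).
  apply: le_gE => [||u].
  - by apply: subexp_norm; exact: subexpB.
  - apply: subexpZ; apply: subexpD => //; apply: subexpM => //; exact: subexp_cst.
  set c := cos (dotp v (e^-1 *: _) + th); set c' := cos (_ + _).
  have -> : c * lik hv e p u - c' = lik hv e p u * (c - c') + (lik hv e p u - 1) * c' by ring.
  have L0 := lik_gt0 hv e u pS.
  have c'1 : `|c'| <= 1 by rewrite ler_norml cos_geN1 cos_le1.
  have S1 : `|(lik hv e p u - 1) * c'| <= e * (drive hv u * expR (drive hv u)).
    rewrite normrM -[leRHS]mulr1 ler_pM//.
    exact: lik_sub1.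
  have S2 : `|lik hv e p u * (c - c')| <=
      l1norm v * (e * (linear_error hv u + 3 * H * `|u| * (e^-1 * l1norm (p - mu)))).
    rewrite normrM gtr0_norm//.
    have cc : `|c - c'| <= l1norm v * l1norm (e^-1 *: (bayes hv e p u - p) - u *: b).
      rewrite (le_trans (cos_lipschitz _ _))//.
      rewrite (_ : _ - _ = dotp v (e^-1 *: (bayes hv e p u - p) - u *: b)).
        exact: dotp_bound.
      by rewrite /z !(dotpBr, dotpZr); ring.
    rewrite (le_trans (ler_wpM2l (ltW L0) cc))// mulrCA ler_wpM2l//.
    exact: bayes_linearization.
  rewrite (le_trans (ler_normD _ _))// (le_trans (lerD S2 S1))//.
  by rewrite -lz le_eqVlt; apply/orP; left; apply/eqP; rewrite /f1 /f2; ring.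
have sfz : subexp (fun u => f2 u * l1norm z).
  by apply: subexpM => //; exact: subexp_cst.
rewrite gEZ; last exact: subexpD.
rewrite (gED sf1 sfz).
rewrite ler_wpM2l ?(ltW e0)//.
have -> : gE (fun u => f2 u * l1norm z) = l1norm z * gE f2.
  by rewrite -gEZ//; congr gE; apply/funext => u; rewrite mulrC.
by have l0 := l1norm_ge0 z; have := mulr_ge0 c1 l0; lra.
Qed.

(** Either [y] is small relative to [x], and a contraction survives with the rate halfway between
    [r] and 1, or [x] is at most a multiple of [y]. The coefficient of [x ^+ m] stays below 1 for
    every [m]. *)
Lemma contract_pow (r x y : R) m : 0 <= r -> r < 1 -> 0 <= x -> 0 <= y -> (0 < m)%N ->
  (r * x + y) ^+ m <=
  (1 + r) / 2 * x ^+ m + ((1 + r / ((1 - r) / 2)) * y) ^+ m.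
Proof.
move=> r0 r1 x0 y0 m0.
have k0 : 0 < (1 - r) / 2 by lra.
have K0 : 0 <= 1 + r / ((1 - r) / 2) by rewrite addr_ge0// divr_ge0// ltW.
have rx0 : 0 <= r * x + y by rewrite addr_ge0 ?mulr_ge0.
have [yx|xy] := leP y ((1 - r) / 2 * x).
  rewrite ler_wpDr ?exprn_ge0 ?mulr_ge0//.
  apply: (@le_trans _ _ (((1 + r) / 2 * x) ^+ m)).
    rewrite lerXn2r ?nnegrE//; first by rewrite mulr_ge0//; lra.
    by lra.
  rewrite exprMn ler_wpM2r ?exprn_ge0//.
  have h : 0 <= (1 + r) / 2 <= 1 by apply/andP; split; lra.
  by case: m m0 => // m _; rewrite exprS ler_piMr ?exprn_ile1//; case/andP: h.
rewrite ler_wpDl ?mulr_ge0 ?exprn_ge0//; first lra.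
rewrite lerXn2r ?nnegrE ?mulr_ge0//.
rewrite mulrDl mul1r addrC lerD2l -mulrA ler_wpM2l//.
by rewrite ler_pdivlMl// ltW.
Qed.

Section Moments.
Variables (Lam : 'M[R]_d) (q m : nat).
Hypotheses (LS : stochastic_mx Lam) (q0 : (0 < q)%N) (m0 : (0 < m)%N).
Hypothesis Lq : forall x : 'cV[R]_d, total x = 0 ->
  l1norm (Lam^T ^+ q *m x) <= 2^-1 * l1norm x.

Let N := adapted_norm Lam q.

Lemma subexp_adapted_norm e mu p : 0 < e -> e <= 1 -> simplex p ->
  subexp (fun u => N (e^-1 *: (bayes hv e p u - mu))).
Proof.
move=> e0 e1 pS.
apply: (@subexp_le _ _ (fun u => N (e^-1 *: (p - mu)) + q%:R * jump_bound hv u)).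
- apply: (measurableT_comp (continuous_borel_cV (@continuous_adapted_norm _ _ Lam q))).
  exact: measurable_zeta.
- by apply: subexpD; [exact: subexp_cst|apply: subexpZ; exact: subexp_jump_bound].
- move=> u; rewrite (ger0_norm (adapted_norm_ge0 _ _ _)).
  apply: le_trans (ler_norm _).
  have -> : e^-1 *: (bayes hv e p u - mu) =
      e^-1 *: (p - mu) + e^-1 *: (bayes hv e p u - p).
    by rewrite -scalerDr [in RHS]addrC addrA subrK.
  rewrite (le_trans (adapted_normD _ _ _ _))// lerD2l.
  rewrite (le_trans (adapted_norm_le _ LS _))// ler_wpM2l//.
  by rewrite l1normZ gtr0_norm ?invr_gt0// bayes_jump.
Qed.

(** A Lyapunov drift condition: the transition contracts the adapted norm, and the update adds at
    most a multiple of [jump_bound], whose moments involve neither [e] nor the law. *)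
Lemma moment_one_step : exists2 C, 0 <= C & forall e mu eta,
  0 < e -> e <= 1 -> invariant_distr Lam mu -> simplex eta ->
  gE (fun u => N (e^-1 *: (bayes hv e (Lam^T *m eta) u - mu)) ^+ m *
        lik hv e (Lam^T *m eta) u) <=
  (1 - (4 * q%:R)^-1) * N (e^-1 *: (eta - mu)) ^+ m + C.
Proof.
have q1 : 1 <= q%:R :> R by rewrite ler1n.
have qi : 0 < (2 * q%:R)^-1 :> R by rewrite invr_gt0; lra.
have qi1 : (2 * q%:R)^-1 <= 1 :> R by rewrite invf_le1; lra.
pose r : R := 1 - (2 * q%:R)^-1.
have r0 : 0 <= r by rewrite /r; lra.
have r1 : r < 1 by rewrite /r; lra.
have rE : (1 + r) / 2 = 1 - (4 * q%:R)^-1.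
  by rewrite /r; field; rewrite gt_eqF//; lra.
pose K : R := 1 + r / ((1 - r) / 2).
have K0 : 0 <= K by rewrite addr_ge0// divr_ge0//; lra.
pose g u := (K * (q%:R * jump_bound hv u)) ^+ m.
have dr0 u : 0 <= drive hv u.
  by rewrite addr_ge0 ?mulr_ge0 ?sqr_ge0.
have jb0 u : 0 <= jump_bound hv u by rewrite !mulr_ge0 ?expR_ge0.
have g0 u : 0 <= g u by rewrite exprn_ge0// !mulr_ge0.
have sg : subexp g.
  by apply: subexpX; apply: subexpZ; apply: subexpZ; exact: subexp_jump_bound.
have sgd : subexp (fun u => g u * (1 + drive hv u * expR (drive hv u))).
  by apply: subexpM => //; apply: subexpD; [exact: subexp_cst|exact: subexp_drive_expR].
exists (gE (fun u => g u * (1 + drive hv u * expR (drive hv u)))).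
  by apply: gE_ge0 => u; rewrite mulr_ge0// addr_ge0 ?mulr_ge0 ?expR_ge0.
move=> e mu eta e0 e1 [muS muI] etaS.
have pS : simplex (Lam^T *m eta) by exact: stoch_simplex.
set p := Lam^T *m eta in pS *.
have sN : subexp (fun u => N (e^-1 *: (bayes hv e p u - mu))) by exact: subexp_adapted_norm.
have sL := subexp_lik hv e p.
set Nz := N (e^-1 *: (eta - mu)).
have Nz0 : 0 <= Nz by exact: adapted_norm_ge0.
have cN : N (e^-1 *: (p - mu)) <= r * Nz.
  have -> : e^-1 *: (p - mu) = Lam^T *m (e^-1 *: (eta - mu)).
    by rewrite -scalemxAr mulmxBr muI.
  apply: adapted_norm_contract => //.
  by rewrite totalZ simplex_sub_total// mulr0.
apply: (@le_trans _ _ (gE (fun u => (1 + r) / 2 * Nz ^+ m * lik hv e p u +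
    g u * (1 + drive hv u * expR (drive hv u))))).
  apply: le_gE => [||u].
  - by apply: subexpM => //; exact: subexpX.
  - by apply: subexpD => //; exact: subexpZ.
  have L0 := lik_gt0 hv e u pS.
  apply: (@le_trans _ _ (((1 + r) / 2 * Nz ^+ m + g u) * lik hv e p u)).
    rewrite ler_wpM2r ?(ltW L0)//.
    apply: le_trans (contract_pow r0 r1 Nz0 _ m0); last by rewrite mulr_ge0.
    rewrite lerXn2r ?nnegrE ?adapted_norm_ge0 ?addr_ge0 ?mulr_ge0//.
    have -> : e^-1 *: (bayes hv e p u - mu) =
        e^-1 *: (p - mu) + e^-1 *: (bayes hv e p u - p).
      by rewrite -scalerDr [in RHS]addrC addrA subrK.
    rewrite (le_trans (adapted_normD _ _ _ _))// lerD//.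
    rewrite (le_trans (adapted_norm_le _ LS _))// ler_wpM2l//.
    by rewrite l1normZ gtr0_norm ?invr_gt0// bayes_jump.
  by rewrite mulrDl lerD2l ler_wpM2l// lik_le.
rewrite gED//; last exact: subexpZ.
by rewrite gEZ// gE_lik// mulr1 rE.
Qed.

End Moments.

End OneStepExpectation.

(** * The filter kernel in the rescaled observation *)

Section FilterKernel.
Context {R : realType} {d : nat}.
Variables (Lam : 'M[R]_d) (hv : 'cV[R]_d) (sigma : R).
Hypotheses (LS : stochastic_mx Lam) (sigma0 : 0 < sigma).
Implicit Types (eta : 'cV[R]_d) (A : set 'cV[R]_d).

Let e := sigma^-1.
Local Notation gam := (normal_prob (0 : R) 1).

(** The factor [normal_pdf 0 1 (e * y)] is common to all coordinates; normalization removes it and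
    leaves Bayes' rule. *)
Lemma filter_unnormE eta y i : filter_unnorm Lam hv sigma y eta i 0 =
  normal_pdf 0 1 (e * y) * ((Lam^T *m eta) i 0 * weight hv e i (e * y)).
Proof.
rewrite /filter_unnorm /obs_mx -mulmxA mul_diag_mx mxE [X in X * _]mxE.
have -> : (y - hv i 0) / sigma = e * y - e * hv i 0 by rewrite /e; ring.
by rewrite normal_pdf_shift -mulrA [_ * expR _]mulrC.
Qed.

Lemma normal_pdf_gt0 (x : R) : 0 < normal_pdf 0 1 x.
Proof. by rewrite normal_pdfE ?oner_eq0// mulr_gt0 ?expR_gt0// normal_peak_gt0 ?oner_eq0. Qed.

Lemma filter_unnorm_l1norm eta y : simplex eta ->
  l1norm (filter_unnorm Lam hv sigma y eta) =
  normal_pdf 0 1 (e * y) * lik hv e (Lam^T *m eta) (e * y).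
Proof.
move=> etaS; have [p0 _] := stoch_simplex LS etaS.
rewrite /l1norm /lik mulr_sumr; apply: eq_bigr => i _.
rewrite filter_unnormE ger0_norm// mulr_ge0 ?(ltW (normal_pdf_gt0 _))//.
by rewrite mulr_ge0// ltW// weight_gt0.
Qed.

Lemma filter_stepE eta y : simplex eta ->
  filter_step Lam hv sigma y eta = bayes hv e (Lam^T *m eta) (e * y).
Proof.
move=> etaS; have L0 := lik_gt0 hv e (e * y) (stoch_simplex LS etaS).
apply/colP => i; rewrite /filter_step mxE filter_unnormE filter_unnorm_l1norm// [RHS]mxE.
have n0 := normal_pdf_gt0 (e * y).
by field; rewrite !gt_eqF.
Qed.

(** The substitution [u = e * y] brings a factor [sigma], which cancels the one in the density of
    the observation. *)
Lemma filter_kernelE eta A : simplex eta -> measurable (A : set (borel_cV R d)) ->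
  filter_kernel Lam hv sigma eta A =
  (\int[gam]_u (\1_A (bayes hv e (Lam^T *m eta) u) * lik hv e (Lam^T *m eta) u)%:E)%E.
Proof.
move=> etaS mA; set p := Lam^T *m eta.
have pS : simplex p by exact: stoch_simplex.
have mb : measurable_fun [set: R] (fun u => \1_A (bayes hv e p u) : R).
  exact: (measurableT_comp (measurable_indic mA) (measurable_bayes hv e p)).
have ml : measurable_fun [set: R] (lik hv e p) by exact: (subexp_lik hv e p).1.
have mn := measurable_normal_pdf (0 : R) 1.
have me : measurable_fun [set: R] (fun y : R => e * y) by exact: measurable_funM.
have L0 u : 0 <= lik hv e p u by rewrite ltW// lik_gt0.
rewrite ge0_integral_normal//; last 2 first.
- by apply/measurable_EFinP; exact: measurable_funM.
- by move=> u; rewrite lee_fin mulr_ge0.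
rewrite /filter_kernel integral_mkcond.
rewrite [LHS](@ge0_integral_affine _ 0 sigma)//.
- apply: eq_integral => u _; rewrite add0r patchE -EFinM.
  have eu : e * (sigma * u) = u by rewrite /e mulrA mulVf ?mul1r// gt_eqF.
  rewrite [X in if X then _ else _](_ : _ = (bayes hv e p u \in A)); last first.
    by apply/idP/idP => /set_mem/= h; apply/mem_set; move: h; rewrite /= filter_stepE//  eu.
  rewrite indicE; case: (_ \in A); last by rewrite !mul0r !mul0e.
  rewrite filter_unnorm_l1norm// eu mul1r -!EFinM -/p.
  by congr EFin; field; rewrite gt_eqF.
- have -> : ((fun y => (sigma^-1 * l1norm (filter_unnorm Lam hv sigma y eta))%:E) \_
     [set y | A (filter_step Lam hv sigma y eta)]) =
     (fun y => (\1_A (bayes hv e p (e * y)) *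
        (sigma^-1 * (normal_pdf 0 1 (e * y) * lik hv e p (e * y))))%:E).
    apply/funext => y; rewrite patchE indicE.
    rewrite [X in if X then _ else _](_ : _ = (bayes hv e p (e * y) \in A)); last first.
      by apply/idP/idP => /set_mem/= h; apply/mem_set; move: h; rewrite /= filter_stepE.
    case: (_ \in A); last by rewrite mul0r.
    by rewrite mul1r filter_unnorm_l1norm.
  apply/measurable_EFinP; apply: measurable_funM.
    exact: (measurableT_comp mb me).
  apply: measurable_funM => //; apply: measurable_funM.
    exact: (measurableT_comp mn me).
  exact: (measurableT_comp ml me).
- move=> y; rewrite patchE; case: ifP => // _.
  by rewrite lee_fin mulr_ge0 ?invr_ge0 ?(ltW sigma0)// l1norm_ge0.
Qed.

(** All laws are carried by the simplex and [bayes] is controlled only there, so both conditions are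
    restricted to it. *)
Definition simplex_bounded (f : 'cV[R]_d -> R) :=
  measurable_fun (@simplex R d : set (borel_cV R d)) f /\
  exists K, forall eta, simplex eta -> `|f eta| <= K.

(** The Markov operator of the filter, written with the rescaled observation. *)
Definition Kop (f : 'cV[R]_d -> R) eta : R :=
  gE (fun u => f (bayes hv e (Lam^T *m eta) u) * lik hv e (Lam^T *m eta) u).

Lemma subexp_bayes f eta : simplex_bounded f -> simplex eta ->
  subexp (fun u => f (bayes hv e (Lam^T *m eta) u)).
Proof.
move=> [mf [K fK]] etaS; have pS := stoch_simplex LS etaS.
apply: (@subexp_bounded _ _ K); last by move=> u; apply: fK; exact: bayes_simplex.
have mfS : measurable_fun [set: borel_cV R d] (f \_ (@simplex R d)).
  by apply/(measurable_restrictT _ measurable_simplex).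
have -> : (fun u => f (bayes hv e (Lam^T *m eta) u)) =
    (f \_ (@simplex R d)) \o (fun u => bayes hv e (Lam^T *m eta) u).
  apply/funext => u /=; rewrite patchE mem_set//; exact: bayes_simplex.
exact: (measurableT_comp mfS (measurable_bayes hv e (Lam^T *m eta))).
Qed.

Lemma subexp_bayes_lik f eta : simplex_bounded f -> simplex eta ->
  subexp (fun u => f (bayes hv e (Lam^T *m eta) u) * lik hv e (Lam^T *m eta) u).
Proof. by move=> bf etaS; apply: subexpM; [exact: subexp_bayes|exact: subexp_lik]. Qed.

Lemma KopDc f c eta : simplex_bounded f -> simplex eta ->
  Kop (fun x => f x + c) eta = Kop f eta + c.
Proof.
move=> bf etaS; rewrite /Kop.
under [X in gE X]eq_fun do rewrite mulrDl.
rewrite gED; [|exact: subexp_bayes_lik|by apply: subexpZ; exact: subexp_lik].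
by rewrite gEZ ?gE_lik ?mulr1//; [exact: stoch_simplex|exact: subexp_lik].
Qed.

Lemma simplex_boundedDc f c : simplex_bounded f -> simplex_bounded (fun x => f x + c).
Proof.
move=> [mf [K fK]]; split; first exact: measurable_funD.
exists (K + `|c|) => eta /fK h; by rewrite (le_trans (ler_normD _ _))// lerD2r.
Qed.

Lemma Kop_bound f K eta : simplex_bounded f -> (forall eta, simplex eta -> `|f eta| <= K) ->
  simplex eta -> `|Kop f eta| <= K.
Proof.
move=> bf fK etaS; have pS := stoch_simplex LS etaS.
have sL := subexp_lik hv e (Lam^T *m eta).
rewrite (le_trans (gE_norm _))//; first exact: subexp_bayes_lik.
rewrite -[leRHS]mulr1 -(gE_lik hv e pS) -gEZ//; apply: le_gE => [||u].
- by apply: subexp_norm; exact: subexp_bayes_lik.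
- exact: subexpZ.
- rewrite normrM (gtr0_norm (lik_gt0 _ _ _ pS)) ler_wpM2r ?(ltW (lik_gt0 _ _ _ pS))//.
  by apply: fK; exact: bayes_simplex.
Qed.

Section OneTransition.
Variables m m' : probability (borel_cV R d) R.
Hypothesis mm' : forall A : set (borel_cV R d), measurable A ->
  m' A = (\int[m]_(eta in @simplex R d) filter_kernel Lam hv sigma eta A)%E.

Let phi (z : borel_cV R d * R) : borel_cV R d := bayes hv e (Lam^T *m z.1) z.2.
(** Outside the simplex the likelihood may be negative; the indicator keeps the density nonnegative
    everywhere. *)
Let pd (z : borel_cV R d * R) : R :=
  \1_(@simplex R d) z.1 * lik hv e (Lam^T *m z.1) z.2.

Let mLam : measurable_fun [set: borel_cV R d * R]
  (fun z => (Lam^T *m (z.1 : 'cV[R]_d) : borel_cV R d)).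
Proof. exact: (measurableT_comp (measurable_mulmx_borel Lam^T) measurable_fst). Qed.

Let mphi : measurable_fun [set: borel_cV R d * R] phi.
Proof. by apply: measurable_bayes_comp => //; exact: measurable_snd. Qed.

Let mpd : measurable_fun [set: borel_cV R d * R] pd.
Proof.
apply: measurable_funM.
  apply: (measurableT_comp (measurable_indic _) measurable_fst).
  exact: measurable_simplex.
by apply: measurable_lik_comp => //; exact: measurable_snd.
Qed.

Let pd0 z : 0 <= pd z.
Proof.
rewrite /pd indicE; have [zS|zS] := pselect (simplex (z.1 : 'cV[R]_d)).
  by rewrite mem_set// mul1r ltW// lik_gt0//; exact: stoch_simplex.
by rewrite memNset// mul0r.
Qed.

(** The law [m'] is the image under [phi] of the measure with density [pd] relative to the product
    of [m] and the standard normal law; Tonelli's theorem does the rest. *)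
Lemma transition_integral (f : borel_cV R d -> \bar R) :
  measurable_fun [set: borel_cV R d] f -> (forall x, (0 <= f x)%E) ->
  (\int[m']_x f x = \int[m]_x \int[gam]_u (f (phi (x, u)) * (pd (x, u))%:E))%E.
Proof.
move=> mf f0.
have mfp : measurable_fun [set: borel_cV R d * R] (fun z => f (phi z) * (pd z)%:E)%E.
  by apply: emeasurable_funM; [exact: measurableT_comp|exact/measurable_EFinP].
rewrite (@ge0_integral_image_density _ _ _ _ _ (m \x gam)%E m' phi pd)//; last first.
  move=> A mA; apply: etrans (mm' mA) _; rewrite [LHS]integral_mkcond [RHS]integral_mkcond.
  have mAp : measurable (phi @^-1` A).
    by rewrite -[X in measurable X]setTI; exact: mphi.
  have E : ((fun z => (pd z)%:E) \_ (phi @^-1` A)) = (fun z => (\1_A (phi z) * pd z)%:E).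
    apply/funext => z; rewrite patchE indicE.
    case: ifPn => [/set_mem/= h|/negP h]; first by rewrite mem_set// mul1r.
    by rewrite memNset ?mul0r// => h'; apply: h; exact: mem_set.
  rewrite E fubini_tonelli1//=; last 2 first.
  - apply/measurable_EFinP; apply: measurable_funM => //.
    exact: (measurableT_comp (measurable_indic mA) mphi).
  - by move=> z; rewrite lee_fin mulr_ge0.
  apply: eq_integral => x _; rewrite patchE /fubini_F/=.
  case: ifPn => [/set_mem xS|/negP xS].
    rewrite filter_kernelE//; apply: eq_integral => u _.
    by rewrite /pd/= [\1_(@simplex R d) _]indicE (mem_set xS) mul1r.
  rewrite integral0_eq// => u _; rewrite /pd/= [\1_(@simplex R d) _]indicE memNset ?mul0r ?mulr0//.
  by move=> h; apply: xS; exact: mem_set.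
rewrite fubini_tonelli1// => z.
by rewrite mule_ge0// lee_fin.
Qed.

Lemma measurable_transition (f : borel_cV R d -> \bar R) :
  measurable_fun [set: borel_cV R d] f -> (forall x, (0 <= f x)%E) ->
  measurable_fun [set: borel_cV R d]
    (fun x => \int[gam]_u (f (phi (x, u)) * (pd (x, u))%:E))%E.
Proof.
move=> mf f0.
have mfp : measurable_fun [set: borel_cV R d * R] (fun z => f (phi z) * (pd z)%:E)%E.
  by apply: emeasurable_funM; [exact: measurableT_comp|exact/measurable_EFinP].
apply: (@measurable_fun_fubini_tonelli_F _ _ _ _ R gam _ mfp) => z.
by rewrite mule_ge0// lee_fin.
Qed.

End OneTransition.

End FilterKernel.

(** * Chains of filter laws *)

Section SimplexExpectation.
Context {R : realType} {d : nat}.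
Implicit Types (f g : 'cV[R]_d -> R) (m : probability (borel_cV R d) R).

Definition expS m f : R := \int[m]_(x in @simplex R d) f (x : 'cV[R]_d).

Lemma simplex_bounded_continuous f : continuous f ->
  (exists K, forall eta, simplex eta -> `|f eta| <= K) -> simplex_bounded f.
Proof.
move=> fc fK; split => //; apply: measurable_funTS; exact: continuous_borel_cV.
Qed.

Lemma simplex_bounded_cst (c : R) : simplex_bounded (fun _ : 'cV[R]_d => c).
Proof. by split => //; exists `|c|. Qed.

Lemma simplex_boundedD f g : simplex_bounded f -> simplex_bounded g ->
  simplex_bounded (fun x => f x + g x).
Proof.
move=> [mf [K fK]] [mg [L gL]]; split; first exact: measurable_funD.
exists (K + L) => eta etaS.
by rewrite (le_trans (ler_normD _ _))// lerD ?fK ?gL.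
Qed.

Lemma simplex_boundedZ c f : simplex_bounded f -> simplex_bounded (fun x => c * f x).
Proof.
move=> [mf [K fK]]; split; first exact: measurable_funM.
exists (`|c| * K) => eta etaS.
by rewrite normrM ler_wpM2l ?fK.
Qed.

Lemma simplex_boundedB f g : simplex_bounded f -> simplex_bounded g ->
  simplex_bounded (fun x => f x - g x).
Proof.
move=> bf /(simplex_boundedZ (-1)) bg; have := simplex_boundedD bf bg.
by under eq_fun do rewrite mulN1r.
Qed.

Lemma simplex_bounded_norm f : simplex_bounded f -> simplex_bounded (fun x => `|f x|).
Proof.
move=> [mf [K fK]]; split; first exact: measurableT_comp.
by exists K => eta etaS; rewrite normr_id fK.
Qed.

Lemma simplex_boundedX n f : simplex_bounded f -> simplex_bounded (fun x => f x ^+ n).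
Proof.
move=> [mf [K fK]]; split; first exact: measurable_funX.
exists (K ^+ n) => eta etaS.
have h := fK _ etaS; rewrite normrX lerXn2r ?nnegrE//.
exact: le_trans (normr_ge0 _) h.
Qed.

Section Mass1.
Variable m : probability (borel_cV R d) R.
Hypothesis mS : m (@simplex R d) = 1%E.

Let mmS : measurable (@simplex R d : set (borel_cV R d)) := measurable_simplex.

Lemma simplex_bounded_integrable f : simplex_bounded f ->
  m.-integrable (@simplex R d) (EFin \o f).
Proof.
move=> [mf [K fK]]; apply: measurable_bounded_integrable => //.
  exact: (le_lt_trans (probability_le1 m mmS) (ltry _)).
exists K; split; first exact: num_real.
by move=> L KL x /fK h; exact: le_trans h (ltW KL).
Qed.

Lemma expS_fin f : simplex_bounded f ->
  ((expS m f)%:E = \int[m]_(x in @simplex R d) (f x)%:E)%E.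
Proof.
move=> bf; rewrite /expS /Rintegral fineK//.
by apply: integrable_fin_num => //; exact: simplex_bounded_integrable.
Qed.

Lemma expSD f g : simplex_bounded f -> simplex_bounded g ->
  expS m (fun x => f x + g x) = expS m f + expS m g.
Proof. by move=> bf bg; apply: RintegralD => //; exact: simplex_bounded_integrable. Qed.

Lemma expSB f g : simplex_bounded f -> simplex_bounded g ->
  expS m (fun x => f x - g x) = expS m f - expS m g.
Proof. by move=> bf bg; apply: RintegralB => //; exact: simplex_bounded_integrable. Qed.

Lemma expSZ c f : simplex_bounded f -> expS m (fun x => c * f x) = c * expS m f.
Proof. by move=> bf; apply: RintegralZl => //; exact: simplex_bounded_integrable. Qed.

Lemma expS_cst c : expS m (fun=> c) = c.
Proof.
rewrite /expS Rintegral_cst//.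
exact: etrans (congr1 (fun t => c * fine t) mS) (mulr1 _).
Qed.

Lemma eq_expS f g : (forall x, simplex x -> f x = g x) -> expS m f = expS m g.
Proof. by move=> fg; apply: eq_Rintegral => x /set_mem; exact: fg. Qed.

Lemma le_expS f g : simplex_bounded f -> simplex_bounded g ->
  (forall x, simplex x -> f x <= g x) -> expS m f <= expS m g.
Proof. by move=> bf bg fg; apply: le_Rintegral => //; exact: simplex_bounded_integrable. Qed.

Lemma expS_norm f : simplex_bounded f -> `|expS m f| <= expS m (fun x => `|f x|).
Proof. by move=> bf; apply: le_normr_Rintegral => //; exact: simplex_bounded_integrable. Qed.

Lemma expS_ge0 f : (forall x, simplex x -> 0 <= f x) -> 0 <= expS m f.
Proof. by move=> f0; apply: Rintegral_ge0. Qed.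

Lemma expS_dist f g h : simplex_bounded f -> simplex_bounded g -> simplex_bounded h ->
  (forall x, simplex x -> `|f x - g x| <= h x) -> `|expS m f - expS m g| <= expS m h.
Proof.
move=> bf bg bh fgh; rewrite -expSB// (le_trans (expS_norm _))//.
  exact: simplex_boundedB.
by apply: le_expS => //; apply: simplex_bounded_norm; exact: simplex_boundedB.
Qed.

End Mass1.

Section Transition.
Variables (Lam : 'M[R]_d) (hv : 'cV[R]_d) (sigma : R).
Hypotheses (LS : stochastic_mx Lam) (sigma0 : 0 < sigma).
Variables m m' : probability (borel_cV R d) R.
Hypotheses (mS : m (@simplex R d) = 1%E) (mS' : m' (@simplex R d) = 1%E).
Hypothesis mm' : forall A : set (borel_cV R d), measurable A ->
  m' A = (\int[m]_(eta in @simplex R d) filter_kernel Lam hv sigma eta A)%E.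

Let mmS : measurable (@simplex R d : set (borel_cV R d)) := measurable_simplex.

Let Kop_ge0E f : simplex_bounded f -> (forall eta, simplex eta -> 0 <= f eta) ->
  forall eta, simplex eta ->
  (\int[normal_prob 0 1]_u (((EFin \o f) \_ (@simplex R d))
      (bayes hv sigma^-1 (Lam^T *m eta) u) *
    (\1_(@simplex R d) eta * lik hv sigma^-1 (Lam^T *m eta) u)%:E) =
  (Kop Lam hv sigma f eta)%:E)%E.
Proof.
move=> bf f0 eta etaS; have pS := stoch_simplex LS etaS.
rewrite /Kop gE_fin; last exact: subexp_bayes_lik.
apply: eq_integral => u _; rewrite patchE mem_set ?indicE ?mem_set//.
  by rewrite mul1r.
exact: bayes_simplex.
Qed.

Let mfS f : simplex_bounded f ->
  measurable_fun [set: borel_cV R d] ((EFin \o f) \_ (@simplex R d)).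
Proof.
move=> [mf _]; apply/(measurable_restrictT _ mmS).
exact/measurable_EFinP.
Qed.

Let fS0 f : (forall eta, simplex eta -> 0 <= f eta) ->
  forall eta : 'cV[R]_d, (0 <= ((EFin \o f) \_ (@simplex R d)) eta)%E.
Proof.
move=> f0 eta; rewrite patchE; case: ifPn => // /set_mem/f0.
by rewrite lee_fin.
Qed.

Let mKop_ge0 f : simplex_bounded f -> (forall eta, simplex eta -> 0 <= f eta) ->
  measurable_fun (@simplex R d : set (borel_cV R d)) (Kop Lam hv sigma f).
Proof.
move=> bf f0; apply/measurable_EFinP.
have := measurable_transition hv sigma LS (mfS bf) (fS0 f0).
move=> /(@measurable_funTS _ _ (borel_cV R d) _ (@simplex R d)); apply: eq_measurable_fun => eta /set_mem etaS.
exact: Kop_ge0E.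
Qed.

Lemma simplex_bounded_Kop f : simplex_bounded f -> simplex_bounded (Kop Lam hv sigma f).
Proof.
move=> bf; have [mf [K fK]] := bf; split; last first.
  by exists K => eta; exact: Kop_bound.
have bg : simplex_bounded (fun x => f x + K) by exact: simplex_boundedDc.
have g0 eta : simplex eta -> 0 <= f eta + K.
  by move=> /fK; rewrite ler_norml => /andP[h _]; rewrite -lerBlDr sub0r.
have := mKop_ge0 bg g0 => mg.
have mg' : measurable_fun (@simplex R d : set (borel_cV R d))
    (fun x => Kop Lam hv sigma (fun x => f x + K) x - K) by exact: measurable_funB.
apply: eq_measurable_fun mg' => eta /set_mem etaS.
by rewrite KopDc// addrK.
Qed.

(** [transition_integral] covers nonnegative functions. Adding the bound [K] reduces the general
    case to it, because both sides shift by the same constant. *)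
Lemma expS_transition f : simplex_bounded f -> expS m' f = expS m (Kop Lam hv sigma f).
Proof.
move=> bf; have [mf [K fK]] := bf.
have bg : simplex_bounded (fun x => f x + K) by exact: simplex_boundedDc.
have g0 eta : simplex eta -> 0 <= f eta + K.
  by move=> /fK; rewrite ler_norml => /andP[h _]; rewrite -lerBlDr sub0r.
have E : expS m' (fun x => f x + K) = expS m (Kop Lam hv sigma (fun x => f x + K)).
  apply: EFin_inj; rewrite !expS_fin//; last exact: simplex_bounded_Kop.
  rewrite integral_mkcond.
  rewrite (transition_integral LS sigma0 mm' (mfS bg) (fS0 g0)).
  rewrite [RHS]integral_mkcond; apply: eq_integral => eta _ /=.
  rewrite [RHS]patchE; case: ifPn => [/set_mem etaS|etaS]; first exact: Kop_ge0E.
  rewrite integral0_eq// => u _.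
  by rewrite indicE (negbTE etaS) mul0r mule0.
have bK := @simplex_bounded_cst K; have bKf := simplex_bounded_Kop bf.
have KK : expS m (Kop Lam hv sigma (fun x => f x + K)) = expS m (fun x => Kop Lam hv sigma f x + K).
  by apply: eq_expS => x xS; rewrite KopDc.
move: E; rewrite KK (expSD m' bf bK) (expSD m bKf bK) (expS_cst mS') (expS_cst mS).
exact: addIr.
Qed.

End Transition.

End SimplexExpectation.

(** * Uniform moments and limits of cosines along filter chains *)

Section FilterChain.
Context {R : realType} {d : nat}.

(* Applied both to the laws of the filter started from [nu] and to the constant sequence
   of an invariant law. *)
Definition filter_chain (Lam : 'M[R]_d) (hv : 'cV[R]_d) (sigma : R)
    (m : nat -> probability (borel_cV R d) R) : Prop :=
  forall n, m n (@simplex R d) = 1%E /\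
    forall A : set (borel_cV R d), measurable A ->
      m n.+1 A = (\int[m n]_(eta in @simplex R d) filter_kernel Lam hv sigma eta A)%E.

Lemma le_l1norm_centered (sigma : R) (mu eta : 'cV[R]_d) : 0 <= sigma ->
  simplex mu -> simplex eta -> l1norm (sigma *: (eta - mu)) <= 2 * sigma.
Proof.
move=> s0 muS etaS; rewrite l1normZ ger0_norm// mulrC ler_wpM2r//.
by rewrite (le_trans (l1normB _ _))// !simplex_l1norm.
Qed.

Lemma poly_growth_ge0 (F : 'cV[R]_d -> R) : poly_growth F ->
  exists (C : R) (k : nat), 0 <= C /\ forall x, `|F x| <= C * (1 + l1norm x) ^+ k.
Proof.
move=> [C [k FC]]; exists C, k; split => //.
have := FC 0; rewrite l1norm0 addr0 expr1n mulr1; exact/le_trans/normr_ge0.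
Qed.

Lemma simplex_bounded_centered (sigma : R) (mu : 'cV[R]_d) (F : 'cV[R]_d -> R) :
  0 <= sigma -> simplex mu -> continuous F -> poly_growth F ->
  simplex_bounded (fun eta => F (sigma *: (eta - mu))).
Proof.
move=> s0 muS Fc /poly_growth_ge0[C [k [C0 FC]]]; split.
  apply: measurable_funTS.
  exact: (measurableT_comp (continuous_borel_cV Fc) (measurable_centered_borel sigma mu)).
exists (C * (1 + 2 * sigma) ^+ k) => eta etaS.
rewrite (le_trans (FC _))// ler_wpM2l// lerXn2r ?nnegrE ?addr_ge0 ?l1norm_ge0 ?mulr_ge0//.
by rewrite lerD2l le_l1norm_centered.
Qed.

Lemma poly_growth_pow k : poly_growth (fun x : 'cV[R]_d => (1 + l1norm x) ^+ k).
Proof.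
by exists 1, k => x; rewrite mul1r ger0_norm// exprn_ge0// addr_ge0// l1norm_ge0.
Qed.

Lemma continuous_pow (f : 'cV[R]_d -> R) k : continuous f -> continuous (fun x => f x ^+ k).
Proof.
move=> fc; elim: k => [|k IH] x.
  by rewrite (_ : (fun x => _) = fun=> 1)//; exact: cst_continuous.
rewrite (_ : (fun x => _) = fun x => f x * f x ^+ k); last first.
  by apply/funext => y; rewrite exprS.
exact: (@continuousM R _ f (fun y => f y ^+ k) x (fc x) (IH x)).
Qed.

Lemma continuous_one_plus_l1norm : continuous (fun x : 'cV[R]_d => 1 + l1norm x).
Proof.
move=> x; apply: (@cvgD _ R^o _ (nbhs x) _ (fun=> 1) (@l1norm R d) 1 (l1norm x)).
  exact: cvg_cst.
exact: continuous_l1norm.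
Qed.

Lemma continuous_cos_dotp v (th : R) : continuous (fun x : 'cV[R]_d => cos (dotp v x + th)).
Proof.
move=> x; apply: (@continuous_comp _ _ _ (fun x => dotp v x + th) (@cos R)); last exact: continuous_cos.
apply: (@cvgD _ R^o _ (nbhs x) _ (dotp v) (fun=> th) (dotp v x) th).
  exact: continuous_dotp.
exact: cvg_cst.
Qed.

Lemma poly_growth_cos v (th : R) : poly_growth (fun x : 'cV[R]_d => cos (dotp v x + th)).
Proof.
exists 1, 0%N => x; rewrite expr0 mulr1.
by rewrite ler_norml cos_geN1 cos_le1.
Qed.

Variables (Lam : 'M[R]_d) (hv mu : 'cV[R]_d).
Hypotheses (LS : stochastic_mx Lam) (LE : ergodic Lam) (muI : invariant_distr Lam mu).

Let muS : simplex mu. Proof. by case: muI. Qed.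

Let chain_step sigma m n f : 0 < sigma -> filter_chain Lam hv sigma m -> simplex_bounded f ->
  expS (m n.+1) f = expS (m n) (Kop Lam hv sigma f).
Proof.
move=> s0 mc bf; have [mS mK] := mc n; have [mS' _] := mc n.+1.
exact: expS_transition.
Qed.

(** The drift condition iterates to a bound free of [sigma]. Only the burn-in time depends on
    [sigma], since the deviation at time 0 may be of order [sigma]. The drift condition needs a
    positive exponent, hence [k.+1]. *)
Lemma chain_moments k : exists C : R, forall sigma, 1 <= sigma -> exists N : nat,
  forall m, filter_chain Lam hv sigma m -> forall n, (N <= n)%N ->
  expS (m n) (fun eta => (1 + l1norm (sigma *: (eta - mu))) ^+ k) <= C.
Proof.
have [q q0 Lq] := ergodic_contraction LS LE muI.
have [C C0 HC] := moment_one_step hv LS q0 (ltn0Sn k) Lq.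
set N := adapted_norm Lam q in HC.
have q1 : 1 <= q%:R :> R by rewrite ler1n.
pose rho : R := 1 - (4 * q%:R)^-1.
have qi : 0 < (4 * q%:R)^-1 :> R by rewrite invr_gt0; lra.
have qi1 : (4 * q%:R)^-1 <= 1 :> R by rewrite invf_le1; lra.
have rho0 : 0 <= rho by rewrite /rho; lra.
have rho1 : rho < 1 by rewrite /rho; lra.
(* The fixed point of [t = rho * t + C]. *)
pose D := C / (1 - rho).
exists (2 ^+ k.+1 * (1 + (1 + D))) => sigma s1.
have s0 : 0 < sigma by lra.
have e0 : 0 < sigma^-1 by rewrite invr_gt0.
have e1 : sigma^-1 <= 1 by rewrite invf_le1.
pose f (eta : 'cV[R]_d) := N (sigma *: (eta - mu)) ^+ k.+1.
have N0 x : 0 <= N x by exact: adapted_norm_ge0.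
have bN : simplex_bounded (fun eta => N (sigma *: (eta - mu))).
  apply: simplex_bounded_centered => //; first exact: ltW.
    exact: continuous_adapted_norm.
  exists q%:R, 1%N => x; rewrite ger0_norm// expr1 (le_trans (adapted_norm_le _ LS _))//.
  by rewrite ler_wpM2l// lerDr.
have bf : simplex_bounded f by exact: simplex_boundedX.
pose B := (q%:R * (2 * sigma)) ^+ k.+1.
have fB eta : simplex eta -> f eta <= B.
  move=> etaS; rewrite lerXn2r ?nnegrE ?mulr_ge0 ?(ltW s0)//.
  rewrite (le_trans (adapted_norm_le _ LS _))// ler_wpM2l//.
  by rewrite le_l1norm_centered// ltW.
have B0 : 0 <= B by rewrite exprn_ge0// !mulr_ge0// ltW.
have [n0 Hn0] : exists n0, forall n, (n0 <= n)%N -> rho ^+ n * B <= 1.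
  have : B * rho ^+ n @[n --> \oo] --> (0 : R) by exact: cvg_geometric0.
  move=> /cvgr_le/(_ 1 ltr01)[n0 _ Hn0]; exists n0 => n n0n.
  by rewrite mulrC; exact: Hn0.
exists n0 => m mc n n0n.
have stepK eta : simplex eta -> Kop Lam hv sigma f eta <= rho * f eta + C.
  move=> etaS; have := HC sigma^-1 mu eta e0 e1 muI etaS.
  by rewrite invrK.
have mS j : m j (@simplex R d) = 1%E by case: (mc j).
have bKf : simplex_bounded (Kop Lam hv sigma f) by exact: simplex_bounded_Kop.
have rec j : expS (m j.+1) f <= rho * expS (m j) f + C.
  rewrite (chain_step j s0 mc bf) -[C in leRHS](expS_cst (mS j)).
  have bc := @simplex_bounded_cst R d C.
  have brf := simplex_boundedZ rho bf.
  rewrite -expSZ// -expSD//; apply: le_expS => //.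
  exact: simplex_boundedD.
have bound j : expS (m j) f <= rho ^+ j * B + D.
  elim: j => [|j IH].
    rewrite expr0 mul1r (@le_trans _ _ B)//.
      rewrite -[leRHS](expS_cst (mS 0%N)); apply: le_expS => //.
      exact: simplex_bounded_cst.
    by rewrite lerDl divr_ge0//; lra.
  rewrite (le_trans (rec j))//.
  apply: (@le_trans _ _ (rho * (rho ^+ j * B + D) + C)).
    by rewrite lerD2r ler_wpM2l.
  have -> : C = (1 - rho) * D by rewrite /D mulrCA divff ?mulr1// gt_eqF//; lra.
  by rewrite exprS le_eqVlt; apply/orP; left; apply/eqP; ring.
have bg : simplex_bounded (fun eta => (1 + l1norm (sigma *: (eta - mu))) ^+ k).
  apply: (@simplex_bounded_centered sigma mu (fun x => (1 + l1norm x) ^+ k)) => //.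
  - exact: ltW.
  - by apply: continuous_pow; exact: continuous_one_plus_l1norm.
  - exact: poly_growth_pow.
have bf1 : simplex_bounded (fun eta => f eta + 1) by exact: simplex_boundedDc.
have bh := simplex_boundedZ (2 ^+ k.+1) bf1.
(* Uses [(1 + t) ^+ k.+1 <= 2 ^+ k.+1 * (t ^+ k.+1 + 1)] for [t >= 0], separately for [t <= 1] and
   [t > 1]. *)
apply: (@le_trans _ _ (expS (m n) (fun eta => 2 ^+ k.+1 * (f eta + 1)))).
  apply: le_expS => // eta etaS; rewrite /f.
  set z := sigma *: _; have lN : l1norm z <= N z by exact: le_adapted_norm.
  have l0 := l1norm_ge0 z.
  apply: (@le_trans _ _ ((1 + N z) ^+ k.+1)).
    apply: (@le_trans _ _ ((1 + l1norm z) ^+ k.+1)).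
      by apply: ler_weXn2l => //; rewrite lerDl.
    by rewrite lerXn2r ?nnegrE ?addr_ge0// lerD2l.
  have [Nz1|Nz1] := leP (N z) 1.
    apply: (@le_trans _ _ (2 ^+ k.+1)); last by rewrite ler_peMr ?exprn_ge0// lerDr exprn_ge0.
    by rewrite lerXn2r ?nnegrE ?addr_ge0//; lra.
  apply: (@le_trans _ _ ((2 * N z) ^+ k.+1)).
    by rewrite lerXn2r ?nnegrE ?addr_ge0 ?mulr_ge0//; lra.
  by rewrite exprMn ler_wpM2l ?exprn_ge0// lerDl.
rewrite expSZ// ler_wpM2l ?exprn_ge0//.
rewrite expSD//; last exact: simplex_bounded_cst.
rewrite (expS_cst (mS n)) addrC lerD2l.
by rewrite (le_trans (bound n))// lerD2r Hn0.
Qed.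

Let b := drift mu hv.
Let phi (v : 'cV[R]_d) : R := expR (- (dotp v b ^+ 2 / 2)).

Let trigS sigma v th (eta : 'cV[R]_d) : R := cos (dotp v (sigma *: (eta - mu)) + th).

Let trigS_bounded sigma v th : 0 < sigma -> simplex_bounded (trigS sigma v th).
Proof.
move=> s0; apply: (@simplex_bounded_centered sigma mu (fun x => cos (dotp v x + th))) => //.
- exact: ltW.
- exact: continuous_cos_dotp.
- exact: poly_growth_cos.
Qed.

(** The exponent 1 is kept in order to match [chain_moments 1]. *)
Let oneS sigma (eta : 'cV[R]_d) : R := (1 + l1norm (sigma *: (eta - mu))) ^+ 1.

Let oneS_bounded sigma : 0 < sigma -> simplex_bounded (oneS sigma).
Proof.
move=> s0; apply: (@simplex_bounded_centered sigma mu (fun x => (1 + l1norm x) ^+ 1)) => //.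
- exact: ltW.
- by apply: continuous_pow; exact: continuous_one_plus_l1norm.
- exact: poly_growth_pow.
Qed.

Let dotp_Lam v x : dotp v (Lam^T *m x) = dotp (Lam *m v) x.
Proof. by rewrite dotp_mul trmxK. Qed.

Let trig_step v : exists2 C, 0 <= C & forall sigma m n th, 1 <= sigma ->
  filter_chain Lam hv sigma m ->
  `|expS (m n.+1) (trigS sigma v th) - phi v * expS (m n) (trigS sigma (Lam *m v) th)| <=
  sigma^-1 * (C * expS (m n) (oneS sigma)).
Proof.
have [C C0 HC] := trig_one_step hv v; exists C => // sigma m n th s1 mc.
have s0 : 0 < sigma by lra.
have e0 : 0 < sigma^-1 by rewrite invr_gt0.
have e1 : sigma^-1 <= 1 by rewrite invf_le1.
have mS : m n (@simplex R d) = 1%E by case: (mc n).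
have bt := trigS_bounded v th s0; have bt' := trigS_bounded (Lam *m v) th s0.
have bo := oneS_bounded s0.
rewrite (chain_step n s0 mc bt) -expSZ// -expSZ// -expSZ//; last exact: simplex_boundedZ.
apply: expS_dist => //.
- exact: simplex_bounded_Kop.
- exact: simplex_boundedZ.
- by apply: simplex_boundedZ; exact: simplex_boundedZ.
move=> eta etaS.
have := HC sigma^-1 mu (Lam^T *m eta) th e0 e1 (stoch_simplex LS etaS) muS.
rewrite invrK => H; have zE : sigma *: (Lam^T *m eta - mu) = Lam^T *m (sigma *: (eta - mu)).
  by case: muI => _ muE; rewrite -scalemxAr mulmxBr muE.
move: H; rewrite zE dotp_Lam => H; apply: le_trans H _.
rewrite ler_wpM2l ?(ltW e0)// ler_wpM2l// /oneS expr1 lerD2l.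
exact: stoch_l1norm.
Qed.

(** Each step multiplies by [phi v], replaces [v] by [Lam *m v] and costs [O(sigma^-1)]. As [phi] is
    at most 1, the errors of the other steps are not amplified. *)
Let trig_steps k v : exists2 C, 0 <= C & forall sigma m n th M1, 1 <= sigma ->
  filter_chain Lam hv sigma m ->
  (forall j, (n <= j)%N -> expS (m j) (oneS sigma) <= M1) ->
  `|expS (m (n + k)%N) (trigS sigma v th) -
    expR (- ((\sum_(j < k) dotp v (Lam^T ^+ j *m b) ^+ 2) / 2)) *
      expS (m n) (trigS sigma (Lam ^+ k *m v) th)| <=
  sigma^-1 * (C * M1).
Proof.
elim: k v => [|k IH] v.
  exists 0 => // sigma m n th M1 s1 mc HM.
  by rewrite addn0 big_ord0 mul0r oppr0 expR0 mul1r expr0 mul1mx subrr normr0 mul0r mulr0.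
have [C C0 HC] := trig_step v; have [C' C'0 HC'] := IH (Lam *m v).
exists (C + C'); first exact: addr_ge0.
move=> sigma m n th M1 s1 mc HM.
have h1 := HC sigma m (n + k)%N th s1 mc; have h2 := HC' sigma m n th M1 s1 mc HM.
rewrite addnS exprSr_mulmx.
set P := expR _ in h2; set a := expS (m n) _ in h2 *.
have -> : expR (- ((\sum_(j < k.+1) dotp v (Lam^T ^+ j *m b) ^+ 2) / 2)) = phi v * P.
  rewrite /phi /P -expRD; congr expR.
  rewrite big_ord_recl/= expr0 mul1mx mulrDl opprD; congr (_ - _ / _).
  apply: eq_bigr => j _; rewrite /bump/= add1n exprS_mulmx.
  by rewrite dotp_Lam.
set a1 := expS (m (n + k).+1) _ in h1 *; set a2 := expS (m (n + k)%N) _ in h1 h2.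
have -> : a1 - phi v * P * a = (a1 - phi v * a2) + phi v * (a2 - P * a) by ring.
have e0 : 0 <= sigma^-1 by rewrite invr_ge0; lra.
rewrite (le_trans (ler_normD _ _))// (mulrDl C) [leRHS]mulrDr lerD//.
  by rewrite (le_trans h1)// ler_wpM2l// ler_wpM2l// HM// leq_addr.
rewrite normrM -[leRHS]mul1r ler_pM//.
rewrite ger0_norm ?expR_ge0// -expR0 ler_expR oppr_le0.
by rewrite divr_ge0// sqr_ge0.
Qed.

(** The order of quantifiers serves both applications: [sigma0] depends on [delta] alone, while the
    burn-in [N] may depend on [sigma] but not on the chain. For the filter, [n] goes to infinity
    before [sigma]; for an invariant law the chain is constant and every [n] gives the same
    value. *)
Definition chain_limit (F : 'cV[R]_d -> R) (L : R) : Prop :=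
  forall delta, 0 < delta -> exists2 sigma0, 1 <= sigma0 & forall sigma, sigma0 <= sigma ->
    exists N : nat, forall m, filter_chain Lam hv sigma m -> forall n, (N <= n)%N ->
      `|expS (m n) (fun eta => F (sigma *: (eta - mu))) - L| <= delta.

(** Three errors of size [delta / 3]: the [k] approximate steps, the memory of the law at time
    [n - k], and the truncation of the covariance series after [k] terms. *)
Lemma chain_limit_cos C v th : limit_covariance Lam mu hv C ->
  chain_limit (fun x => cos (dotp v x + th)) (cos th * expR (- (dotp v (C *m v) / 2))).
Proof.
move=> HC delta delta0.
have [M1' HM] := chain_moments 1.
pose M1 : R := Num.max M1' 1.
have M10 : 0 < M1 by rewrite lt_max ltr01 orbT.
have [c [r [c0 r0 r1 Hr]]] := geometric_decay LS LE muI.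
have d30 : 0 < delta / 3 by rewrite divr_gt0.
have [k [k1 k2]] : exists k : nat, l1norm v * c * M1 * r ^+ k <= delta / 3 /\
    `|expR (- ((\sum_(j < k) dotp v (Lam^T ^+ j *m b) ^+ 2) / 2)) -
      expR (- (dotp v (C *m v) / 2))| <= delta / 3.
  have h1 : l1norm v * c * M1 * r ^+ n @[n --> \oo] --> (0 : R) by exact: cvg_geometric0.
  have h2 : expR (- ((\sum_(j < n) dotp v (Lam^T ^+ j *m b) ^+ 2) / 2)) @[n --> \oo] -->
      expR (- (dotp v (C *m v) / 2)).
    apply: continuous_cvg; first exact: continuous_expR.
    apply: (@cvgN _ R^o); apply: cvgM; last exact: cvg_cst.
    exact: limit_covariance_cvg.
  have /cvgr_le/(_ _ d30) n1 := h1; have /cvgr_dist_le/(_ _ d30) n2 := h2.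
  near \oo => k; exists k; split; first by near: k; exact: n1.
  by rewrite distrC; near: k; exact: n2.
have [Ck Ck0 Hk] := trig_steps k v.
pose sigma0 := Num.max 1 (Ck * M1 / (delta / 3)).
exists sigma0; first by rewrite le_max lexx.
move=> sigma; rewrite /sigma0 ge_max => /andP[s1 s2].
have s0 : 0 < sigma by lra.
have [N0 HN] := HM _ s1; exists (N0 + k)%N => m mc n Nn.
have mS j : m j (@simplex R d) = 1%E by case: (mc j).
pose n' := (n - k)%N.
have n'N : (N0 <= n')%N by rewrite /n' leq_subRL ?(leq_trans (leq_addl _ _) Nn)// addnC.
have nE : n = (n' + k)%N by rewrite /n' subnK// (leq_trans (leq_addl _ _) Nn).
have Hj j : (n' <= j)%N -> expS (m j) (oneS sigma) <= M1.
  by move=> nj; rewrite le_max (HN _ mc) // (leq_trans n'N).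
have h := Hk sigma m n' th M1 s1 mc Hj.
set P := expR (- ((\sum_(j < k) _) / 2)) in k2 h; set P' := expR _ in k2 *.
set a' := expS (m n') _ in h.
(* The deviation has zero sum, so moving [Lam ^+ k] onto it shrinks the argument of the cosine to a
   small multiple of the first moment. *)
have h3 : `|a' - cos th| <= delta / 3.
  rewrite -[X in _ - X](expS_cst (mS n')).
  have bt := trigS_bounded (Lam ^+ k *m v) th s0.
  have bo := oneS_bounded s0.
  pose K := l1norm v * c * r ^+ k.
  have K0 : 0 <= K by rewrite !mulr_ge0 ?l1norm_ge0 ?exprn_ge0.
  apply: (@le_trans _ _ (expS (m n') (fun eta => K * oneS sigma eta))).
    apply: expS_dist => //; first exact: simplex_bounded_cst.
      exact: simplex_boundedZ.
    move=> eta etaS; rewrite /trigS (le_trans (cos_lipschitz _ _))// addrK.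
    have -> : dotp (Lam ^+ k *m v) (sigma *: (eta - mu)) =
       dotp v (Lam^T ^+ k *m (sigma *: (eta - mu))).
      by rewrite dotp_mul -trmx_exp trmxK.
    rewrite (le_trans (dotp_bound _ _))// /K -!mulrA ler_wpM2l ?l1norm_ge0//.
    have z0 : total (sigma *: (eta - mu)) = 0.
      by rewrite totalZ simplex_sub_total// mulr0.
    rewrite (le_trans (Hr k _ z0))// -mulrA ler_wpM2l// ler_wpM2l ?exprn_ge0//.
    by rewrite /oneS expr1 lerDr.
  rewrite expSZ// (le_trans _ k1)// /K mulrAC ler_wpM2r ?exprn_ge0//.
  by rewrite ler_wpM2l ?mulr_ge0 ?l1norm_ge0// Hj.
have -> : (fun eta : 'cV[R]_d => cos (dotp v (sigma *: (eta - mu)) + th)) = trigS sigma v th by [].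
rewrite nE; set a := expS (m (n' + k)%N) _ in h *.
have -> : a - cos th * P' = (a - P * a') + P * (a' - cos th) + cos th * (P - P') by ring.
have P1 : `|P| <= 1.
  rewrite ger0_norm ?expR_ge0// -expR0 ler_expR oppr_le0 divr_ge0//.
  by apply: sumr_ge0 => j _; rewrite sqr_ge0.
have ct1 : `|cos th| <= 1 by rewrite ler_norml cos_geN1 cos_le1.
have t1 : `|a - P * a'| <= delta / 3.
  rewrite (le_trans h)// ler_pdivrMl//.
  by move: s2; rewrite ler_pdivrMr// mulrC.
have t2 : `|P * (a' - cos th)| <= delta / 3.
  by rewrite normrM (le_trans _ h3)// ler_piMl.
have t3 : `|cos th * (P - P')| <= delta / 3.
  by rewrite normrM (le_trans _ k2)// ler_piMl.
rewrite (le_trans (ler_normD _ _))//.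
have := ler_normD (a - P * a') (P * (a' - cos th)); lra.
Unshelve. all: by end_near. Qed.

Lemma chain_limitD F G a c : continuous F -> poly_growth F -> continuous G -> poly_growth G ->
  chain_limit F a -> chain_limit G c -> chain_limit (fun x => F x + G x) (a + c).
Proof.
move=> Fc Fp Gc Gp Fa Gc' delta delta0.
have d20 : 0 < delta / 2 by rewrite divr_gt0.
have [s1 s11 H1] := Fa _ d20; have [s2 s21 H2] := Gc' _ d20.
exists (Num.max s1 s2); first by rewrite le_max s11.
move=> sigma; rewrite ge_max => /andP[ss1 ss2].
have [N1 HN1] := H1 _ ss1; have [N2 HN2] := H2 _ ss2.
have s0 : 0 <= sigma by lra.
exists (maxn N1 N2) => m mc n; rewrite geq_max => /andP[n1 n2].
rewrite expSD; [|exact: simplex_bounded_centered..].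
have := HN1 _ mc _ n1; have := HN2 _ mc _ n2.
set x := expS _ _; set y := expS _ _ => hy hx.
have -> : y + x - (a + c) = (y - a) + (x - c) by ring.
by rewrite (le_trans (ler_normD _ _))//; lra.
Qed.

Lemma chain_limitZ F a k : continuous F -> poly_growth F ->
  chain_limit F a -> chain_limit (fun x => k * F x) (k * a).
Proof.
move=> Fc Fp Fa delta delta0.
have k0 : 0 < `|k| + 1 by rewrite ltr_wpDl.
have [s1 s11 H1] := Fa _ (divr_gt0 delta0 k0).
exists s1 => // sigma ss1; have [N1 HN1] := H1 _ ss1.
have s0 : 0 <= sigma by lra.
exists N1 => m mc n n1.
rewrite expSZ; last exact: simplex_bounded_centered.
rewrite -mulrBr normrM (le_trans (ler_wpM2l _ (HN1 _ mc _ n1)))//.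
by rewrite mulrCA ler_piMr ?(ltW delta0)// ler_pdivrMr// mul1r lerDl.
Qed.

End FilterChain.

(** * Gaussian vectors *)

Section GaussianMoments.
Context {R : realType}.

(** Stein's identity with [c = 0] and phase [pi / 2], where the sine is the constant 1. *)
Lemma gE_id : gE (fun x : R => x) = 0.
Proof.
have := gE_sin_stein (0 : R) (pi / 2); rewrite mul0r => <-.
by congr gE; apply/funext => x; rewrite mul0r add0r sin_pihalf mulr1.
Qed.

Lemma sin_taylor (x : R) : `|sin x - x| <= x ^+ 2.
Proof.
have := @mean_value_quadratic R sin cos 1 0 x ler01 (fun x => is_derive_sin x).
rewrite sin0 cos0 !subr0 !mul1r real_normK ?num_real//; apply => c.
by have := cos_lipschitz c 0; rewrite cos0 !subr0 mul1r.
Qed.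

(** Stein's identity for [sin (c * u)], divided by [c], in the limit of small [c]. *)
Lemma gE_sqr : gE (fun x : R => x ^+ 2) = 1.
Proof.
have s1 : subexp (fun x : R => x) by exact: subexp_id.
have s2 : subexp (fun x : R => x ^+ 2) by exact: subexpX.
have s3 : subexp (fun x : R => `|x| ^+ 3) by apply: subexpX; exact: subexp_abs.
set a := gE _; set k := gE (fun x : R => `|x| ^+ 3) + 1.
have k0 : 0 <= k by rewrite addr_ge0// gE_ge0// => x; rewrite exprn_ge0.
have key c : 0 < c -> c <= 1 -> `|1 - a| <= k * c.
  move=> c0 c1; have := gE_sin_stein c 0; rewrite gE_cos cos0 mul1r => E.
  have ss : subexp (fun u : R => u * sin (c * u + 0)) by exact/subexpM/subexp_sin.
  have h1 : `|gE (fun u => u * sin (c * u + 0)) - c * a| <= c ^+ 2 * gE (fun x : R => `|x| ^+ 3).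
    have sca := subexpZ c s2.
    rewrite -gEZ// -gEB// (le_trans (gE_norm _))//; first exact: subexpB.
    rewrite -gEZ//; apply: le_gE => [||u].
    - by apply: subexp_norm; exact: subexpB.
    - exact: subexpZ.
    - rewrite addr0 (_ : _ - _ = u * (sin (c * u) - c * u)); last by ring.
      rewrite normrM (le_trans (ler_wpM2l _ (sin_taylor _)))//.
      rewrite exprMn -(real_normK (num_real u)) le_eqVlt; apply/orP; left; apply/eqP.
      by ring.
  have h2 : `|expR (- (c ^+ 2 / 2)) - 1| <= c.
    have c2 : c ^+ 2 <= c by rewrite expr2 ler_piMl// ltW.
    have g := expR_ge1Dx (- (c ^+ 2 / 2)).
    have l : expR (- (c ^+ 2 / 2)) <= 1.
      by rewrite -expR0 ler_expR oppr_le0 divr_ge0// sqr_ge0.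
    by have := sqr_ge0 c; rewrite ler_norml; move=> ?; apply/andP; split; lra.
  rewrite E in h1; set x := expR _ in h1 h2.
  rewrite -mulrBr normrM gtr0_norm// expr2 -mulrA ler_pM2l// in h1.
  have -> : 1 - a = (x - a) - (x - 1) by ring.
  by rewrite (le_trans (ler_normB _ _))// /k mulrDl mul1r [gE _ * c]mulrC lerD.
apply/eqP; rewrite eq_sym -subr_eq0 -normr_le0; apply/ler_addgt0Pl => e e0; rewrite addr0.
have k1 : 0 < k + 1 by rewrite ltr_wpDl.
pose c := Num.min 1 (e / (k + 1)).
have c0 : 0 < c by rewrite lt_min ltr01 divr_gt0.
have c1 : c <= 1 by rewrite ge_min lexx.
rewrite (le_trans (key c c0 c1))//.
apply: (@le_trans _ _ (k * (e / (k + 1)))).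
  by rewrite ler_wpM2l// ge_min lexx orbT.
by rewrite mulrCA ler_piMr ?(ltW e0)// ler_pdivrMr// mul1r lerDl.
Qed.

Lemma subexp_affine (f : R -> R) (m s : R) : subexp f -> subexp (fun x => f (m + s * x)).
Proof.
move=> [mf [C [c [C0 c0 fC]]]]; split.
  by apply: (measurableT_comp mf); apply: measurable_funD => //; apply: measurable_funM.
exists (C * expR (c * `|m|)), (c * `|s|); split => [||u].
- by rewrite mulr_ge0 ?expR_ge0.
- by rewrite mulr_ge0.
rewrite (le_trans (fC _))// -mulrA ler_wpM2l// -expRD ler_expR.
by rewrite -mulrA -normrM -mulrDr ler_wpM2l// ler_normD.
Qed.

Lemma gE_affine2 (m s : R) : gE (fun x => (m + s * x) ^+ 2) = m ^+ 2 + s ^+ 2.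
Proof.
have s1 : subexp (fun x : R => x) by exact: subexp_id.
have s2 : subexp (fun x : R => x ^+ 2) by exact: subexpX.
have -> : (fun x => (m + s * x) ^+ 2) =
    fun x => (m ^+ 2 + 2 * m * s * x) + s ^+ 2 * x ^+ 2.
  by apply/funext => x; ring.
have s3 := subexpZ (2 * m * s) s1; have s4 := subexp_cst (m ^+ 2).
rewrite gED; [|exact: subexpD|exact: subexpZ].
by rewrite gED// gE_cst !gEZ// gE_id gE_sqr mulr0 addr0 mulr1.
Qed.

Lemma gE_affine1 (m s : R) : gE (fun x => m + s * x) = m.
Proof.
have s1 : subexp (fun x : R => x) by exact: subexp_id.
rewrite gED; [|exact: subexp_cst|exact: subexpZ].
by rewrite gEZ// gE_id mulr0 addr0 gE_cst.
Qed.

End GaussianMoments.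

Section NormalLaw.
Context {R : realType} {dQ : measure_display} {TQ : measurableType dQ}.
Variables (Q : probability TQ R) (X : TQ -> R) (m v : R).
Hypotheses (mX : measurable_fun [set: TQ] X) (v0 : 0 <= v).
Hypothesis XE : forall B : set R, measurable B -> Q [set w | B (X w)] = normal_law m v B.

Let s := Num.sqrt v.

(** The representation [m + s * x] with [x] standard normal also covers the point mass at [m], for
    which [s = 0]. *)
Lemma ge0_integral_normal_law (f : R -> \bar R) :
  measurable_fun [set: R] f -> (forall x, (0 <= f x)%E) ->
  (\int[Q]_w f (X w) = \int[normal_prob 0 1]_x f (m + s * x)%R)%E.
Proof.
move=> mf f0.
have mset B : measurable B -> measurable (X @^-1` B).
  by move=> mB; rewrite -[X in measurable X]setTI; exact: mX.
have H (nu : {measure set R -> \bar R}) :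
    (forall B, measurable B -> nu B = normal_law m v B) ->
    (\int[Q]_w f (X w) = \int[nu]_x f x)%E.
  move=> nuE; rewrite (@ge0_integral_image_density _ _ _ _ R Q nu X (fun=> 1))//.
    by apply: eq_integral => w _; rewrite mule1.
  by move=> B mB; rewrite nuE// -XE// integral_cst ?mul1e//; exact: mset.
have [vz|vnz] := eqVneq v 0.
  rewrite (H (\d_m)); last by move=> B _; rewrite /normal_law vz eqxx.
  rewrite integral_dirac// diracT mul1e /s vz sqrtr0.
  under eq_integral do rewrite mul0r addr0.
  rewrite integral_cst//.
  by rewrite [X in _ = (_ * X)%E](@probability_setT _ _ _ (normal_prob 0 1)) mule1.
have s0 : 0 < s by rewrite sqrtr_gt0 lt_neqAle eq_sym vnz.
rewrite -(ge0_integral_normal_std m s0 mf f0).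
rewrite (@ge0_integral_image_density _ _ _ _ R Q (normal_prob m s) X (fun=> 1))//.
  by apply: eq_integral => w _; rewrite mule1.
move=> B mB; rewrite integral_cst ?mul1e; last exact: mset.
by rewrite [RHS](XE mB) /normal_law (negbTE vnz).
Qed.

Lemma normal_law_integrable f : subexp f -> Q.-integrable [set: TQ] (fun w => (f (X w))%:E).
Proof.
move=> sf; have mf := sf.1; apply/integrableP; split.
  by apply/measurable_EFinP; exact: (measurableT_comp mf mX).
rewrite (@ge0_integral_normal_law (fun x => `|(f x)%:E|%E))//.
  have /integrableP[_ ] := subexp_integrable (subexp_affine m s sf).
  by [].
by apply/measurable_EFinP; exact: (measurableT_comp _ mf).
Qed.

Lemma normal_law_expectation f : subexp f ->
  (\int[Q]_w (f (X w))%:E = (gE (fun x => f (m + s * x)))%:E)%E.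
Proof.
move=> sf; have [mf [C [c [C0 c0 fC]]]] := sf.
(* As in [gE_shift], a dominating function reduces the claim to nonnegative functions. *)
pose g (u : R) : R := C * expR (c * `|u|).
have sg : subexp g by apply: subexpZ; exact: subexp_expR_abs.
have g0 u : 0 <= g u by rewrite mulr_ge0 ?expR_ge0.
have fg0 u : 0 <= f u + g u.
  by rewrite addrC -lerBlDr sub0r (le_trans _ (fC u))// -normrN ler_norm.
have sfg := subexpD sf sg.
have ge0 h : subexp h -> (forall u, 0 <= h u) ->
    (\int[Q]_w (h (X w))%:E = (gE (fun x => h (m + s * x)))%:E)%E.
  move=> sh h0; rewrite (@ge0_integral_normal_law (EFin \o h))//.
    by rewrite gE_fin//; exact: subexp_affine.
  by apply/measurable_EFinP; exact: sh.1.
have -> : (fun w => (f (X w))%:E) = (fun w => (f (X w) + g (X w))%:E - (g (X w))%:E)%E.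
  by apply/funext => w; rewrite -EFinB addrK.
rewrite integralB//; [|exact: (normal_law_integrable sfg)|exact: normal_law_integrable].
rewrite (ge0 _ sfg fg0) ge0// -EFinB gED; [|exact: subexp_affine|exact: (subexp_affine m s sg)].
by rewrite addrK.
Qed.

End NormalLaw.

Lemma exprD_le (R : realType) (a b : R) k : 0 <= a -> 0 <= b ->
  (a + b) ^+ k <= 2 ^+ k * (a ^+ k + b ^+ k).
Proof.
move=> a0 b0; have h (x y : R) : 0 <= x -> x <= y -> (x + y) ^+ k <= 2 ^+ k * (x ^+ k + y ^+ k).
  move=> x0 xy; have y0 := le_trans x0 xy.
  apply: (@le_trans _ _ ((2 * y) ^+ k)).
    by rewrite lerXn2r ?nnegrE ?addr_ge0 ?mulr_ge0//; lra.
  by rewrite exprMn ler_wpM2l ?exprn_ge0// lerDr exprn_ge0.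
have [ab|/ltW ba] := leP a b; first exact: h.
by rewrite addrC [X in _ * X]addrC; exact: h.
Qed.

(** * Integrability and characteristic function of a Gaussian vector *)

Section GaussianVector.
Context {R : realType} {d : nat} {dQ : measure_display} {TQ : measurableType dQ}.
Variables (Q : probability TQ R) (C : 'M[R]_d) (Z : 'I_d -> {RV Q >-> R}).
Hypothesis ZG : centered_gaussian C Z.

Definition vecZ (w : TQ) : 'cV[R]_d := \col_i Z i w.

Lemma measurable_vecZ : measurable_fun [set: TQ] (vecZ : TQ -> borel_cV R d).
Proof.
apply: measurable_to_borel_cV => i.
by under eq_fun do rewrite mxE; exact: measurable_funPT.
Qed.

Let comb (v : 'cV[R]_d) w : R := \sum_i v i 0 * Z i w.

Let combE v w : comb v w = dotp v (vecZ w).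
Proof. by apply: eq_bigr => i _; rewrite mxE. Qed.

Let mcomb v : measurable_fun [set: TQ] (comb v).
Proof.
by apply: measurable_sum => i; apply: measurable_funM => //.
Qed.

Lemma vecZ_pow_integrable k (v : 'cV[R]_d) :
  Q.-integrable [set: TQ] (fun w => (`|dotp v (vecZ w)| ^+ k)%:E).
Proof.
have [/(_ (fun i => v i 0))[m [s [s0 H]]] _ _] := ZG.
have sk : subexp (fun x : R => `|x| ^+ k) by apply: subexpX; exact: subexp_abs.
have := normal_law_integrable (mcomb v) s0 H sk.
by under eq_fun do rewrite combE.
Qed.

Let integrable_Z k i : Q.-integrable [set: TQ] (fun w => (`|Z i w| ^+ k)%:E).
Proof.
have := vecZ_pow_integrable k (delta_mx i 0).
by under eq_fun do rewrite dotp_delta mxE.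
Qed.

Lemma l1norm_pow_integrable k :
  Q.-integrable [set: TQ] (fun w => ((1 + l1norm (vecZ w)) ^+ k)%:E).
Proof.
have mabs i : measurable_fun [set: TQ] (fun w => `|Z i w|).
  apply: measurableT_comp => //; exact: measurable_funPT.
have msum (r : seq 'I_d) : measurable_fun [set: TQ] (fun w => (1 + \sum_(i <- r) `|Z i w|) ^+ k).
  apply: measurable_funX; apply: measurable_funD => //.
  exact: measurable_sum.
(* Generalizing to partial sums permits an induction in which each coordinate costs a factor
   [2 ^+ k]. *)
suff H (r : seq 'I_d) : Q.-integrable [set: TQ] (fun w => ((1 + \sum_(i <- r) `|Z i w|) ^+ k)%:E).
  have := H (index_enum _); congr (Q.-integrable _ _); apply/funext => w.
  by congr (((1 + _) ^+ k)%:E); apply: eq_bigr => i _; rewrite mxE.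
elim: r => [|i r IH].
  have -> : (fun w => ((1 + \sum_(i <- [::]) `|Z i w|) ^+ k)%:E) = cst 1%:E.
    by apply/funext => w; rewrite big_nil addr0 expr1n.
  exact: finite_measure_integrable_cst.
apply: (@le_integrable _ _ _ Q _ measurableT _
  ((fun w => (2 ^+ k)%:E * (`|Z i w| ^+ k)%:E) \+
   (fun w => (2 ^+ k)%:E * ((1 + \sum_(i <- r) `|Z i w|) ^+ k)%:E))%E).
- exact/measurable_EFinP.
- move=> w _ /=; have S0 : 0 <= \sum_(j <- r) `|Z j w| by exact: sumr_ge0.
  have S1 : 0 <= 1 + \sum_(j <- r) `|Z j w| by rewrite addr_ge0.
  rewrite lee_fin big_cons [leLHS]ger0_norm; last first.
    by rewrite exprn_ge0// addr_ge0// addr_ge0.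
  rewrite [leRHS]ger0_norm; last by rewrite addr_ge0// mulr_ge0 ?exprn_ge0.
  by rewrite -mulrDr addrCA exprD_le.
- by apply: integrableD => //; apply: integrableZl.
Qed.

Lemma vecZ_integrable (F : 'cV[R]_d -> R) : continuous F -> poly_growth F ->
  Q.-integrable [set: TQ] (fun w => (F (vecZ w))%:E).
Proof.
move=> Fc /poly_growth_ge0[K [k [K0 FK]]].
apply: (@le_integrable _ _ _ Q _ measurableT _
  (fun w => (K%:E * ((1 + l1norm (vecZ w)) ^+ k)%:E)%E)).
- apply/measurable_EFinP.
  exact: (measurableT_comp (continuous_borel_cV Fc) measurable_vecZ).
- move=> w _ /=; rewrite lee_fin (le_trans (FK _))// ger0_norm//.
  by rewrite mulr_ge0// exprn_ge0// addr_ge0// l1norm_ge0.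
- by apply: integrableZl => //; exact: l1norm_pow_integrable.
Qed.

Definition expZ (F : 'cV[R]_d -> R) : R := \int[Q]_w F (vecZ w).

Lemma expZ_fin F : continuous F -> poly_growth F ->
  ('E_Q[fun w => F (vecZ w)] = (expZ F)%:E)%E.
Proof.
move=> Fc Fp; rewrite unlock /expZ /Rintegral fineK//.
by apply: integrable_fin_num => //; exact: vecZ_integrable.
Qed.

(** The hypothesis provides some normal law; its mean and variance are identified by computing the
    first two moments of the combination from those of the [Z i]. *)
Lemma gaussian_comb_law (v : 'cV[R]_d) : forall B : set R, measurable B ->
  Q [set w | B (comb v w)] = normal_law 0 (dotp v (C *m v)) B.
Proof.
have [Zlaw Zmean Zcov] := ZG.
have [m [s [s0 H]]] := Zlaw (fun i => v i 0).
have iZ i : Q.-integrable [set: TQ] (fun w => (Z i w)%:E).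
  have := integrable_Z 1 i => h.
  apply: (le_integrable _ _ _ h) => //.
    by apply/measurable_EFinP; exact: measurable_funPT.
  by move=> w _; rewrite expr1 /= normr_id.
have E1 i : (\int[Q]_w (Z i w)%:E = 0)%E by have := Zmean i; rewrite unlock.
have E2 i j : (\int[Q]_w (Z i w * Z j w)%:E = (C i j)%:E)%E.
  have := Zcov i j; rewrite covariance.unlock !Zmean/= => <-.
  by rewrite unlock; apply: eq_integral => w _ /=; rewrite mulrfctE/= !subr0.
have iZZ i j : Q.-integrable [set: TQ] (fun w => (Z i w * Z j w)%:E).
  apply: (@le_integrable _ _ _ Q _ measurableT _
    ((fun w => (`|Z i w| ^+ 2)%:E) \+ (fun w => (`|Z j w| ^+ 2)%:E))%E).
  - by apply/measurable_EFinP; apply: measurable_funM; exact: measurable_funPT.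
  - move=> w _ /=; rewrite lee_fin normrM [leRHS]ger0_norm ?addr_ge0 ?sqr_ge0//.
    by have := normr_ge0 (Z i w); have := normr_ge0 (Z j w); nra.
  - by apply: integrableD => //; exact: integrable_Z.
have s1 : subexp (fun x : R => x) by exact: subexp_id.
have mE : m = 0.
  apply: EFin_inj.
  rewrite -[m in LHS](gE_affine1 m (Num.sqrt s)) -(normal_law_expectation (mcomb v) s0 H s1).
  rewrite /comb; under eq_integral do rewrite -sumEFin.
  rewrite integral_sum//; last first.
    by move=> i; under eq_fun do rewrite EFinM; exact: integrableZl.
  rewrite big1// => i _; under eq_integral do rewrite EFinM.
  by rewrite integralZl// E1 mule0.
have sE : s = dotp v (C *m v).
  apply: EFin_inj.
  have := gE_affine2 m (Num.sqrt s); rewrite sqr_sqrtr// mE expr0n add0r => <-.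
  have s2 : subexp (fun x : R => x ^+ 2) by exact: subexpX.
  have := normal_law_expectation (mcomb v) s0 H s2; rewrite mE => <-.
  transitivity (\int[Q]_w (\sum_i \sum_j (v i 0 * v j 0)%:E * (Z i w * Z j w)%:E))%E.
    apply: eq_integral => w _; rewrite expr2 /comb mulr_suml -sumEFin.
    apply: eq_bigr => i _; rewrite mulr_sumr -sumEFin; apply: eq_bigr => j _.
    by rewrite -EFinM; congr EFin; ring.
  rewrite integral_sum//; last first.
    by move=> i; apply: integrable_sum => // j _; exact: integrableZl.
  rewrite /dotp -sumEFin; apply: eq_bigr => i _.
  rewrite integral_sum//; last by move=> j; exact: integrableZl.
  rewrite mxE mulr_sumr -sumEFin; apply: eq_bigr => j _.
  by rewrite integralZl// E2 -EFinM; congr EFin; ring.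
by move: H; rewrite mE sE.
Qed.

Lemma expZ_cos (v : 'cV[R]_d) (th : R) : 0 <= dotp v (C *m v) ->
  expZ (fun x => cos (dotp v x + th)) = cos th * expR (- (dotp v (C *m v) / 2)).
Proof.
move=> v0; have sc : subexp (fun x : R => cos (x + th)).
  by have := subexp_cos 1 th; under eq_fun do rewrite mul1r.
apply: EFin_inj; rewrite -expZ_fin; [|exact: continuous_cos_dotp|exact: poly_growth_cos].
rewrite unlock.
have := normal_law_expectation (mcomb v) v0 (gaussian_comb_law v) sc.
under eq_integral do rewrite combE.
move=> ->; congr EFin.
under [X in gE X]eq_fun do rewrite add0r.
by rewrite gE_cos sqr_sqrtr.
Qed.

Lemma expZD F G : continuous F -> poly_growth F -> continuous G -> poly_growth G ->
  expZ (fun x => F x + G x) = expZ F + expZ G.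
Proof. by move=> *; apply: RintegralD => //; exact: vecZ_integrable. Qed.

Lemma expZZ c F : continuous F -> poly_growth F ->
  expZ (fun x => c * F x) = c * expZ F.
Proof. by move=> *; apply: RintegralZl => //; exact: vecZ_integrable. Qed.

Lemma expZ_dist F G (e : R) k : continuous F -> poly_growth F ->
  continuous G -> poly_growth G -> 0 <= e ->
  (forall x, `|F x - G x| <= e * (1 + l1norm x) ^+ k) ->
  `|expZ F - expZ G| <= e * expZ (fun x => (1 + l1norm x) ^+ k).
Proof.
move=> Fc Fp Gc Gp e0 FG.
have iF := vecZ_integrable Fc Fp; have iG := vecZ_integrable Gc Gp.
have iB := l1norm_pow_integrable k.
rewrite /expZ -RintegralB// -RintegralZl//.
have iFG : Q.-integrable [set: TQ] (EFin \o (fun w => F (vecZ w) - G (vecZ w))).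
  by have := integrableB measurableT iF iG.
rewrite (le_trans (le_normr_Rintegral _ _))//.
apply: le_Rintegral => //.
- exact: (integrable_norm iFG).
- by have := integrableZl measurableT e iB.
Qed.

End GaussianVector.

(** * From cosines to continuous functions of polynomial growth *)

Section ChainLimit.
Context {R : realType} {d : nat} {dQ : measure_display} {TQ : measurableType dQ}.
Variables (Lam : 'M[R]_d) (hv mu : 'cV[R]_d).
Hypotheses (LS : stochastic_mx Lam) (LE : ergodic Lam) (muI : invariant_distr Lam mu).
Variables (Q : probability TQ R) (C : 'M[R]_d) (Z : 'I_d -> {RV Q >-> R}).
Hypotheses (HC : limit_covariance Lam mu hv C) (ZG : centered_gaussian C Z).

Lemma poly_growthD (F G : 'cV[R]_d -> R) : poly_growth F -> poly_growth G ->
  poly_growth (fun x => F x + G x).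
Proof.
move=> /poly_growth_ge0[K [k [K0 FK]]] /poly_growth_ge0[L [l [L0 GL]]].
exists (K + L), (k + l)%N => x; rewrite (le_trans (ler_normD _ _))// mulrDl.
have x1 : 1 <= 1 + l1norm x by rewrite lerDl l1norm_ge0.
rewrite lerD//.
- rewrite (le_trans (FK x))// ler_wpM2l//.
  by apply: ler_weXn2l => //; exact: leq_addr.
- rewrite (le_trans (GL x))// ler_wpM2l//.
  by apply: ler_weXn2l => //; exact: leq_addl.
Qed.

Lemma poly_growthZ c (F : 'cV[R]_d -> R) : poly_growth F -> poly_growth (fun x => c * F x).
Proof.
move=> [K [k FK]]; exists (`|c| * K), k => x.
by rewrite normrM -mulrA ler_wpM2l.
Qed.

Lemma trigpoly_regular p : @trigpoly R d p -> continuous p /\ poly_growth p.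
Proof.
elim=> [v th|f g _ [fc fp] _ [gc gp]|c f _ [fc fp]].
- by split; [exact: continuous_cos_dotp|exact: poly_growth_cos].
- split; last exact: poly_growthD.
  move=> x; exact: (@continuousD R R^o _ f g x (fc x) (gc x)).
- split; last exact: poly_growthZ.
  move=> x; exact: (@continuousM R _ (fun=> c) f x (@cst_continuous _ _ c x) (fc x)).
Qed.

Lemma chain_limit_trigpoly p : trigpoly p -> chain_limit Lam hv mu p (expZ Z p).
Proof.
have [C0 _ _] := HC; have [_ Cpos] := C0.
elim=> [v th|f g tf IHf tg IHg|c f tf IHf].
- rewrite (expZ_cos ZG); last by have := Cpos v; rewrite -mulmxA -dotpE.
  exact: chain_limit_cos.
- have [fc fp] := trigpoly_regular tf; have [gc gp] := trigpoly_regular tg.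
  by rewrite (expZD ZG)//; apply: (chain_limitD muI).
- have [fc fp] := trigpoly_regular tf.
  by rewrite (expZZ ZG)//; apply: (chain_limitZ muI).
Qed.

(** A trigonometric approximation with weighted error [e] costs [e] times a moment on either side:
    [M1] along the chain, uniformly in large [sigma] and late times, and [expZ Z W] for the Gaussian
    vector. *)
Lemma chain_limit_gaussian F : continuous F -> poly_growth F ->
  chain_limit Lam hv mu F (expZ Z F).
Proof.
move=> Fc Fp delta delta0.
have muS : simplex mu by case: muI.
have [k Hk] := trig_density Fc Fp.
have [M1' HM] := chain_moments hv LS LE muI k.
pose W (x : 'cV[R]_d) := (1 + l1norm x) ^+ k.
have Wc : continuous W by apply: continuous_pow; exact: continuous_one_plus_l1norm.
have Wp : poly_growth W by exact: poly_growth_pow.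
have W0 : 0 <= expZ Z W.
  by apply: Rintegral_ge0 => w _; rewrite exprn_ge0// addr_ge0// l1norm_ge0.
pose M1 : R := Num.max M1' 0.
have M10 : 0 <= M1 by rewrite le_max lexx orbT.
pose K := M1 + expZ Z W + 1.
have K0 : 0 < K by rewrite ltr_wpDl// addr_ge0.
have d2 : 0 < delta / 2 by rewrite divr_gt0.
pose e := delta / 2 / K.
have e0 : 0 < e by rewrite divr_gt0.
have [p tp Fp'] := Hk _ e0.
have [pc pp] := trigpoly_regular tp.
have [s0 s01 Hs] := chain_limit_trigpoly tp d2.
exists s0 => // sigma ss.
have s1 : 1 <= sigma by exact: le_trans ss.
have sp : 0 <= sigma by lra.
have [N1 HN1] := Hs _ ss; have [N2 HN2] := HM _ s1.
exists (maxn N1 N2) => m mc n; rewrite geq_max => /andP[n1 n2].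
have h1 := HN1 _ mc _ n1; have h2 := HN2 _ mc _ n2.
have h3 : `|expZ Z F - expZ Z p| <= e * expZ Z W.
  by apply: (expZ_dist ZG) => //; exact: ltW.
set E1 := expS _ _ in h1; set E2 := expS _ _.
have h4 : `|E2 - E1| <= e * M1.
  apply: (@le_trans _ _ (expS (m n) (fun eta => e * W (sigma *: (eta - mu))))).
    have bW := @simplex_bounded_centered R d sigma mu W sp muS Wc Wp.
    apply: expS_dist.
    - exact: simplex_bounded_centered.
    - exact: simplex_bounded_centered.
    - exact: simplex_boundedZ.
    - by move=> eta _; exact: Fp'.
  rewrite expSZ; last exact: (@simplex_bounded_centered R d sigma mu W).
  by rewrite ler_wpM2l ?(ltW e0)// le_max h2.
have eK : e * M1 + e * expZ Z W <= delta / 2.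
  rewrite -mulrDr /e -mulrA ler_piMr ?(ltW d2)// mulrC ler_pdivrMr// mul1r.
  by rewrite /K lerDl.
have -> : E2 - expZ Z F = (E2 - E1) + (E1 - expZ Z p) - (expZ Z F - expZ Z p) by ring.
rewrite (le_trans (ler_normB _ _))//.
have := ler_normD (E2 - E1) (E1 - expZ Z p); lra.
Qed.

End ChainLimit.

(** * The filter as a conditional law *)

Section DensityUnique.
Context d (T : measurableType d) (R : realType).
Variables (rho1 rho2 : {measure set T -> \bar R}) (f g : T -> \bar R).
Hypotheses (mf : measurable_fun [set: T] f) (mg : measurable_fun [set: T] g).
Hypotheses (f0 : forall x, (0 <= f x)%E) (g0 : forall x, (0 <= g x)%E).
Variable G : set (set T).
Hypotheses (GI : setI_closed G) (Gm : G `<=` measurable) (GT : G [set: T]).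
Hypothesis fgG : forall B, G B -> (\int[rho1]_(x in B) f x = \int[rho2]_(x in B) g x)%E.
Hypothesis f_fin : (\int[rho1]_x f x < +oo)%E.

(** The sets on which the integrals agree form a Dynkin system containing the pi-system [G];
    finiteness of the total integral is what handles complements. *)
Lemma density_unique B : <<s G >> B ->
  measurable B /\ (\int[rho1]_(x in B) f x = \int[rho2]_(x in B) g x)%E.
Proof.
rewrite -(setI_closed_g_dynkin_g_sigma_algebra GI).
suff : <<d G >> `<=` [set A | measurable A /\
    (\int[rho1]_(x in A) f x = \int[rho2]_(x in A) g x)%E] by apply.
apply: smallest_sub => [|A GA]; last by split; [exact: Gm|exact: fgG].
split; first by split => //; exact: (fgG GT).
- move=> A [mA fgA]; split; first exact: measurableC.
  have split_int (rho : {measure set T -> \bar R}) (k : T -> \bar R) :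
      measurable_fun [set: T] k -> (forall x, (0 <= k x)%E) ->
      (\int[rho]_x k x = \int[rho]_(x in A) k x + \int[rho]_(x in ~` A) k x)%E.
    move=> mk k0; rewrite -(setUv A) ge0_integral_setU//.
    - exact: measurableC.
    - exact: measurable_funTS.
    - by apply/disj_setPS => x [].
  have := fgG GT; rewrite (split_int rho1 f)// (split_int rho2 g)// fgA.
  have Afin : (\int[rho2]_(x in A) g x)%E \is a fin_num.
    rewrite -fgA ge0_fin_numE; last exact: integral_ge0.
    apply: le_lt_trans f_fin; rewrite (split_int rho1 f)// leeDl//.
    exact: integral_ge0.
  move=> /(congr1 (fun t => t - \int[rho2]_(x in A) g x)%E).
  by rewrite ![(\int[rho2]_(x in A) g x + _)%E]addeC !addeK.
- move=> F tF FP; split; first by apply: bigcupT_measurable => k; case: (FP k).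
  have mF k : measurable (F k) by case: (FP k).
  have series (rho : {measure set T -> \bar R}) (k : T -> \bar R) :
      measurable_fun [set: T] k -> (forall x, (0 <= k x)%E) ->
      (\int[rho]_(x in \bigcup_i F i) k x = \sum_(i <oo) \int[rho]_(x in F i) k x)%E.
    by move=> mk k0; apply: ge0_integral_bigcup => //; exact: measurable_funTS.
  by rewrite !series//; apply: eq_eseriesr => k _; case: (FP k).
Qed.

End DensityUnique.

(** * Joint law of paths and observations *)

Section HiddenMarkov.
Context {R : realType} {d : nat} (a : 'I_d -> R) (a_inj : injective a).
Context (Lam : 'M[R]_d) (nu : 'cV[R]_d).
Context {dT : measure_display} {T : measurableType dT} (P : probability T R).
Context (X : nat -> {RV P >-> R}) (X_chain : markov_chain a Lam nu X).
Context (h : R -> R).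
Context (xi : nat -> {RV P >-> R}) (xi_noise : std_gaussian_noise xi).
Context (xi_X_indep : indep_processes P [set: nat] X [set m | (1 <= m)%N] xi).
Context (sigma : R) (sigma0 : 0 < sigma).

Local Notation gam := (normal_prob (0 : R) 1).
Let hv : 'cV[R]_d := \col_i h (a i).
Let e := sigma^-1.

Definition scaled_obs (m : nat) (w : T) : R := sigma^-1 * obs h sigma X xi m w.

Local Notation U := scaled_obs.

Definition state (n : nat) (i : 'I_d) : set T := [set w | X n w = a i].

Definition pathset (n : nat) (s : nat -> 'I_d) : set T :=
  [set w | forall k, (k <= n)%N -> X k w = a (s k)].

Definition rect (n : nat) (B : nat -> set R) : set T :=
  [set w | forall m, (1 <= m <= n)%N -> B m (U m w)].

(** The law of the rescaled observation in state [i], normal with mean [e * hv i 0] and variance 1,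
    written by its density relative to the standard normal law. *)
Definition obs_law (i : 'I_d) (B : set R) : \bar R :=
  (\int[gam]_(u in B) (weight hv e i u)%:E)%E.

Lemma state_obs m i w : X m w = a i -> U m w = xi m w + e * hv i 0.
Proof.
move=> E; rewrite /U /obs E /hv mxE /e; field.
by rewrite gt_eqF.
Qed.

Lemma measurable_state n i : measurable (state n i).
Proof.
have := measurable_funPT (X n) measurableT _ (measurable_set1 (a i)).
by rewrite setTI.
Qed.

Lemma state_exists n w : exists i, X n w = a i.
Proof.
case: X_chain => Xr _ _; have [i _ E] := Xr n w.
by exists i.
Qed.

Lemma measurable_scaled_obs m : measurable_fun [set: T] (U m).
Proof.
have -> : U m = fun w => \sum_i (\1_(state m i) w * (xi m w + e * hv i 0)).
  apply/funext => w; have [i Xi] := state_exists m w.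
  rewrite (bigD1 i)//= big1 ?addr0 => [|j ji].
    by rewrite indicE mem_set// mul1r; exact: state_obs.
  rewrite indicE memNset ?mul0r// /state/= Xi => /a_inj ij.
  by rewrite ij eqxx in ji.
apply: measurable_sum => i; apply: measurable_funM.
  exact/measurable_indic/measurable_state.
by apply: measurable_funD => //; exact: measurable_funPT.
Qed.

(** The index set in the form over which [mutually_indep] quantifies. *)
Definition times (n : nat) : {fset nat} := [fset k in iota 1 n]%fset.

Lemma in_times n m : (m \in times n) = (1 <= m <= n)%N.
Proof. by rewrite !inE/= mem_iota add1n ltnS. Qed.

Lemma measurable_rect n B : (forall m, measurable (B m)) -> measurable (rect n B).
Proof.
move=> mB.
have -> : rect n B = \bigcap_(m in [set` times n]) (U m @^-1` B m).
  apply/seteqP; split => w H m; first by rewrite /= in_times; exact: H.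
  by move=> mn; apply: H; rewrite /= in_times.
apply: fin_bigcap_measurable => [|m _]; first exact: finite_fset.
by rewrite -[X in measurable X]setTI; exact: measurable_scaled_obs.
Qed.

Lemma pathset_sigma n s : sigma_of [set: nat] X (pathset n s).
Proof.
pose G := \bigcup_(m in [set: nat]) preimage_set_system [set: T] (X m) measurable.
have -> : pathset n s = \bigcap_(k in `I_n.+1) state k (s k).
  by apply/seteqP; split => w H k /=; exact: H.
have : @measurable _ (g_sigma_algebraType G) (\bigcap_(k in `I_n.+1) state k (s k)).
  apply: fin_bigcap_measurable; first exact: finite_II.
  move=> k _; apply: sub_sigma_algebra; exists k => //.
  exists [set a (s k)]; first exact: measurable_set1.
  by rewrite setTI.
by [].
Qed.

Lemma measurable_pathset n s : measurable (pathset n s).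
Proof.
have -> : pathset n s = \bigcap_(k in `I_n.+1) state k (s k).
  by apply/seteqP; split => w H k /=; exact: H.
apply: fin_bigcap_measurable; first exact: finite_II.
by move=> k _; exact: measurable_state.
Qed.

Lemma timesS n : times n.+1 = (n.+1 |` times n)%fset.
Proof.
apply/fsetP => m; rewrite in_fset1U !in_times.
by apply/idP/idP; lia.
Qed.

Lemma noise_law m i (B : set R) : (1 <= m)%N -> measurable B ->
  P (xi m @^-1` [set x | B (x + e * hv i 0)]) = obs_law i B.
Proof.
move=> m1 mB; have [_ xlaw] := xi_noise.
have msh : measurable_fun [set: R] (fun x : R => x + e * hv i 0) by exact: measurable_funD.
have mB' : measurable [set x : R | B (x + e * hv i 0)].
  by rewrite -[X in measurable X]setTI; exact: msh.
apply: etrans (xlaw m m1 _ mB') _.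
have mI : measurable_fun [set: R] (fun x : R => (\1_B x)%:E : \bar R).
  by apply/measurable_EFinP; exact: measurable_indic.
have := @ge0_integral_normal_shift R (e * hv i 0) (fun x => (\1_B x)%:E) mI.
have I0 x : (0%R <= (\1_B x)%:E :> \bar R)%E by rewrite lee_fin.
move=> /(_ I0); rewrite /obs_law.
rewrite [X in X = _ -> _](_ : _ = gam [set x : R | B (x + e * hv i 0)]); last first.
  by rewrite -[in RHS](setIT [set x : R | B (x + e * hv i 0)]) -integral_indic//; apply: eq_integral => x _ /=.
move=> ->; rewrite [RHS]integral_mkcond; apply: eq_integral => x _.
rewrite patchE indicE -EFinM.
by case: ifP => _; rewrite ?mul1r ?mul0r.
Qed.

(** On a fixed path each observation is the noise translated by a known amount. The event thus
    becomes one about the noise alone, which is independent of the path and factorizes. *)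
Lemma path_rect n s B : (forall m, measurable (B m)) ->
  P (pathset n s `&` rect n B) =
  (P (pathset n s) * \prod_(m <- times n) obs_law (s m) (B m))%E.
Proof.
move=> mB.
pose B' m := if (1 <= m)%N then [set x : R | B m (x + e * hv (s m) 0)] else [set: R].
pose V := \bigcap_(m in [set` times n]) (xi m @^-1` B' m).
have msh m : measurable_fun [set: R] (fun x : R => x + e * hv (s m) 0).
  exact: measurable_funD.
have mB' m : measurable (B' m).
  rewrite /B'; case: ifP => // _.
  by rewrite -[X in measurable X]setTI; exact: msh.
have -> : pathset n s `&` rect n B = pathset n s `&` V.
  apply/seteqP; split => w [pw H]; split => // m.
    move=> /=; rewrite in_times => /andP[m1 mn]; rewrite /B' m1/=.
    by rewrite -(state_obs (pw m mn)); apply: H; rewrite m1.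
  move=> /andP[m1 mn]; have := H m; rewrite /= in_times m1 mn /B' m1 => /(_ isT)/=.
  by rewrite -(state_obs (pw m mn)).
have sV : sigma_of [set m | (1 <= m)%N] xi V.
  pose G := \bigcup_(m in [set m | (1 <= m)%N]) preimage_set_system [set: T] (xi m) measurable.
  have : @measurable _ (g_sigma_algebraType G) V.
    apply: fin_bigcap_measurable; first exact: finite_fset.
    move=> m /=; rewrite in_times => /andP[m1 _]; apply: sub_sigma_algebra; exists m => //.
    by exists (B' m) => //; rewrite setTI.
  by [].
rewrite xi_X_indep//; last exact: pathset_sigma.
congr (_ * _)%E; have [xind _] := xi_noise.
rewrite xind//; last by move=> m /=; rewrite in_times => /andP[].
rewrite big_seq [RHS]big_seq; apply: eq_bigr => m; rewrite in_times => /andP[m1 _].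
by rewrite /B' m1; exact: noise_law.
Qed.

Lemma path_rect_step n s B : (forall m, measurable (B m)) ->
  P (pathset n.+1 s `&` rect n.+1 B) =
  ((Lam (s n) (s n.+1))%:E * (P (pathset n s `&` rect n B) * obs_law (s n.+1) (B n.+1)))%E.
Proof.
move=> mB; rewrite !path_rect// timesS big_fsetU1/=; last by rewrite in_times ltnn andbF.
case: X_chain => _ _ Xm.
have -> : pathset n.+1 s =
    [set w | (forall k, (k <= n)%N -> X k w = a (s k)) /\ X n.+1 w = a (s n.+1)].
  apply/seteqP; split => [w H|w [H1 H2] k].
    by split => [k kn|]; apply: H => //; exact: leqW.
  by rewrite leq_eqVlt => /orP[/eqP->//|]; rewrite ltnS; exact: H1.
rewrite Xm -!muleA; congr (_ * (_ * _))%E.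
by rewrite muleC.
Qed.

(** Up to time [n] there are finitely many paths; [inord] extends a finite path to the sequence
    expected by [pathset]. *)
Lemma path_partition n E : measurable E ->
  P E = (\sum_(s : {ffun 'I_n.+1 -> 'I_d}) P (pathset n (fun k => s (inord k)) `&` E))%E.
Proof.
move=> mE.
have mpE (s : {ffun 'I_n.+1 -> 'I_d}) : measurable (pathset n (fun k => s (inord k)) `&` E).
  by apply: measurableI => //; exact: measurable_pathset.
under eq_bigr => s _ do rewrite -[X in P X]setIT -integral_indic//.
rewrite -ge0_integral_sum//; last first.
  by move=> s; apply/measurable_EFinP; exact: measurable_indic.
rewrite -[X in P X]setIT -integral_indic//; apply: eq_integral => w _.
pose s0 : {ffun 'I_n.+1 -> 'I_d} := [ffun k : 'I_n.+1 => sval (cid (state_exists k w))].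
have s0P (k : 'I_n.+1) : X k w = a (s0 k) by rewrite ffunE; case: cid.
rewrite (bigD1 s0)//= big1 ?adde0 => [|s ss0].
  congr EFin; rewrite !indicE; congr (_ : bool)%:R; apply/idP/idP => /set_mem H; apply/mem_set.
    by split => // k kn; rewrite -[in X k](@inordK n k)// ?ltnS// s0P.
  by case: H.
rewrite indicE memNset// => -[H _]; move/eqP: ss0; apply; apply/ffunP => k.
by apply: a_inj; rewrite -s0P H ?inord_val// -ltnS.
Qed.

End HiddenMarkov.

Section Filter.
Context {R : realType} {d : nat} (a : 'I_d -> R) (a_inj : injective a).
Context (Lam : 'M[R]_d) (LS : stochastic_mx Lam) (nu : 'cV[R]_d) (nuS : simplex nu).
Context {dT : measure_display} {T : measurableType dT} (P : probability T R).
Context (X : nat -> {RV P >-> R}) (X_chain : markov_chain a Lam nu X).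
Context (h : R -> R).
Context (xi : nat -> {RV P >-> R}) (xi_noise : std_gaussian_noise xi).
Context (xi_X_indep : indep_processes P [set: nat] X [set m | (1 <= m)%N] xi).
Context (sigma : R) (sigma0 : 0 < sigma).

Local Notation gam := (normal_prob (0 : R) 1).
Let hv : 'cV[R]_d := \col_i h (a i).
Let e := sigma^-1.
Local Notation U := (scaled_obs X h xi sigma).
Local Notation state := (state a X).
Local Notation rect := (rect X h xi sigma).
Local Notation obs_law := (obs_law a h sigma).

Let mstate n i : measurable (state n i).
Proof. exact: measurable_state. Qed.

Let mU n : measurable_fun [set: T] (U n).
Proof. by apply: (measurable_scaled_obs a_inj X_chain). Qed.

Let mrect n B : (forall m, measurable (B m)) -> measurable (rect n B).
Proof. by move=> mB; apply: (measurable_rect a_inj X_chain). Qed.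

Lemma obs_law_fin j B : measurable B -> (obs_law j B = (fine (obs_law j B))%:E)%E.
Proof.
move=> mB; rewrite fineK// ge0_fin_numE; last first.
  by apply: integral_ge0 => u _; rewrite lee_fin ltW// weight_gt0.
apply: (@le_lt_trans _ _ (\int[gam]_u (weight hv e j u)%:E)%E).
  apply: ge0_subset_integral => //.
    by apply/measurable_EFinP; exact: (subexp_weight hv e j).1.
  by move=> u _; rewrite lee_fin ltW// weight_gt0.
by rewrite -gE_fin ?ltry//; exact: subexp_weight.
Qed.

Lemma obs_law_ge0 j B : (0 <= obs_law j B)%E.
Proof. by apply: integral_ge0 => u _; rewrite lee_fin ltW// weight_gt0. Qed.

(** Sum over all paths up to time [n], apply [path_rect_step] to each, and group them by their last
    state. *)
Lemma transition_rect n B j C : (forall m, measurable (B m)) -> measurable C ->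
  P (rect n B `&` (state n.+1 j `&` U n.+1 @^-1` C)) =
  (\sum_i (Lam i j)%:E * (P (rect n B `&` state n i) * obs_law j C))%E.
Proof.
move=> mB mC; have [L0 _] := LS.
(* [rect n B] involves indices up to [n] only, so index [n.+1] is free to carry [C]. *)
pose B'' m := if m == n.+1 then C else B m.
have mB'' m : measurable (B'' m) by rewrite /B''; case: ifP.
have mUC : measurable (U n.+1 @^-1` C).
  by rewrite -[X in measurable X]setTI; exact: mU.
have mr := mrect n mB.
rewrite (path_partition a_inj X_chain n); last first.
  by apply: measurableI => //; exact: measurableI.
pose pr (s : {ffun 'I_n.+1 -> 'I_d}) := P (pathset a X n (fun k => s (inord k)) `&` rect n B).
have term (s : {ffun 'I_n.+1 -> 'I_d}) :
    P (pathset a X n (fun k => s (inord k)) `&` (rect n B `&` (state n.+1 j `&` U n.+1 @^-1` C))) =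
    ((Lam (s ord_max) j)%:E * (pr s * obs_law j C))%E.
  pose s'' k := if k == n.+1 then j else s (inord k).
  have -> : pathset a X n (fun k => s (inord k)) `&` (rect n B `&` (state n.+1 j `&` U n.+1 @^-1` C)) =
      pathset a X n.+1 s'' `&` rect n.+1 B''.
    apply/seteqP; split => w.
      move=> [H1 [H2 [H3 H4]]]; split => [k kn|m /andP[m1 mn]].
        rewrite /s''; case: eqP => [->//|/eqP kn1]; apply: H1.
        by rewrite -ltnS ltn_neqAle kn1.
      rewrite /B''; case: eqP => [->//|/eqP mn1]; apply: H2.
      by rewrite m1 -ltnS ltn_neqAle mn1.
    move=> [H1 H2]; split; [|split; [|split]].
    - move=> k kn; rewrite H1 ?leqW// /s''.
      by rewrite ltn_eqF// ltnS.
    - move=> m /andP[m1 mn]; have := H2 m; rewrite m1 leqW// /B'' ltn_eqF ?ltnS//; exact.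
    - by have := H1 n.+1 (leqnn _); rewrite /s'' eqxx.
    - by have := H2 n.+1; rewrite /B'' eqxx /= leqnn; exact.
  rewrite (path_rect_step X_chain h xi_noise xi_X_indep sigma0 n s'' mB'').
  rewrite /s'' /B'' eqxx ltn_eqF// (_ : inord n = ord_max); last first.
    by apply: val_inj => /=; rewrite inordK.
  congr (_ * (P _ * _))%E; apply/seteqP; split => w [H1 H2]; split.
  - by move=> k kn; rewrite H1// ltn_eqF// ltnS.
  - by move=> m /andP[m1 mn]; have := H2 m; rewrite m1 mn ltn_eqF ?ltnS//; exact.
  - by move=> k kn; rewrite H1// ltn_eqF// ltnS.
  - by move=> m /andP[m1 mn]; have := H2 m; rewrite m1 mn ltn_eqF ?ltnS//; exact.
under eq_bigr do rewrite term.
have stateE i : P (rect n B `&` state n i) =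
    (\sum_(s : {ffun 'I_n.+1 -> 'I_d}) (if s ord_max == i then pr s else 0))%E.
  rewrite (path_partition a_inj X_chain n); last exact: measurableI.
  apply: eq_bigr => s _.
  have sn w : pathset a X n (fun k => s (inord k)) w -> X n w = a (s ord_max).
    move=> H; rewrite H//; congr (a (s _)).
    by apply: val_inj => /=; rewrite inordK.
  case: eqP => [si|si].
    congr (P _); apply/seteqP; split => w; first by move=> [? []].
    by move=> [H1 H2]; split => //; split => //; rewrite /state/= sn// si.
  rewrite (_ : _ `&` _ = set0) ?measure0//; apply/seteqP; split => // w [H1 [_ H2]].
  by apply: si; apply: a_inj; rewrite -(sn _ H1).
have pr0 s : (0 <= pr s)%E by exact: measure_ge0.
transitivity (\sum_i \sum_(s : {ffun 'I_n.+1 -> 'I_d})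
    (if s ord_max == i then (Lam i j)%:E * (pr s * obs_law j C) else 0))%E.
  rewrite exchange_big/=; apply: eq_bigr => s _.
  rewrite (bigD1 (s ord_max))//= eqxx big1 ?adde0// => i.
  by rewrite eq_sym => /negbTE->.
apply: eq_bigr => i _; rewrite stateE ge0_sume_distrl; last by move=> s _; case: ifP.
rewrite ge0_sume_distrr; last first.
  by move=> s _; case: ifP; rewrite ?mul0e// => _; rewrite mule_ge0// obs_law_ge0.
by apply: eq_bigr => s _; case: ifP => //; rewrite mul0e mule0.
Qed.

Definition obs_gen (n : nat) : set (set T) :=
  \bigcup_(m in [set m | (1 <= m <= n)%N])
    preimage_set_system [set: T] (obs h sigma X xi m) measurable.

(** A pi-system generating the sigma-algebra of the observations, on which the joint law with the
    states is explicit. *)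
Definition rects (n : nat) : set (set T) :=
  [set A | exists2 B : nat -> set R, (forall m, measurable (B m)) & A = rect n B].

Lemma rects_setI n : setI_closed (rects n).
Proof.
move=> _ _ [B mB ->] [B' mB' ->]; exists (fun m => B m `&` B' m).
  by move=> m; exact: measurableI.
apply/seteqP; split => w; first by move=> [H1 H2] m mn; split; [exact: H1|exact: H2].
by move=> H; split => m mn; case: (H m mn).
Qed.

Lemma rects_measurable n : rects n `<=` measurable.
Proof. by move=> _ [B mB ->]; exact: mrect. Qed.

Lemma rects_setT n : rects n [set: T].
Proof. by exists (fun=> setT) => //; apply/seteqP; split. Qed.

Lemma obs_scaled m w : obs h sigma X xi m w = sigma * U m w.
Proof. by rewrite /scaled_obs mulrA divff ?mul1r// gt_eqF. Qed.

Lemma obs_gen_rects n : <<s obs_gen n >> `<=` <<s rects n >>.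
Proof.
apply: smallest_sub; first exact: smallest_sigma_algebra.
move=> _ [m /= mn [C mC <-]]; apply: sub_sigma_algebra.
have msc : measurable_fun [set: R] (fun u : R => sigma * u) by exact: measurable_funM.
exists (fun k => if k == m then [set u | C (sigma * u)] else setT).
  move=> k; case: ifP => // _.
  by rewrite -[X in measurable X]setTI; exact: msc.
rewrite setTI; apply/seteqP; split => w /=.
  by move=> H k kn; case: eqP => [->/=|//]; rewrite -obs_scaled.
by move=> H; have := H m mn; rewrite eqxx/= -obs_scaled.
Qed.

Local Notation Tn n := (g_sigma_algebraType (obs_gen n)).

Lemma obs_gen_measurable n A : <<s obs_gen n >> A -> measurable A.
Proof.
suff : <<s obs_gen n >> `<=` @measurable _ T by apply.
apply: smallest_sub; first exact: sigma_algebra_measurable.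
move=> _ [m /= mn [C mC <-]].
have mo : measurable_fun [set: T] (obs h sigma X xi m).
  rewrite (_ : obs h sigma X xi m = fun w => sigma * U m w).
    by apply: measurable_funM => //; exact: mU.
  by apply/funext => w; exact: obs_scaled.
exact: mo.
Qed.

Lemma obs_gen_sub n k : (n <= k)%N -> <<s obs_gen n >> `<=` <<s obs_gen k >>.
Proof.
move=> nk; apply: smallest_sub; first exact: smallest_sigma_algebra.
move=> A [m /= /andP[m1 mn] Am]; apply: sub_sigma_algebra; exists m => //=.
by rewrite m1 (leq_trans mn).
Qed.

Lemma rect_obs_gen n B : (forall m, measurable (B m)) -> <<s obs_gen n >> (rect n B).
Proof.
move=> mB.
have : @measurable _ (Tn n) (rect n B); last by [].
have -> : rect n B = \bigcap_(m in [set` times n]) (U m @^-1` B m).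
  apply/seteqP; split => w H m; first by rewrite /= in_times; exact: H.
  by move=> mn; apply: H; rewrite /= in_times.
apply: fin_bigcap_measurable => [|m]; first exact: finite_fset.
rewrite /= in_times => mn; apply: sub_sigma_algebra; exists m => //=.
have msc : measurable_fun [set: R] (fun u : R => sigma^-1 * u) by exact: measurable_funM.
exists [set y | B m (sigma^-1 * y)]; last by rewrite setTI.
by rewrite -[X in measurable X]setTI; exact: msc.
Qed.

Lemma measurable_scaled_obs_gen n m : (1 <= m <= n)%N ->
  measurable_fun [set: Tn n] (U m : Tn n -> R).
Proof.
move=> mn _ C mC; rewrite setTI; apply: sub_sigma_algebra; exists m => //=.
have msc : measurable_fun [set: R] (fun u : R => sigma^-1 * u) by exact: measurable_funM.
exists [set y | C (sigma^-1 * y)]; last by rewrite setTI.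
by rewrite -[X in measurable X]setTI; exact: msc.
Qed.

Fixpoint posterior (n : nat) (w : T) : 'cV[R]_d :=
  if n is n'.+1 then bayes hv e (Lam^T *m posterior n' w) (U n'.+1 w) else nu.

Lemma posterior_simplex n w : simplex (posterior n w).
Proof. by elim: n => //= n IH; apply: bayes_simplex; exact: stoch_simplex. Qed.

Lemma measurable_posterior_gen n :
  measurable_fun [set: Tn n] (posterior n : Tn n -> borel_cV R d).
Proof.
elim: n => [|n IH]; first exact: measurable_cst.
have IH' : measurable_fun [set: Tn n.+1] (posterior n : Tn n.+1 -> borel_cV R d).
  by move=> _ C mC; apply: (obs_gen_sub (leqnSn n)); exact: IH.
apply: measurable_bayes_comp; last by apply: measurable_scaled_obs_gen; rewrite leqnn.
exact: (measurableT_comp (measurable_mulmx_borel Lam^T) IH').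
Qed.

Lemma measurable_posterior n :
  measurable_fun [set: T] (posterior n : T -> borel_cV R d).
Proof. by move=> _ C mC; apply: (@obs_gen_measurable n); exact: measurable_posterior_gen. Qed.

End Filter.

(** * Conditional density given a sub-sigma-algebra *)

Section JointDensity.
Context {R : realType} {dT : measure_display} {T : measurableType dT}.
Variables (P : probability T R) (S : set (set T)).
Hypothesis Sm : <<s S >> `<=` measurable.
Local Notation gam := (normal_prob (0 : R) 1).
Local Notation TS := (g_sigma_algebraType S).
Variables (U : T -> R) (L : TS * R -> R).
Hypotheses (mU : measurable_fun [set: T] U) (mL : measurable_fun [set: TS * R] L).
Hypothesis L0 : forall z, 0 <= L z.
Hypothesis law : forall B C, <<s S >> B -> measurable C ->
  P (B `&` U @^-1` C) = (\int[P]_(w in B) \int[gam]_(u in C) (L (w, u))%:E)%E.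

(** The identity into the coarser measurable space, so that [PS] is the restriction of [P] to the
    sigma-algebra generated by [S]. *)
Let midn : measurable_fun [set: T] (id : T -> TS).
Proof. by move=> _ B mB; rewrite setTI; exact: Sm. Qed.

Let idS : {mfun T >-> TS} := mfun_Sub (mem_set midn).
Let PS : probability TS R := distribution P idS.

Let mpair : measurable_fun [set: T] (fun w => (w, U w) : (TS * measurableTypeR R)%type).
Proof. by apply: measurable_fun_pair; [exact: midn|exact: mU]. Qed.

Let pairS : {mfun T >-> (TS * measurableTypeR R)%type} := mfun_Sub (mem_set mpair).
Let PU : probability (TS * measurableTypeR R)%type R := distribution P pairS.

Let mLE : measurable_fun [set: TS * R] (EFin \o L).
Proof. exact/measurable_EFinP. Qed.

(** The hypothesis [law] makes [L] a conditional density of [U] given the past. It describes the law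
    of the pair on measurable rectangles, and [density_unique] extends the description to the
    product sigma-algebra. *)
Lemma ge0_integral_joint (f : TS * R -> \bar R) :
  measurable_fun [set: TS * R] f -> (forall z, (0 <= f z)%E) ->
  (\int[P]_w f (w, U w) = \int[P]_w \int[gam]_u (f (w, u) * (L (w, u))%:E))%E.
Proof.
have iterate (k : TS * R -> \bar R) : measurable_fun [set: TS * R] k -> (forall z, (0 <= k z)%E) ->
    (\int[PS \x gam]_z k z = \int[P]_w \int[gam]_u k (w, u))%E.
  move=> mk k0; rewrite fubini_tonelli1//.
  rewrite (ge0_integral_distribution idS)//; first exact: measurable_fun_fubini_tonelli_F.
  by move=> y; exact: integral_ge0.
have dens A : measurable (A : set (TS * R)) -> PU A = (\int[PS \x gam]_(z in A) (L z)%:E)%E.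
  move=> mA; pose G := [set B `*` C | B in @measurable _ TS & C in @measurable _ R].
  have GI : setI_closed G.
    move=> _ _ [B mB [C mC <-]] [B' mB' [C' mC' <-]].
    exists (B `&` B'); first exact: measurableI.
    by exists (C `&` C'); [exact: measurableI|rewrite setXI].
  have Gm : G `<=` measurable by move=> _ [B mB [C mC <-]]; exact: measurableX.
  have GT : G [set: TS * R] by exists setT => //; exists setT => //; rewrite setXTT.
  have fgG B : G B -> (\int[PU]_(x in B) 1 = \int[PS \x gam]_(x in B) (L x)%:E)%E.
    move=> [B1 mB1 [C mC <-]]; rewrite integral_cst ?mul1e//; last exact: measurableX.
    rewrite integral_mkcond iterate.
    - rewrite [LHS](law mB1 mC) integral_mkcond; apply: eq_integral => w _.
      rewrite patchE; case: ifPn => wB.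
        rewrite integral_mkcond; apply: eq_integral => u _.
        rewrite !patchE in_setX/= wB; by case: ifP.
      rewrite integral0_eq// => u _; rewrite patchE in_setX/= (negbTE wB).
      by [].
    - apply/(measurable_restrictT _ _).1 => //; first exact: measurableX.
      exact: measurable_funTS.
    - by move=> z; rewrite patchE; case: ifP; rewrite // lee_fin.
  have fin1 : (\int[PU]_z 1 < +oo)%E.
    by rewrite integral_cst// mul1e (@le_lt_trans _ _ 1%E) ?ltry// probability_le1.
  have sA : <<s G >> A by rewrite -measurable_prod_measurableType.
  have [_] := @density_unique _ _ _ PU _ (cst 1%E) (EFin \o L)
    (measurable_cst _) mLE (fun=> lee01) L0 _ GI Gm GT fgG fin1 A sA.
  by rewrite integral_cst ?mul1e.
move=> mf f0.
rewrite -[LHS](ge0_integral_distribution pairS)//.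
apply: etrans (@ge0_integral_image_density _ _ _ _ _ _ PU id L _ _ _ dens _ _ _) _ => //.
rewrite iterate//; first exact: emeasurable_funM.
by move=> z; rewrite mule_ge0// lee_fin.
Qed.

End JointDensity.

(** * The posterior recursion computes the conditional law of the state *)

Section FilterLaw.
Context {R : realType} {d : nat} (a : 'I_d -> R) (a_inj : injective a).
Context (Lam : 'M[R]_d) (LS : stochastic_mx Lam) (nu : 'cV[R]_d) (nuS : simplex nu).
Context {dT : measure_display} {T : measurableType dT} (P : probability T R).
Context (X : nat -> {RV P >-> R}) (X_chain : markov_chain a Lam nu X).
Context (h : R -> R).
Context (xi : nat -> {RV P >-> R}) (xi_noise : std_gaussian_noise xi).
Context (xi_X_indep : indep_processes P [set: nat] X [set m | (1 <= m)%N] xi).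
Context (sigma : R) (sigma0 : 0 < sigma).

Local Notation gam := (normal_prob (0 : R) 1).
Let hv : 'cV[R]_d := \col_i h (a i).
Let e := sigma^-1.
Local Notation U := (scaled_obs X h xi sigma).
Local Notation state := (state a X).
Local Notation rect := (rect X h xi sigma).
Local Notation obs_law := (obs_law a h sigma).
Local Notation obs_gen := (obs_gen X h xi sigma).
Local Notation rects := (rects X h xi sigma).
Local Notation posterior := (posterior a Lam nu X h xi sigma).

Let mstate n i : measurable (state n i).
Proof. exact: measurable_state. Qed.

Let mU n : measurable_fun [set: T] (U n).
Proof. by apply: (measurable_scaled_obs a_inj X_chain). Qed.

Let mUC n C : measurable C -> measurable (U n @^-1` C).
Proof. by move=> mC; rewrite -[X in measurable X]setTI; exact: mU. Qed.

Let mgen n A : <<s obs_gen n >> A -> measurable A.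
Proof. exact: (obs_gen_measurable a_inj X_chain sigma0). Qed.

Let mrects n : rects n `<=` measurable.
Proof. exact: (rects_measurable a_inj X_chain). Qed.

Let L0 i j : 0 <= Lam i j. Proof. by case: LS. Qed.

Let indic_ge0 (D : set T) w : (0 <= (\1_D w : R)%:E)%E.
Proof. by rewrite lee_fin. Qed.

Let mindic (D : set T) : measurable D -> measurable_fun [set: T] (fun w => (\1_D w : R)%:E).
Proof. by move=> mD; apply/measurable_EFinP; exact: measurable_indic. Qed.

Lemma state_partition n E : measurable E -> P E = (\sum_i P (E `&` state n i))%E.
Proof.
move=> mE.
have mEs i : measurable (E `&` state n i) by exact: measurableI.
under eq_bigr => i _ do rewrite -[X in P X]setIT -integral_indic//.
rewrite -ge0_integral_sum//; last by move=> i; exact: mindic.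
rewrite -[X in P X]setIT -integral_indic//; apply: eq_integral => w _.
have [i Xi] := state_exists X_chain n w.
rewrite (bigD1 i)//= big1 ?adde0 => [|j ji].
  congr EFin; rewrite !indicE; congr (_ : bool)%:R; apply/idP/idP => /set_mem H; apply/mem_set => //.
  by case: H.
rewrite indicE memNset// => -[_ Xj]; have ij := a_inj (etrans (esym Xi) Xj).
by rewrite ij eqxx in ji.
Qed.

(** Both sides are integrals over [A], of an indicator and of a combination of indicators, so
    [density_unique] extends the identity from rectangles to all observable events. *)
Lemma transition_sigma n A j C : <<s obs_gen n >> A -> measurable C ->
  P (A `&` (state n.+1 j `&` U n.+1 @^-1` C)) =
  (\sum_i (Lam i j)%:E * (P (A `&` state n i) * obs_law j C))%E.
Proof.
move=> gA mC.
have mD : measurable (state n.+1 j `&` U n.+1 @^-1` C) by apply: measurableI => //; exact: mUC.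
pose c i := Lam i j * fine (obs_law j C).
have c0 i : 0 <= c i by rewrite mulr_ge0// fine_ge0// obs_law_ge0.
pose g w : \bar R := (\sum_i (c i)%:E * (\1_(state n i) w)%:E)%E.
have g0 w : (0 <= g w)%E by apply: sume_ge0 => i _; rewrite mule_ge0// lee_fin.
have mg : measurable_fun [set: T] g.
  by apply: emeasurable_sum => i; apply: emeasurable_funM => //; exact: mindic.
have intg B : measurable B -> (\int[P]_(w in B) g w)%E =
    (\sum_i (Lam i j)%:E * (P (B `&` state n i) * obs_law j C))%E.
  move=> mB; rewrite ge0_integral_sum//; last 2 first.
  - by move=> i; apply: emeasurable_funM => //; apply: measurable_funTS; exact: mindic.
  - by move=> i w _; rewrite mule_ge0// lee_fin.
  apply: eq_bigr => i _; rewrite ge0_integralZl_EFin//; last first.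
    by apply: measurable_funTS; exact: mindic.
  rewrite integral_indic// setIC /c EFinM -obs_law_fin// -muleA.
  by rewrite [X in (_ * X)%E]muleC.
have intf B : measurable B ->
    (\int[P]_(w in B) (\1_(state n.+1 j `&` U n.+1 @^-1` C) w)%:E)%E =
    P (B `&` (state n.+1 j `&` U n.+1 @^-1` C)).
  by move=> mB; rewrite integral_indic// setIC.
have fgG B : rects n B ->
    (\int[P]_(w in B) (\1_(state n.+1 j `&` U n.+1 @^-1` C) w)%:E = \int[P]_(w in B) g w)%E.
  move=> rB; rewrite intf ?intg; [|exact: mrects rB|exact: mrects rB].
  case: rB => B' mB' ->; exact: (transition_rect a_inj LS X_chain).
have fin1 : (\int[P]_w (\1_(state n.+1 j `&` U n.+1 @^-1` C) w)%:E < +oo)%E.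
  by rewrite intf// (le_lt_trans (probability_le1 _ _)) ?ltry//; exact: measurableI.
have [mA] := density_unique (mindic mD) mg (@indic_ge0 _) g0 (@rects_setI _ _ _ _ _ _ _ _ _)
  (@mrects n) (rects_setT _ _ _ _ _) fgG fin1 (obs_gen_rects sigma0 gA).
by rewrite intf// intg.
Qed.

(** The defining property of the conditional probability of a state given the first [n]
    observations. *)
Definition posterior_spec n := forall A i, <<s obs_gen n >> A ->
  P (A `&` state n i) = (\int[P]_(w in A) (posterior n w i 0)%:E)%E.

Let p n w : 'cV[R]_d := Lam^T *m posterior n w.

Let pS n w : simplex (p n w).
Proof. by apply: stoch_simplex => //; exact: posterior_simplex. Qed.

Let post0 n w i : 0 <= posterior n w i 0.
Proof. by have [->] := posterior_simplex a LS nuS X h xi sigma n w. Qed.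

Let p0 n w i : 0 <= p n w i 0. Proof. by have [->] := pS n w. Qed.

Let mpost n : measurable_fun [set: T] (posterior n : T -> borel_cV R d).
Proof. by apply: (measurable_posterior a_inj X_chain). Qed.

Let mposti n i : measurable_fun [set: T] (fun w => posterior n w i 0).
Proof. exact: (measurableT_comp (coord_borel_cV i) (mpost n)). Qed.

Let mpi n i : measurable_fun [set: T] (fun w => p n w i 0).
Proof.
apply: (measurableT_comp (coord_borel_cV i)).
exact: (measurableT_comp (measurable_mulmx_borel Lam^T) (mpost n)).
Qed.

Let inner n j C w : measurable C ->
  (\int[gam]_(u in C) (p n w j 0 * weight hv e j u)%:E = (p n w j 0)%:E * obs_law j C)%E.
Proof.
move=> mC; under eq_integral do rewrite EFinM.
rewrite ge0_integralZl_EFin//.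
- by move=> u _; rewrite lee_fin ltW// weight_gt0.
- by apply: measurable_funTS; apply/measurable_EFinP; exact: measurable_weight.
Qed.

Lemma state_obs_law n A j C : posterior_spec n -> <<s obs_gen n >> A -> measurable C ->
  P (A `&` (state n.+1 j `&` U n.+1 @^-1` C)) =
  (\int[P]_(w in A) \int[gam]_(u in C) (p n w j 0 * weight hv e j u)%:E)%E.
Proof.
move=> PP gA mC; have mA := mgen gA; rewrite transition_sigma//.
under [RHS]eq_integral do rewrite inner//.
rewrite (obs_law_fin a h sigma j mC).
set c := fine _; have c0 : 0 <= c by rewrite fine_ge0// obs_law_ge0.
rewrite ge0_integralZr ?lee_fin//; last 2 first.
- by apply: measurable_funTS; apply/measurable_EFinP; exact: mpi.
- by move=> w _; rewrite lee_fin.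
under [in RHS]eq_integral => w _ do rewrite /p mxE -sumEFin.
rewrite ge0_integral_sum//; last 2 first.
- move=> i; apply: measurable_funTS; apply/measurable_EFinP.
  by apply: measurable_funM => //; exact: mposti.
- by move=> i w _; rewrite lee_fin mxE mulr_ge0.
rewrite ge0_sume_distrl; last first.
  by move=> i _; apply: integral_ge0 => w _; rewrite lee_fin mxE mulr_ge0.
apply: eq_bigr => i _; rewrite PP// muleA; congr (_ * _)%E.
under [RHS]eq_integral => w _ do rewrite mxE EFinM.
rewrite ge0_integralZl_EFin//; first by move=> w _; rewrite lee_fin.
by apply: measurable_funTS; apply/measurable_EFinP; exact: mposti.
Qed.

Lemma next_obs_law n A C : posterior_spec n -> <<s obs_gen n >> A -> measurable C ->
  P (A `&` U n.+1 @^-1` C) =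
  (\int[P]_(w in A) \int[gam]_(u in C) (lik hv e (p n w) u)%:E)%E.
Proof.
move=> PP gA mC; have mA := mgen gA.
rewrite (state_partition n.+1); last by apply: measurableI => //; exact: mUC.
under [RHS]eq_integral => w _.
  under eq_integral do rewrite /lik -sumEFin.
  rewrite ge0_integral_sum//; last 2 first.
  - move=> j; apply: measurable_funTS; apply/measurable_EFinP.
    by apply: measurable_funM => //; exact: measurable_weight.
  - by move=> j u _; rewrite lee_fin mulr_ge0// ltW// weight_gt0.
  over.
rewrite ge0_integral_sum//; last 2 first.
- move=> j; under eq_fun do rewrite inner//.
  apply: measurable_funTS; apply: emeasurable_funM => //.
  by apply/measurable_EFinP; exact: mpi.
- move=> j w _; apply: integral_ge0 => u _.
  by rewrite lee_fin mulr_ge0// ltW// weight_gt0.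
by apply: eq_bigr => j _; rewrite -state_obs_law// -setIA [X in _ `&` X]setIC.
Qed.

Let mp_gen n : measurable_fun [set: g_sigma_algebraType (obs_gen n)]
  (p n : g_sigma_algebraType (obs_gen n) -> borel_cV R d).
Proof.
apply: (measurableT_comp (measurable_mulmx_borel Lam^T)).
exact: measurable_posterior_gen.
Qed.

Lemma ge0_integral_next n (f : g_sigma_algebraType (obs_gen n) * R -> \bar R) :
  posterior_spec n -> measurable_fun [set: g_sigma_algebraType (obs_gen n) * R] f ->
  (forall z, (0 <= f z)%E) ->
  (\int[P]_w f (w, U n.+1 w) =
   \int[P]_w \int[gam]_u (f (w, u) * (lik hv e (p n w) u)%:E))%E.
Proof.
move=> PP mf f0.
pose L (z : g_sigma_algebraType (obs_gen n) * R) := lik hv e (p n z.1) z.2.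
have mL : measurable_fun [set: g_sigma_algebraType (obs_gen n) * R] L.
  by apply: measurable_lik_comp => //; exact: (measurableT_comp (@mp_gen n) measurable_fst).
have Lge0 z : 0 <= L z by rewrite ltW// lik_gt0.
have law B C (gB : <<s obs_gen n >> B) (mC : measurable C) := next_obs_law PP gB mC.
exact: (ge0_integral_joint (@mgen n) (mU n.+1) mL Lge0 law mf f0).
Qed.

(** Given the past, state [j] together with the next observation has density
    [p n w j 0 * weight hv e j u], and the observation alone has density [lik]; their quotient is
    the coordinate of Bayes' rule. Rectangles suffice. *)
Lemma posterior_specP n : posterior_spec n.
Proof.
elim: n => [|n IH] A j gA.
  (* At time 0 nothing has been observed and the sigma-algebra is trivial. *)
  have A01 : A = set0 \/ A = [set: T].
    suff : <<s obs_gen 0 >> `<=` [set A | A = set0 \/ A = [set: T]] by apply.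
    apply: smallest_sub; last by move=> B [m /= /andP[]]; case: m.
    split; first by left.
      by move=> B [->|->]; [right; rewrite setD0|left; rewrite setDT].
    move=> F FP; case: (pselect (exists k, F k = [set: T])) => [[k Fk]|nF].
      by right; apply/seteqP; split => // w _; exists k => //; rewrite Fk.
    left; apply/seteqP; split => // w [k _]; case: (FP k) => [->//|Fk].
    by exfalso; apply: nF; exists k.
  case: A01 => ->; first by rewrite set0I measure0 integral_set0.
  rewrite setTI; transitivity (\int[P]_(w in [set: T]) cst (nu j 0)%:E w)%E => //.
  rewrite integral_cst// [X in (_ * X)%E](@probability_setT _ _ _ P) mule1.
  by case: X_chain => _ Xnu _; exact: Xnu.
have mS : measurable (state n.+1 j) by [].
have mpo : measurable_fun [set: T] (fun w => (posterior n.+1 w j 0)%:E).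
  by apply/measurable_EFinP; exact: mposti.
have po0 w : (0 <= (posterior n.+1 w j 0)%:E)%E by rewrite lee_fin; exact: post0.
have fgG B : rects n.+1 B ->
    (\int[P]_(w in B) (\1_(state n.+1 j) w)%:E = \int[P]_(w in B) (posterior n.+1 w j 0)%:E)%E.
  move=> rB; rewrite integral_indic//; last exact: mrects rB.
  case: rB => B' mB' {B}->.
  have -> : rect n.+1 B' = rect n B' `&` U n.+1 @^-1` B' n.+1.
    apply/seteqP; split => w.
      move=> H; split; last by apply: H; rewrite leqnn.
      by move=> m /andP[m1 mn]; apply: H; rewrite m1 leqW.
    move=> [H1 H2] m /andP[m1]; rewrite leq_eqVlt => /orP[/eqP->//|mn].
    by apply: H1; rewrite m1.
  have gr := @rect_obs_gen _ _ _ _ X h xi sigma n _ mB'.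
  rewrite setIC -setIA [X in _ `&` X]setIC; apply: etrans (state_obs_law j IH gr (mB' n.+1)) _.
  pose f (z : g_sigma_algebraType (obs_gen n) * R) : \bar R :=
    (\1_(rect n B') z.1 * \1_(B' n.+1) z.2 * bayes hv e (p n z.1) z.2 j 0)%:E.
  have bg0 w u : 0 <= bayes hv e (p n w) u j 0.
    by have [->] := bayes_simplex hv e u (pS n w).
  have mf : measurable_fun [set: g_sigma_algebraType (obs_gen n) * R] f.
    apply/measurable_EFinP; apply: measurable_funM; first apply: measurable_funM.
    - by apply: measurableT_comp => //; apply: measurable_indic; exact: gr.
    - by apply: measurableT_comp => //; apply: measurable_indic.
    - apply: (measurableT_comp (coord_borel_cV j)).
      by apply: measurable_bayes_comp => //; exact: (measurableT_comp (@mp_gen n) measurable_fst).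
  have f0 z : (0 <= f z)%E by rewrite lee_fin !mulr_ge0.
  transitivity (\int[P]_w f (w, U n.+1 w))%E.
    rewrite ge0_integral_next// integral_mkcond; apply: eq_integral => w _.
    rewrite patchE; case: ifPn => wB.
      rewrite integral_mkcond; apply: eq_integral => u _.
      rewrite patchE /f/= !indicE wB mul1r -EFinM.
      case: ifPn => _; last by rewrite !mul0r.
      by rewrite mul1r [X in _ = (X * _)%:E]mxE divfK// gt_eqF// lik_gt0.
    rewrite integral0_eq// => u _.
    by rewrite /f/= indicE (negbTE wB) !mul0r mul0e.
  rewrite [RHS]integral_mkcond; apply: eq_integral => w _.
  rewrite patchE /f/= !indicE in_setI.
  have -> : (w \in U n.+1 @^-1` B' n.+1) = (U n.+1 w \in B' n.+1).
    by apply/idP/idP => /set_mem H; apply/mem_set.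
  by case: ifP => [/andP[-> ->]|]; rewrite ?mul1r//; do 2! case: (_ \in _); rewrite ?mul0r ?mulr0 ?mul0r.
have fin1 : (\int[P]_w (\1_(state n.+1 j) w)%:E < +oo)%E.
  by rewrite integral_indic// (le_lt_trans (probability_le1 _ _)) ?ltry//; exact: measurableI.
have [mA] := density_unique (mindic mS) mpo (@indic_ge0 _) po0 (@rects_setI _ _ _ _ _ _ _ _ _)
  (@mrects n.+1) (rects_setT _ _ _ _ _) fgG fin1 (obs_gen_rects sigma0 gA).
by rewrite integral_indic// setIC.
Qed.

Definition filter_law n : probability (borel_cV R d) R :=
  distribution P (mfun_Sub (mem_set (mpost n))).

Lemma ge0_integral_filter_law n f : measurable_fun [set: borel_cV R d] f ->
  (forall x, (0 <= f x)%E) ->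
  (\int[filter_law n]_x f x = \int[P]_w f (posterior n w))%E.
Proof. by move=> mf f0; rewrite /filter_law ge0_integral_distribution. Qed.

Lemma filter_law_simplex n : filter_law n (@simplex R d) = 1%E.
Proof.
transitivity (P [set: T]); last exact: probability_setT.
congr (P _); apply/seteqP; split => // w _ /=.
exact: posterior_simplex.
Qed.

(** Given the past, the next observation has density [lik], so the next posterior is drawn from the
    kernel at the present one. *)
Lemma filter_law_chain : filter_chain Lam hv sigma filter_law.
Proof.
move=> n; split; first exact: filter_law_simplex.
move=> A mA.
pose f (z : g_sigma_algebraType (obs_gen n) * R) : \bar R := (\1_A (bayes hv e (p n z.1) z.2))%:E.
have mf : measurable_fun [set: g_sigma_algebraType (obs_gen n) * R] f.
  apply/measurable_EFinP; apply: (measurableT_comp (measurable_indic mA)).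
  by apply: measurable_bayes_comp => //; exact: (measurableT_comp (@mp_gen n) measurable_fst).
have f0 z : (0 <= f z)%E by rewrite lee_fin.
transitivity (\int[P]_w f (w, U n.+1 w))%E.
  rewrite -[A in LHS]setIT -integral_indic// ge0_integral_filter_law//.
  by apply/measurable_EFinP; exact: measurable_indic.
rewrite (ge0_integral_next (@posterior_specP n) mf f0).
rewrite [RHS]integral_mkcond.
have mindA : measurable_fun [set: borel_cV R d] (fun x => (\1_A x : R)%:E : \bar R).
  by apply/measurable_EFinP; exact: measurable_indic.
have ind0 (x : borel_cV R d) : (0 <= (\1_A x : R)%:E :> \bar R)%E by rewrite lee_fin.
pose K (eta : borel_cV R d) : \bar R := (\int[gam]_u ((\1_A (bayes hv e (Lam^T *m eta) u) : R)%:E *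
    (\1_(@simplex R d) eta * lik hv e (Lam^T *m eta) u)%:E))%E.
have mK : measurable_fun [set: borel_cV R d] K.
  exact: (measurable_transition hv sigma LS mindA ind0).
have K0 x : (0 <= K x)%E.
  apply: integral_ge0 => u _; rewrite mule_ge0// lee_fin indicE.
  case: (boolP (x \in _)) => [/set_mem xS|]; last by rewrite mul0r.
  by rewrite mul1r ltW// lik_gt0//; exact: stoch_simplex.
transitivity (\int[filter_law n]_eta K eta)%E.
  rewrite (ge0_integral_filter_law n mK K0).
  apply: eq_integral => w _; apply: eq_integral => u _.
  rewrite [\1_(@simplex R d) _]indicE mem_set ?mul1r//; exact: posterior_simplex.
apply: eq_integral => eta _; rewrite patchE; case: ifPn => [/set_mem etaS|etaS].
  rewrite filter_kernelE//; apply: eq_integral => u _.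
  by rewrite [\1_(@simplex R d) _]indicE (mem_set etaS) mul1r EFinM.
by rewrite /K integral0_eq// => u _; rewrite [\1_(@simplex R d) _]indicE (negbTE etaS) mul0r mule0.
Qed.

End FilterLaw.

(** * Maximal coordinates and the minimal error *)

Section MaxOver.
Context {R : realType} {d : nat}.
Implicit Types (J : set 'I_d) (f g : 'I_d -> R).

Lemma max_over_spec J f : J !=set0 ->
  exists i, [/\ J i, max_over J f = f i & forall j, J j -> f j <= f i].
Proof.
move=> [i0 Ji0].
have Pi0 : i0 \in J by exact: mem_set.
case: (@Order.TotalTheory.arg_maxP _ _ _ i0 (fun i => i \in J) f Pi0) => i /set_mem Ji fi.
have {}fi j : J j -> f j <= f i by move=> Jj; apply: fi; exact: mem_set.
exists i; split => //; apply/eqP; rewrite eq_le; apply/andP; split.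
  by apply: ge_sup; [exists (f i), i|move=> _ [j Jj <-]; exact: fi].
apply: ub_le_sup; last by exists i.
by exists (f i) => _ [j Jj <-]; exact: fi.
Qed.

Lemma le_max_over J f j : J j -> f j <= max_over J f.
Proof.
by move=> Jj; have [|i [_ -> h]] := @max_over_spec J f; [exists j|exact: h].
Qed.

Lemma max_over_eq J f i : J i -> (forall j, J j -> f j <= f i) -> max_over J f = f i.
Proof.
move=> Ji fi; have [|k [Jk kE fk]] := @max_over_spec J f; first by exists i.
by rewrite kE; apply/eqP; rewrite eq_le fi// fk.
Qed.

Lemma max_overZ J c f : J !=set0 -> 0 <= c ->
  max_over J (fun i => c * f i) = c * max_over J f.
Proof.
move=> J0 c0; have [i [Ji iE fi]] := @max_over_spec J f J0.
by rewrite iE; apply: max_over_eq => // j Jj; rewrite ler_wpM2l// fi.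
Qed.

Lemma max_over1 i f : max_over [set i] f = f i.
Proof. by apply: max_over_eq => // j ->. Qed.

Lemma max_over_sub J f g (c : R) : J !=set0 -> (forall i, `|f i - g i| <= c) ->
  `|max_over J f - max_over J g| <= c.
Proof.
move=> J0 fg.
have [i [Ji iE fi]] := @max_over_spec J f J0.
have [k [Jk kE gk]] := @max_over_spec J g J0.
rewrite iE kE ler_norml; have := fg i; have := fg k; have := fi k Jk; have := gk i Ji.
rewrite !ler_norml => h1 h2 /andP[h3 h4] /andP[h5 h6]; apply/andP; split; lra.
Qed.

Lemma continuous_max_over J : J !=set0 ->
  continuous (fun x : 'cV[R]_d => max_over J (fun i => x i 0)).
Proof.
move=> J0 x.
have h : (fun y : 'cV[R]_d => l1norm (y - x)) @ x --> l1norm (x - x).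
  apply: (@cvg_finsum R _ _ (nbhs x) _ _ (fun i (y : 'cV[R]_d) => `|(y - x) i 0|)) => i.
  apply: (@cvg_norm _ R^o); under eq_fun do rewrite !mxE; rewrite !mxE.
  by apply: (@cvgB _ R^o); [exact: coord_cvg|exact: cvg_cst].
apply/(@cvgrPdist_le _ _ _ (nbhs x) _) => eps eps0.
move/(@cvgrPdist_le _ _ _ (nbhs x) _) : h => /(_ _ eps0); apply: filterS => y.
rewrite subrr l1norm0 sub0r normrN (ger0_norm (l1norm_ge0 _)) => h.
rewrite distrC; apply: max_over_sub => // i; apply: le_trans h.
by apply: le_trans (coord_l1norm (y - x) i); rewrite !mxE.
Qed.

Lemma max_over_l1norm J (x : 'cV[R]_d) : J !=set0 ->
  `|max_over J (fun i => x i 0)| <= l1norm x.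
Proof.
move=> J0; have [i [Ji -> _]] := @max_over_spec J (fun i => x i 0) J0.
exact: coord_l1norm.
Qed.

Lemma simplex_setT (x : 'cV[R]_d) : simplex x -> [set: 'I_d] !=set0.
Proof.
move=> [_ x1]; case: (pselect ([set: 'I_d] !=set0)) => // h.
move: x1; rewrite big1 => [/eqP|i _]; first by rewrite eq_sym oner_eq0.
by exfalso; apply: h; exists i.
Qed.

End MaxOver.

(** * Optimality of the maximum a posteriori estimate *)

Section MinError.
Context {R : realType} {d : nat} (a : 'I_d -> R) (a_inj : injective a).
Context (Lam : 'M[R]_d) (LS : stochastic_mx Lam) (nu : 'cV[R]_d) (nuS : simplex nu).
Context {dT : measure_display} {T : measurableType dT} (P : probability T R).
Context (X : nat -> {RV P >-> R}) (X_chain : markov_chain a Lam nu X).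
Context (h : R -> R).
Context (xi : nat -> {RV P >-> R}) (xi_noise : std_gaussian_noise xi).
Context (xi_X_indep : indep_processes P [set: nat] X [set m | (1 <= m)%N] xi).
Context (sigma : R) (sigma0 : 0 < sigma).

Let hv : 'cV[R]_d := \col_i h (a i).
Local Notation state := (state a X).
Local Notation obs_gen := (obs_gen X h xi sigma).
Local Notation posterior := (posterior a Lam nu X h xi sigma).
Local Notation law := (filter_law a_inj X_chain h xi sigma0).

Let mstate n i : measurable (state n i).
Proof. exact: measurable_state. Qed.

Let mgen n A : <<s obs_gen n >> A -> measurable A.
Proof. exact: (obs_gen_measurable a_inj X_chain sigma0). Qed.

Let mpost n : measurable_fun [set: T] (posterior n : T -> borel_cV R d).
Proof. by apply: (measurable_posterior a_inj X_chain). Qed.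

Let J0 : [set: 'I_d] !=set0 := simplex_setT nuS.

Let postS n w : simplex (posterior n w).
Proof. exact: posterior_simplex. Qed.

Let post0 n w i : 0 <= posterior n w i 0.
Proof. by have [->] := postS n w. Qed.

Definition max_coord (x : 'cV[R]_d) : R := max_over [set: 'I_d] (fun i => x i 0).

Lemma simplex_bounded_max_coord : simplex_bounded max_coord.
Proof.
apply: simplex_bounded_continuous; first exact: continuous_max_over.
by exists 1 => eta etaS; rewrite (le_trans (max_over_l1norm _ J0))// simplex_l1norm.
Qed.

Let g n w : \bar R := (max_coord (posterior n w))%:E.

Let post_le_max n w i : posterior n w i 0 <= max_coord (posterior n w).
Proof. exact: (@le_max_over _ _ [set: 'I_d] (fun i => posterior n w i 0)). Qed.

Let g0 n w : (0 <= g n w)%E.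
Proof. by case: J0 => i _; rewrite lee_fin (le_trans (post0 n w i)). Qed.

Let mposti n i : measurable_fun [set: T] (fun w => posterior n w i 0).
Proof. exact: (measurableT_comp (coord_borel_cV i) (mpost n)). Qed.

Let mg n : measurable_fun [set: T] (g n).
Proof.
apply/measurable_EFinP.
exact: (measurableT_comp (continuous_borel_cV (continuous_max_over J0)) (mpost n)).
Qed.

Lemma integral_max_posterior n : (\int[P]_w g n w = (expS (law n) max_coord)%:E)%E.
Proof.
have bm := simplex_bounded_max_coord; have [mm _] := bm.
have mS : law n (@simplex R d) = 1%E by exact: filter_law_simplex.
pose f := (EFin \o max_coord) \_ (@simplex R d).
have mf : measurable_fun [set: borel_cV R d] f.
  apply/(measurable_restrictT _ _).1; first exact: measurable_simplex.
  exact/measurable_EFinP.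
have f0 x : (0 <= f x)%E.
  rewrite /f patchE; case: ifPn => // /set_mem xS.
  have [i _] := J0; rewrite lee_fin; have [xi0 _] := xS.
  by apply: le_trans (xi0 i) _; exact: (@le_max_over _ _ [set: 'I_d] (fun i => x i 0)).
rewrite expS_fin// [RHS]integral_mkcond; apply/esym.
apply: etrans (ge0_integral_filter_law a_inj X_chain h xi sigma0 n mf f0) _.
by apply: eq_integral => w _; rewrite /f patchE mem_set.
Qed.

Let sum_restrict n (D : 'I_d -> set T) : (forall i, measurable (D i)) ->
  (\sum_i \int[P]_(w in D i) g n w = \int[P]_w \sum_i (g n \_ (D i)) w)%E.
Proof.
move=> mD; rewrite ge0_integral_sum//; last 2 first.
- by move=> i; apply/(measurable_restrictT _ _).1 => //; exact: measurable_funTS.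
- by move=> i w _; rewrite patchE; case: ifP.
by apply: eq_bigr => i _; rewrite [LHS]integral_mkcond.
Qed.

(** Split according to the state: [theta = a i] is an observable event, on which the probability of
    state [i] is the integral of its posterior probability. *)
Let correct n (theta : T -> R) : (forall B, measurable B -> <<s obs_gen n >> (theta @^-1` B)) ->
  measurable [set w | X n w = theta w] /\
  P [set w | X n w = theta w] =
    (\sum_i \int[P]_(w in theta @^-1` [set a i]) (posterior n w i 0)%:E)%E.
Proof.
move=> mth.
have Hi i : [set w | X n w = theta w] `&` state n i = theta @^-1` [set a i] `&` state n i.
  apply/seteqP; split => w [/= H1 H2]; split => //=.
    by rewrite -H1; exact: H2.
  by rewrite H1; exact: H2.
have mtha i : measurable (theta @^-1` [set a i]) by apply: mgen; exact: mth.
have mH : measurable [set w | X n w = theta w].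
  rewrite (_ : [set w | _] = \bigcup_(i in [set: 'I_d]) (theta @^-1` [set a i] `&` state n i)).
    by apply: fin_bigcup_measurable => // i _; exact: measurableI.
  apply/seteqP; split => w.
    by move=> H; have [i Xi] := state_exists X_chain n w; exists i => //; rewrite -Hi.
  by move=> [i _]; rewrite -Hi => -[].
split => //; rewrite (state_partition a_inj X_chain n)//; apply: eq_bigr => i _.
rewrite Hi; apply: (posterior_specP a_inj LS nuS X_chain xi_noise xi_X_indep sigma0).
exact: mth.
Qed.

(** The events [theta = a i] are disjoint, and on each of them the integrand is at most the largest
    posterior coordinate. *)
Let correct_le n (theta : T -> R) :
  (forall B, measurable B -> <<s obs_gen n >> (theta @^-1` B)) ->
  (P [set w | X n w = theta w] <= (expS (law n) max_coord)%:E)%E.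
Proof.
move=> mth; have [_ ->] := correct mth.
have mtha i : measurable (theta @^-1` [set a i]) by apply: mgen; exact: mth.
rewrite -integral_max_posterior.
apply: (@le_trans _ _ (\sum_i \int[P]_(w in theta @^-1` [set a i]) g n w)%E).
  apply: lee_sum => i _; apply: ge0_le_integral => //.
  - by move=> w _; rewrite lee_fin.
  - by apply: measurable_funTS; apply/measurable_EFinP; exact: mposti.
  - exact: measurable_funTS.
  - by move=> w _; rewrite lee_fin.
rewrite sum_restrict//; apply: ge0_le_integral => //.
- by move=> w _; apply: sume_ge0 => i _; rewrite patchE; case: ifP.
- by apply: emeasurable_sum => i; apply/(measurable_restrictT _ _).1 => //; exact: measurable_funTS.
move=> w _; case: (pselect (exists i, theta w = a i)) => [[i ti]|nt].
  rewrite (bigD1 i)//= big1 ?adde0 => [|j ji]; first by rewrite patchE; case: ifP.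
  rewrite patchE memNset// => /= tj; move/eqP: ji; apply; apply: a_inj.
  by rewrite -tj.
rewrite big1 => [|i _]; first exact: g0.
by rewrite patchE memNset// => /= ti; apply: nt; exists i.
Qed.

(** Ties go to the smallest index, which makes these events disjoint while they remain
    observable. *)
Let first_max n (i : 'I_d) : set T :=
  [set w | forall j, posterior n w j 0 <= posterior n w i 0 /\
     ((j < i)%N -> posterior n w j 0 < posterior n w i 0)].

Let first_max_exists n w : exists i, first_max n i w.
Proof.
have [i0 [_ _ i0max]] := @max_over_spec _ _ [set: 'I_d] (fun i => posterior n w i 0) J0.
pose Q (i : 'I_d) := [forall j, posterior n w j 0 <= posterior n w i 0].
have Q0 : Q i0 by apply/forallP => j; exact: i0max.
case: (@arg_minnP _ i0 Q (fun i => i : nat) Q0) => i /forallP Qi imin.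
exists i => j; split; first exact: Qi.
move=> ji; rewrite lt_neqAle Qi andbT; apply/eqP => E.
suff /imin : Q j by rewrite leqNgt ji.
by apply/forallP => k; rewrite E.
Qed.

Let first_max_unique n w i j : first_max n i w -> first_max n j w -> i = j.
Proof.
move=> Hi Hj; apply: val_inj; case: (ltngtP i j) => // ij.
  by have := (Hj i).2 ij; rewrite ltNge (Hi j).1.
by have := (Hi j).2 ij; rewrite ltNge (Hj i).1.
Qed.

Let first_max_gen n i : <<s obs_gen n >> (first_max n i).
Proof.
pose Tn := g_sigma_algebraType (obs_gen n).
have mp j : measurable_fun [set: Tn] (fun w => posterior n w j 0).
  apply: (measurableT_comp (coord_borel_cV j)).
  exact: measurable_posterior_gen.
suff : @measurable _ Tn (first_max n i) by [].
rewrite (_ : first_max n i = \bigcap_(j in [set: 'I_d])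
    ([set w | posterior n w j 0 <= posterior n w i 0] `&`
     [set w | (j < i)%N -> posterior n w j 0 < posterior n w i 0])); last first.
  by apply/seteqP; split => w H j; have := H j => // /(_ Logic.I).
apply: fin_bigcap_measurable => // j _; apply: measurableI.
  have := measurable_fun_ler (mp j) (mp i) measurableT (Y := [set true]).
  by rewrite setTI; apply.
have [ji|ji] := boolP (j < i)%N.
  have := measurable_fun_ltr (mp j) (mp i) measurableT (Y := [set true]).
  rewrite setTI => /(_ Logic.I).
  rewrite (_ : _ @^-1` _ = [set w | true -> posterior n w j 0 < posterior n w i 0])//.
  by apply/seteqP; split => w /=; [move=> ->|move=> ->].
rewrite (_ : [set w | _] = setT)//.
by apply/seteqP; split.
Qed.

Let map_estimate n w : R := \sum_i (a i * \1_(first_max n i) w).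

Let map_estimateE n w i : first_max n i w -> map_estimate n w = a i.
Proof.
move=> wi; rewrite /map_estimate (bigD1 i)//= big1 ?addr0 => [|j ji].
  by rewrite indicE mem_set// mulr1.
rewrite indicE memNset ?mulr0// => wj.
by move/eqP: ji; apply; exact: first_max_unique wj wi.
Qed.

Let map_estimate_gen n B : measurable B -> <<s obs_gen n >> (map_estimate n @^-1` B).
Proof.
move=> mB; pose Tn := g_sigma_algebraType (obs_gen n).
have mm : measurable_fun [set: Tn] (map_estimate n).
  apply: measurable_sum => i; apply: measurable_funM => //.
  by apply: measurable_indic; exact: first_max_gen.
have : @measurable _ Tn (map_estimate n @^-1` B) by rewrite -[X in measurable X]setTI; exact: mm.
by [].
Qed.

Let map_estimate_bounded n : [bounded map_estimate n w | w in [set: T]].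
Proof.
exists (\sum_i `|a i|); split; first by rewrite num_real.
move=> M hM w _ /=; rewrite (le_trans _ (ltW hM))//.
have [i wi] := first_max_exists n w; rewrite (map_estimateE wi).
by rewrite (bigD1 i)//= lerDl sumr_ge0.
Qed.

Let map_estimate_correct n :
  P [set w | X n w = map_estimate n w] = (expS (law n) max_coord)%:E.
Proof.
have [_ ->] := correct (@map_estimate_gen n).
have E i : map_estimate n @^-1` [set a i] = first_max n i.
  apply/seteqP; split => w /=; last exact: map_estimateE.
  have [j wj] := first_max_exists n w; rewrite (map_estimateE wj) => /a_inj <-.
  exact: wj.
rewrite -integral_max_posterior.
transitivity (\sum_i \int[P]_(w in first_max n i) g n w)%E.
  apply: eq_bigr => i _; rewrite E; apply: eq_integral => w /set_mem wi.
  congr EFin; apply/esym; apply: (@max_over_eq _ _ [set: 'I_d] (fun i => posterior n w i 0)) => //.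
  by move=> j _; exact: (wi j).1.
rewrite sum_restrict; last by move=> i; apply: mgen; exact: first_max_gen.
apply: eq_integral => w _; have [i wi] := first_max_exists n w.
rewrite (bigD1 i)//= big1 ?adde0 => [|j ji]; first by rewrite patchE mem_set.
rewrite patchE memNset// => wj.
by move/eqP: ji; apply; exact: first_max_unique wj wi.
Qed.

(** The bound on the probability of a correct decision holds for every observable estimator and is
    attained by [map_estimate]. *)
Lemma min_errorE n :
  min_error P X (obs h sigma X xi) n = 1 - expS (law n) max_coord.
Proof.
have err (theta : T -> R) : (forall B, measurable B -> <<s obs_gen n >> (theta @^-1` B)) ->
    P [set w | X n w <> theta w] = (1 - P [set w | X n w = theta w])%E.
  by move=> mth; have [mH _] := correct mth; rewrite -probability_setC.
rewrite /min_error; set S := [set fine _ | _ in _].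
have S1 : S (1 - expS (law n) max_coord).
  exists (map_estimate n); last by rewrite (err _ (@map_estimate_gen n)) map_estimate_correct.
  by split; [exact: map_estimate_bounded|exact: map_estimate_gen].
have lb : lbound S (1 - expS (law n) max_coord).
  move=> _ [theta [_ mth] <-].
  have := correct_le mth; rewrite err//.
  have [mH _] := correct mth.
  rewrite -(fineK (fin_num_measure P _ mH)) lee_fin -EFinB/= => ?; lra.
apply/eqP; rewrite eq_le; apply/andP; split.
  by apply: ge_inf => //; exists (1 - expS (law n) max_coord).
by apply: lb_le_inf => //; exists (1 - expS (law n) max_coord).
Qed.

End MinError.

Lemma cvg_pinfty_dist_le {R : realType} (f : R -> R) (l : R) :
  (forall delta, 0 < delta -> exists s0, forall s, s0 <= s -> `|f s - l| <= delta) ->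
  f s @[s --> +oo] --> l.
Proof.
move=> fl; apply/cvgrPdist_le => delta delta0.
have [s0 Hs0] := fl delta delta0.
have : \forall s \near +oo, s0 <= s by apply: nbhs_pinfty_ge; rewrite num_real.
by apply: filterS => s s0s; rewrite distrC; exact: Hs0.
Qed.

Lemma cvgn_dist_le {R : realType} (u : nat -> R) (l c delta : R) :
  u n @[n --> \oo] --> l -> (exists N, forall n, (N <= n)%N -> `|u n - c| <= delta) ->
  `|l - c| <= delta.
Proof.
move=> ul [N HN].
have uc : `|u n - c| @[n --> \oo] --> `|l - c|.
  by apply: cvg_norm; apply: cvgB => //; exact: cvg_cst.
rewrite -(cvg_lim _ uc)//; apply: limr_le; first by apply/cvg_ex; exists `|l - c|.
by exists N => // n /= Nn; exact: HN.
Qed.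

(** * Linearization of the maximal coordinate around [mu] *)

Section MaximalAtoms.
Context {R : realType} {d : nat}.
Variable mu : 'cV[R]_d.
Hypothesis muS : simplex mu.
Let J := maximal_atoms mu.
Let dne : [set: 'I_d] !=set0 := simplex_setT muS.

Lemma maximal_atoms_neq0 : J !=set0.
Proof. by have [i [_ iE _]] := @max_over_spec _ _ _ (fun i => mu i 0) dne; exists i. Qed.

Lemma maximal_atoms_gap : exists2 g, 0 < g & forall i, ~ J i -> mu i 0 <= max_coord mu - g.
Proof.
case: (pselect ((~` J) !=set0)) => [nJ|nJ]; last first.
  (* All atoms are maximal, so any positive gap will do. *)
  by exists 1 => // i Ji; exfalso; apply: nJ; exists i.
have [k [kJ kE kmax]] := @max_over_spec _ _ _ (fun i => mu i 0) nJ.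
have le_mu i : mu i 0 <= max_coord mu by exact: (@le_max_over _ _ [set: 'I_d] (fun i => mu i 0)).
exists (max_coord mu - mu k 0); last by move=> i Ji; rewrite subKr; exact: kmax.
rewrite subr_gt0 lt_neqAle le_mu andbT; apply/eqP => E; exact: kJ.
Qed.

(* If |x| is less than half of s times the gap then the maximum is attained in J and both
   sides agree; otherwise the ratio on the right is at least 1. *)
Lemma max_coord_linearize : exists2 c, 0 <= c & forall q (s : R) (x : 'cV[R]_d), 0 < s ->
  `|max_coord (s *: mu + x) - s * max_coord mu - max_over J (fun i => x i 0)| <=
  2 * c ^+ q * s^-1 ^+ q * (1 + l1norm x) ^+ q.+1.
Proof.
have [g g0 gap] := maximal_atoms_gap.
exists (2 / g); first by rewrite divr_ge0 ?(ltW g0).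
move=> q s x s0; set c := 2 / g.
have x0 := l1norm_ge0 x.
have c0 : 0 < c by rewrite divr_gt0.
have [small|large] := leP (2 * l1norm x) (s * g).
  rewrite [X in `|X|](_ : _ = 0) ?normr0; last first.
    have [k [kJ kE kmax]] := @max_over_spec _ _ _ (fun i => x i 0) maximal_atoms_neq0.
    have kmu : mu k 0 = max_coord mu by exact: kJ.
    rewrite kE /max_coord (@max_over_eq _ _ _ _ k)//.
      by rewrite !mxE kmu /max_coord; ring.
    move=> i _; rewrite !mxE kmu.
    case: (pselect (J i)) => Ji.
      have -> : mu i 0 = max_coord mu by exact: Ji.
      by rewrite lerD2l kmax.
    have := gap i Ji; rewrite -(ler_pM2l s0) mulrBr => h.
    have := coord_l1norm x i; have := coord_l1norm x k; rewrite !ler_norml => /andP[h1 h2] /andP[h3 h4].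
    lra.
  by rewrite !mulr_ge0// ?exprn_ge0 ?invr_ge0 ?(ltW s0) ?(ltW c0) ?addr_ge0.
have bound : `|max_coord (s *: mu + x) - s * max_coord mu - max_over J (fun i => x i 0)| <=
    2 * l1norm x.
  rewrite mulr2n mulrDl mul1r (le_trans (ler_normB _ _))// lerD//.
    rewrite /max_coord -max_overZ//; last exact: ltW.
    by apply: max_over_sub => // i; rewrite !mxE addrAC subrr add0r; exact: coord_l1norm.
  exact: max_over_l1norm maximal_atoms_neq0.
apply: le_trans bound _.
have r1 : 1 <= c * s^-1 * (1 + l1norm x).
  have -> : c * s^-1 * (1 + l1norm x) = (2 * (1 + l1norm x)) / (s * g).
    by rewrite /c; field; rewrite !gt_eqF.
  by rewrite ler_pdivlMr ?mulr_gt0// mul1r; lra.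
have -> : 2 * c ^+ q * s^-1 ^+ q * (1 + l1norm x) ^+ q.+1 =
    2 * (1 + l1norm x) * (c * s^-1 * (1 + l1norm x)) ^+ q.
  by rewrite !exprMn exprS; ring.
apply: (@le_trans _ _ (2 * (1 + l1norm x))); first lra.
by rewrite ler_peMr ?exprn_ege1//; lra.
Qed.

Lemma poly_growth_max_over (K : set 'I_d) : K !=set0 ->
  poly_growth (fun x : 'cV[R]_d => max_over K (fun i => x i 0)).
Proof.
move=> K0; exists 1, 1%N => x; rewrite mul1r expr1.
by rewrite (le_trans (max_over_l1norm _ K0))// lerDr.
Qed.

Variables (Lam : 'M[R]_d) (hv : 'cV[R]_d).
Hypotheses (LS : stochastic_mx Lam) (LE : ergodic Lam) (muI : invariant_distr Lam mu).

(** The linearization error is [sigma^-1 ^+ q] times a moment of order [q.+1]; since moments of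
    every order are bounded uniformly, any power of [sigma] can be gained. *)
Lemma chain_max_coord q : exists2 C, 0 <= C & forall sigma, 1 <= sigma -> exists N : nat,
  forall m, filter_chain Lam hv sigma m -> forall n, (N <= n)%N ->
  `|expS (m n) (fun eta => sigma * (max_coord eta - max_coord mu)) -
    expS (m n) (fun eta => max_over J (fun i => (sigma *: (eta - mu)) i 0))| <=
  C * sigma^-1 ^+ q.
Proof.
have [c c0 lin] := max_coord_linearize.
have [C0 HC0] := chain_moments hv LS LE muI q.+1.
exists (2 * c ^+ q * Num.max C0 0).
  by rewrite mulr_ge0 ?mulr_ge0 ?exprn_ge0// le_max lexx orbT.
move=> sigma s1; have s0 : 0 < sigma by exact: lt_le_trans s1.
have [N HN] := HC0 _ s1; exists N => m mc n Nn.
have [mS _] := mc n.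
have bpow : simplex_bounded (fun eta : 'cV[R]_d => (1 + l1norm (sigma *: (eta - mu))) ^+ q.+1).
  apply: (@simplex_bounded_centered _ _ sigma mu (fun x => (1 + l1norm x) ^+ q.+1)) => //.
  - exact: ltW.
  - by apply: continuous_pow; exact: continuous_one_plus_l1norm.
  - exact: poly_growth_pow.
have bJ : simplex_bounded (fun eta : 'cV[R]_d => max_over J (fun i => (sigma *: (eta - mu)) i 0)).
  apply: (@simplex_bounded_centered _ _ sigma mu (fun x => max_over J (fun i => x i 0))) => //.
  - exact: ltW.
  - exact: continuous_max_over maximal_atoms_neq0.
  - exact: poly_growth_max_over maximal_atoms_neq0.
have bM : simplex_bounded (fun eta : 'cV[R]_d => sigma * (max_coord eta - max_coord mu)).
  apply: simplex_boundedZ; apply: simplex_boundedB; last exact: simplex_bounded_cst.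
  exact: simplex_bounded_max_coord muS.
have bh := simplex_boundedZ (2 * c ^+ q * sigma^-1 ^+ q) bpow.
apply: le_trans (expS_dist (m n) bM bJ bh _) _ => [eta etaS|].
  have := lin q sigma (sigma *: (eta - mu)) s0.
  rewrite -scalerDr (addrC mu) subrK.
  have -> : max_coord (sigma *: eta) = sigma * max_coord eta.
    rewrite /max_coord -max_overZ ?(ltW s0)//.
    by congr max_over; apply/funext => i; rewrite mxE.
  by rewrite mulrBr.
rewrite expSZ// mulrAC -!mulrA ler_wpM2l// ler_wpM2l ?exprn_ge0//.
rewrite ler_wpM2r ?exprn_ge0 ?invr_ge0 ?(ltW s0)//.
by rewrite le_max HN.
Qed.

End MaximalAtoms.

Section ChainMean.
Context {R : realType} {d : nat}.
Variables (Lam : 'M[R]_d) (hv mu : 'cV[R]_d) (sigma : R).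
Hypotheses (LS : stochastic_mx Lam) (LE : ergodic Lam) (muI : invariant_distr Lam mu).
Hypothesis sigma0 : 0 < sigma.
Variable m : nat -> probability (borel_cV R d) R.
Hypothesis mc : filter_chain Lam hv sigma m.

Let mean n : 'cV[R]_d := \col_i expS (m n) (fun eta => eta i 0).

Let bcoord (i : 'I_d) : simplex_bounded (fun eta : 'cV[R]_d => eta i 0).
Proof.
apply: simplex_bounded_continuous; first exact: coord_cvg.
exists 1 => eta etaS; rewrite (le_trans (coord_l1norm _ _))//.
by rewrite simplex_l1norm.
Qed.

Let bcomb (c : 'I_d -> R) (s : seq 'I_d) :
  simplex_bounded (fun eta : 'cV[R]_d => \sum_(i <- s) c i * eta i 0).
Proof.
elim: s => [|i s IH].
  by under eq_fun do rewrite big_nil; exact: simplex_bounded_cst.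
under eq_fun do rewrite big_cons; apply: simplex_boundedD => //.
exact: simplex_boundedZ.
Qed.

Let expS_comb n (c : 'I_d -> R) (s : seq 'I_d) :
  expS (m n) (fun eta : 'cV[R]_d => \sum_(i <- s) c i * eta i 0) =
  \sum_(i <- s) c i * expS (m n) (fun eta : 'cV[R]_d => eta i 0).
Proof.
have [mS _] := mc n; elim: s => [|i s IH].
  by under [X in expS _ X]eq_fun do rewrite big_nil; rewrite big_nil expS_cst.
under [X in expS _ X]eq_fun do rewrite big_cons.
rewrite big_cons expSD ?IH ?expSZ//; exact: simplex_boundedZ.
Qed.

(** Averaged against the likelihood, the posterior returns the prior, so the mean follows the linear
    dynamics of the unobserved chain. *)
Lemma chain_mean_step n : mean n.+1 = Lam^T *m mean n.
Proof.
have [mS mSt] := mc n; have [mS' _] := mc n.+1.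
apply/colP => j; rewrite !mxE.
rewrite (expS_transition LS sigma0 mS mS' mSt)//.
transitivity (expS (m n) (fun eta : 'cV[R]_d => \sum_i Lam i j * eta i 0)).
  apply: eq_expS => eta etaS; rewrite /Kop.
  have pS := stoch_simplex LS etaS.
  transitivity (gE (fun u => (Lam^T *m eta) j 0 * weight hv sigma^-1 j u)).
    by congr gE; apply/funext => u; rewrite [X in X * _]mxE divfK// gt_eqF// lik_gt0.
  rewrite gEZ ?gE_weight ?mulr1; last exact: subexp_weight.
  by rewrite mxE; apply: eq_bigr => i _; rewrite mxE.
by rewrite expS_comb; apply: eq_bigr => i _; rewrite !mxE.
Qed.

Lemma chain_mean_simplex n : simplex (mean n).
Proof.
have [mS _] := mc n; split => [i|].
  by rewrite mxE; apply: expS_ge0 => eta [eta0 _].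
transitivity (expS (m n) (fun eta : 'cV[R]_d => \sum_i 1 * eta i 0)).
  by rewrite expS_comb; apply: eq_bigr => i _; rewrite mxE mul1r.
transitivity (expS (m n) (fun=> 1)); last exact: expS_cst.
apply: eq_expS => eta [_ eta1]; rewrite -[RHS]eta1.
by apply: eq_bigr => i _; rewrite mul1r.
Qed.

Lemma chain_mean_cvg i : expS (m n) (fun eta => eta i 0) @[n --> \oo] --> mu i 0.
Proof.
have meanE n : mean n = Lam^T ^+ n *m mean 0.
  elim: n => [|n IH]; first by rewrite expr0 mul1mx.
  by rewrite chain_mean_step IH exprS mulmxA.
have [mu' [_ lim']] := LE; have [muS _] := muI.
have <- : mu' i 0 = mu i 0.
  have := lim' _ muS i; under eq_fun do rewrite invariant_iter//.
  by move=> /(cvg_unique _); apply => //; exact: cvg_cst.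
have := lim' _ (chain_mean_simplex 0) i.
by under eq_fun do rewrite -meanE mxE.
Qed.

End ChainMean.

(** * Asymptotics of the error probability *)

Section ErrorGap.
Context {R : realType} {d : nat} (a : 'I_d -> R) (a_inj : injective a).
Context (Lam : 'M[R]_d) (LS : stochastic_mx Lam) (LE : ergodic Lam).
Context (nu mu : 'cV[R]_d) (nuS : simplex nu) (muI : invariant_distr Lam mu).
Context {dT : measure_display} {T : measurableType dT} (P : probability T R).
Context (X : nat -> {RV P >-> R}) (X_chain : markov_chain a Lam nu X).
Context (h : R -> R).
Context (xi : nat -> {RV P >-> R}) (xi_noise : std_gaussian_noise xi).
Context (xi_X_indep : indep_processes P [set: nat] X [set m | (1 <= m)%N] xi).
Context (Perr : R -> R).
Hypothesis Perr_lim : forall sigma : R, 0 < sigma ->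
  min_error P X (obs h sigma X xi) n @[n --> \oo] --> Perr sigma.

Let hv : 'cV[R]_d := \col_i h (a i).
Let muS : simplex mu. Proof. by case: muI. Qed.
Local Notation J := (maximal_atoms mu).
Local Notation law := (filter_law a_inj X_chain h xi).
Local Notation maxJ := (fun x : 'cV[R]_d => max_over J (fun i => x i 0)).

Let J0 : J !=set0 := maximal_atoms_neq0 muS.

Lemma error_gap_cvg sigma (s0 : 0 < sigma) :
  expS (law s0 n) (fun eta => sigma * (max_coord eta - max_coord mu)) @[n --> \oo] -->
  sigma * (prior_error mu - Perr sigma).
Proof.
have bm := simplex_bounded_max_coord nuS.
have E n : expS (law s0 n) (fun eta => sigma * (max_coord eta - max_coord mu)) =
    sigma * (prior_error mu - min_error P X (obs h sigma X xi) n).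
  have mS : law s0 n (@simplex R d) = 1%E by exact: filter_law_simplex.
  have bc := @simplex_bounded_cst R d (max_coord mu).
  rewrite expSZ//; last exact: simplex_boundedB.
  rewrite expSB// expS_cst// (min_errorE a_inj LS nuS X_chain h xi_noise xi_X_indep s0).
  by rewrite /prior_error -/(max_coord mu); ring.
under eq_fun do rewrite E.
by apply: cvgMr; apply: cvgB; [exact: cvg_cst|exact: Perr_lim].
Qed.

(** The time [n] goes to infinity first, at fixed [sigma]. Linearization with [q = 1] leaves an
    error of order [1 / sigma]. *)
Lemma error_gap_chain_limit L : chain_limit Lam hv mu maxJ L ->
  sigma * (prior_error mu - Perr sigma) @[sigma --> +oo] --> L.
Proof.
move=> JL; apply: cvg_pinfty_dist_le => delta delta0.
have delta2 : 0 < delta / 2 by rewrite divr_gt0.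
have [s1 s1_ge1 Hs1] := JL _ delta2.
have [C C0 HC] := chain_max_coord muS hv LS LE muI 1.
exists (Num.max s1 (2 * C / delta)) => sigma; rewrite ge_max => /andP[s1s Cs].
have sge1 := le_trans s1_ge1 s1s.
have s0 : 0 < sigma by exact: lt_le_trans sge1.
have [N1 HN1] := Hs1 _ s1s; have [N2 HN2] := HC _ sge1.
have mc : filter_chain Lam hv sigma (law s0) by exact: filter_law_chain.
apply: (cvgn_dist_le (error_gap_cvg s0)); exists (maxn N1 N2) => n.
rewrite geq_max => /andP[n1 n2].
have e1 := HN1 _ mc _ n1; have e2 := HN2 _ mc _ n2.
have e3 : C * sigma^-1 ^+ 1 <= delta / 2.
  rewrite expr1 ler_pdivrMr// mulrAC ler_pdivlMr// [delta * _]mulrC -ler_pdivrMr//.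
  by rewrite [C * 2]mulrC.
rewrite [delta]splitr -(subrKA (expS (law s0 n) (fun eta => maxJ (sigma *: (eta - mu))))).
by apply: le_trans (ler_normD _ _) _; apply: lerD => //; exact: le_trans e2 e3.
Qed.

(** With one maximal atom the linear term is a single coordinate of the deviation. Its mean vanishes
    as [n] grows, so only the linearization error is left. *)
Lemma error_gap_superpolynomial (p : nat) : (exists i, J = [set i]) -> (1 <= p)%N ->
  sigma ^+ p * (prior_error mu - Perr sigma) @[sigma --> +oo] --> (0 : R).
Proof.
move=> [i Ji]; case: p => // p _; apply: cvg_pinfty_dist_le => delta delta0.
(* The target power is now [p.+1], one factor of which belongs to the rescaled gap; linearizing with
   [q = p.+1] leaves [C / sigma]. *)
have [C C0 HC] := chain_max_coord muS hv LS LE muI p.+1.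
exists (Num.max 1 (C / delta)) => sigma; rewrite ge_max => /andP[s1 Cs].
have s0 : 0 < sigma by exact: lt_le_trans s1.
have [N HN] := HC _ s1.
have mc : filter_chain Lam hv sigma (law s0) by exact: filter_law_chain.
have mean0 : expS (law s0 n) (fun eta => maxJ (sigma *: (eta - mu))) @[n --> \oo] --> (0 : R).
  have := @chain_mean_cvg _ _ _ _ _ _ LS LE muI s0 _ mc i => cv.
  have -> : (0 : R) = sigma * (mu i 0 - mu i 0) by rewrite subrr mulr0.
  have bi : simplex_bounded (fun eta : 'cV[R]_d => eta i 0).
    apply: simplex_bounded_continuous; first exact: coord_cvg.
    exists 1 => eta etaS; rewrite (le_trans (coord_l1norm _ _))//.
    by rewrite simplex_l1norm.
  have bc := @simplex_bounded_cst R d (mu i 0).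
  have E n : expS (law s0 n) (fun eta => maxJ (sigma *: (eta - mu))) =
      sigma * (expS (law s0 n) (fun eta => eta i 0) - mu i 0).
    have [mS _] := mc n.
    transitivity (expS (law s0 n) (fun eta => sigma * (eta i 0 - mu i 0))).
      by apply: eq_expS => eta _; rewrite Ji max_over1 !mxE.
    by rewrite expSZ ?expSB ?expS_cst//; exact: simplex_boundedB.
  under eq_fun do rewrite E.
  by apply: cvgMr; apply: cvgB => //; exact: cvg_cst.
pose u n := expS (law s0 n) (fun eta => sigma * (max_coord eta - max_coord mu)) -
  expS (law s0 n) (fun eta => maxJ (sigma *: (eta - mu))).
have diff : u n @[n --> \oo] --> sigma * (prior_error mu - Perr sigma) - 0.
  by apply: cvgB => //; exact: error_gap_cvg.
have bound : `|sigma * (prior_error mu - Perr sigma) - 0 - 0| <= C * sigma^-1 ^+ p.+1.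
  by apply: (@cvgn_dist_le _ u _ 0 _ diff); exists N => n Nn; rewrite subr0; exact: HN.
rewrite !subr0 in bound *.
rewrite exprSr -mulrA normrM ger0_norm ?exprn_ge0 ?(ltW s0)//.
apply: le_trans (ler_wpM2l _ bound) _; first by rewrite exprn_ge0// ltW.
have -> : sigma ^+ p * (C * sigma^-1 ^+ p.+1) = C / sigma.
  rewrite exprVn exprS; field.
  by rewrite !gt_eqF// exprn_gt0.
by rewrite ler_pdivrMr// mulrC -ler_pdivrMr.
Qed.

End ErrorGap.

Theorem theorem2p4
    (R : realType) (d : nat) (a : 'I_d -> R) (a_inj : injective a)
    (Lam : 'M[R]_d) (Lam_stoch : stochastic_mx Lam) (Lam_erg : ergodic Lam)
    (nu mu : 'cV[R]_d) (nu_distr : simplex nu) (mu_inv : invariant_distr Lam mu)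
    (dT : measure_display) (T : measurableType dT) (P : probability T R)
    (X : nat -> {RV P >-> R}) (X_chain : markov_chain a Lam nu X)
    (h : R -> R)
    (xi : nat -> {RV P >-> R}) (xi_noise : std_gaussian_noise xi)
    (xi_X_indep : indep_processes P [set: nat] X [set m | (1 <= m)%N] xi)
    (M : R -> probability (borel_cV R d) R)
    (M_inv : forall sigma : R, 0 < sigma ->
       filter_invariant Lam (\col_i h (a i)) sigma (M sigma))
    (Perr : R -> R)
    (Perr_lim : forall sigma : R, 0 < sigma ->
       min_error P X (obs h sigma X xi) n @[n --> \oo] --> Perr sigma) :
  (exists! C : 'M[R]_d, limit_covariance Lam mu (\col_i h (a i)) C) /\
  forall (C : 'M[R]_d),
    limit_covariance Lam mu (\col_i h (a i)) C ->
  forall (dQ : measure_display) (TQ : measurableType dQ) (Q : probability TQ R)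
    (Z : 'I_d -> {RV Q >-> R}), centered_gaussian C Z ->
  [/\ forall F : 'cV[R]_d -> R, continuous F -> poly_growth F ->
        (\int[M sigma]_(eta in @simplex R d)
           (F (sigma *: ((eta : 'cV[R]_d) - mu)))%:E)%E @[sigma --> +oo] -->
        ('E_Q[fun w => F (\col_i Z i w)])%E,
      (sigma * (prior_error mu - Perr sigma))%:E @[sigma --> +oo] -->
        ('E_Q[fun w => max_over (maximal_atoms mu) (fun j => Z j w)])%E &
      (exists i, maximal_atoms mu = [set i]) ->
        forall p : nat, (1 <= p)%N ->
          sigma ^+ p * (prior_error mu - Perr sigma) @[sigma --> +oo] --> (0 : R)].
Proof.
set hv := \col_i h (a i).
have muS : simplex mu by case: mu_inv.
split.
  have [C HC] := limit_covariance_exists hv Lam_stoch Lam_erg mu_inv.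
  exists C; split => // C' HC'.
  exact: (limit_covariance_unique Lam_stoch Lam_erg mu_inv HC HC').
move=> C HC dQ TQ Q Z ZG; split.
- move=> F Fc Fg.
  rewrite [X in _ --> X](expZ_fin ZG Fc Fg).
  have mS sigma : 0 < sigma -> M sigma (@simplex R d) = 1%E.
    by move=> /M_inv[].
  have key sigma : 0 < sigma -> (\int[M sigma]_(eta in @simplex R d)
      (F (sigma *: ((eta : 'cV[R]_d) - mu)))%:E =
      (expS (M sigma) (fun eta => F (sigma *: (eta - mu))))%:E)%E.
    move=> s0; rewrite expS_fin ?mS//.
    by apply: simplex_bounded_centered => //; exact: ltW.
  apply: cvg_EFin.
    have : \forall s \near +oo, 0 < s :> R by apply: nbhs_pinfty_gt; rewrite num_real.
    by apply: filterS => s s0; rewrite key.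
  apply: cvg_pinfty_dist_le => delta delta0.
  have [s1 s1_ge1 Hs1] := chain_limit_gaussian Lam_stoch Lam_erg mu_inv HC ZG Fc Fg delta0.
  exists s1 => sigma s1s.
  have s0 : 0 < sigma by apply: lt_le_trans s1s; exact: lt_le_trans s1_ge1.
  have [N HN] := Hs1 _ s1s.
  (* Invariance makes the constant sequence a filter chain, so the chain limit can be read off at
     index [N]. *)
  have mc : filter_chain Lam hv sigma (fun=> M sigma).
    by move=> n; exact: M_inv.
  by rewrite /= key//; exact: HN mc N (leqnn N).
- pose maxJ := fun x : 'cV[R]_d => max_over (maximal_atoms mu) (fun i => x i 0).
  have J0 := maximal_atoms_neq0 muS.
  have Jc : continuous maxJ by exact: continuous_max_over.
  have Jg : poly_growth maxJ by exact: poly_growth_max_over.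
  have -> : (fun w => max_over (maximal_atoms mu) (fun j => Z j w)) = (fun w => maxJ (vecZ Z w)).
    by apply/funext => w; congr max_over; apply/funext => j; rewrite mxE.
  rewrite (expZ_fin ZG Jc Jg); apply: cvg_EFin; first by near=> s.
  exact: (error_gap_chain_limit a_inj Lam_stoch Lam_erg nu_distr mu_inv X_chain xi_noise
    xi_X_indep Perr_lim (chain_limit_gaussian Lam_stoch Lam_erg mu_inv HC ZG Jc Jg)).
- move=> J1 p p1.
  exact: (error_gap_superpolynomial a_inj Lam_stoch Lam_erg nu_distr mu_inv X_chain xi_noise
    xi_X_indep Perr_lim J1 p1).
Unshelve. all: by end_near.
Qed.
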